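(* Let $d\ge 2$, $\lambda>0$ and $s>0$ be fixed. Consider the mobile geometric graph in $\mathbb{R}^d$ with intensity $\lambda$ and range of motion $s$, and a target $u$ located at the origin at time $0$, independent of the nodes of the mobile geometric graph, which either stays fixed at the origin for all time or moves according to a $d$-dimensional Brownian motion with variance $s^2$ (independent of the nodes). Let $T_{\mathrm{det}}$ be the detection time of $u$. Then, as $t\to\infty$, $$\mathbf{Pr}[T_{\mathrm{det}}\ge t]=\exp\left(-\Theta(t/\log t)\right)\ \text{ if } d=2,\qquad \mathbf{Pr}[T_{\mathrm{det}}\ge t]=\exp\left(-\Theta(t)\right)\ \text{ if } d\ge 3 .$$ That is, there exist constants $0<c\le C<\infty$ and $t_0$, depending only on $\lambda$, $s$ and $d$, such that for all integers $t\ge t_0$: if $d=2$ then $\exp(-C t/\log t)\le \mathbf{Pr}[T_{\mathrm{det}}\ge t]\le \exp(-c t/\log t)$, and if $d\ge 3$ then $\exp(-Ct)\le \mathbf{Pr}[T_{\mathrm{det}}\ge t]\le \exp(-ct)$.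
   Context: Mobile geometric graph (MGG): let $\Pi_0$ be a Poisson point process of intensity $\lambda$ on $\mathbb{R}^d$ (its points are called nodes). Each node $v\in\Pi_0$ moves according to an independent $d$-dimensional Brownian motion $W_v$ started at the location of $v$ with variance $s^2$ (each coordinate increment over a time interval of length $h$ is $N(0,s^2h)$). For integers $i\ge 0$, $\Pi_i$ is the point process with a node at $W_v(i)$ for each $v\in\Pi_0$. The number $r=r(d)>0$ is fixed so that the Euclidean ball of radius $r$ in $\mathbb{R}^d$ has volume $1$. The MGG is the sequence of graphs $(G_i)_{i\ge0}$, where $G_i$ has node set $\Pi_i$ and an edge between each pair of nodes at Euclidean distance at most $r$. Detection: a node $v$ detects $u$ at time step $i$ if the distance between $v$ and $u$ at time $i$ is at most $r$. $T_{\mathrm{det}}$ is the first integer time step $i\ge0$ at which some node of the MGG detects $u$. *)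

(* Defs.v *)
From HB Require Import structures.
From mathcomp Require Import all_boot all_order all_algebra finmap.
From mathcomp Require Import all_classical all_reals all_analysis measurable_realfun.
Import Order.TTheory GRing.Theory Num.Theory.
Import numFieldNormedType.Exports.

Set Implicit Arguments.
Unset Strict Implicit.
Unset Printing Implicit Defensive.

Local Open Scope classical_set_scope.
Local Open Scope ring_scope.

(* Points of R^d are [d.-tuple R], whose library sigma-algebra is the one
   generated by the coordinates, i.e. the Borel sigma-algebra of R^d. *)

Section euclidean.
Context {R : realType}.

Definition edist (d : nat) (x y : d.-tuple R) : R :=
  Num.sqrt (\sum_(j < d) (tnth x j - tnth y j) ^+ 2).

Definition origin (d : nat) : d.-tuple R := [tuple 0 | _ < d].

Definition eball (d : nat) (x : d.-tuple R) (r : R) : set (d.-tuple R) :=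
  [set y | edist x y <= r].

(* d-dimensional Lebesgue measure on Borel sets, as the iterated product of
   [lebesgue_measure]: the successor case is the unfolding of [\x], integrating
   the measure of the sections over the first coordinate.  Its values on
   non-measurable sets are meaningless. *)
Fixpoint vol (d : nat) : set (d.-tuple R) -> \bar R :=
  match d with
  | 0 => fun A => (\1_A [tuple])%:E
  | d'.+1 => fun A =>
      (\int[lebesgue_measure]_x vol [set y : d'.-tuple R | A [tuple of x :: y]])%E
  end.

End euclidean.

Section independence.
Context {R : realType} {dO : measure_display} {O : measurableType dO}.
Variable P : probability O R.

Definition indep (I : choiceType) (F : I -> set (set O)) : Prop :=
  forall (J : {fset I}) (E : I -> set O),
    (forall i, i \in J -> F i (E i)) ->
    P (\bigcap_(i in [set` J]) E i) = (\prod_(i <- J) P (E i))%E.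

Definition indep2 (F G : set (set O)) : Prop :=
  forall A B, F A -> G B -> P (A `&` B) = (P A * P B)%E.

Definition sigma_rv (dT : measure_display) (T : measurableType dT)
    (f : O -> T) : set (set O) :=
  preimage_set_system setT f measurable.

Definition sigma_process (I : Type) (D : set I)
    (dT : measure_display) (T : measurableType dT) (f : I -> O -> T)
    : set (set O) :=
  <<s \bigcup_(i in D) sigma_rv (f i) >>.

End independence.

(* Processes in continuous time are indexed by all of R, but only their
   values at times t >= 0 are ever constrained or used. *)
Section brownian.
Context {R : realType} {dO : measure_display} {O : measurableType dO}.
Variable P : probability O R.

(* The second argument of [normal_prob] is the standard deviation.
   Independence of finitely many successive increments is expressed with
   infinite nondecreasing sequences of times: a finite sequence can be
   prolonged by a constant one. *)
Definition is_brownian1 (s : R) (b : R -> O -> R) : Prop :=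
  [/\ {ae P, forall w, b 0 w = 0},
      (forall t : nat -> R,
         0 <= t 0%N -> (forall i j, (i <= j)%N -> t i <= t j) ->
         indep P (fun k => sigma_rv (fun w => b (t k.+1) w - b (t k) w))),
      (forall t h : R, 0 <= t -> 0 < h ->
         forall A : set R, measurable A ->
         P ((fun w => b (t + h) w - b t w) @^-1` A) =
         normal_prob 0 (s * Num.sqrt h) A)
    & {ae P, forall w, {within [set t | 0 <= t], continuous (b ^~ w)}}].

(* d-dimensional Brownian motion of variance s^2 started at the origin *)
Definition is_brownian (d : nat) (s : R) (B : R -> O -> d.-tuple R) : Prop :=
  (forall j : 'I_d, is_brownian1 s (fun t w => tnth (B t w) j)) /\
  indep P (fun j : 'I_d =>
    sigma_process [set t : R | 0 <= t] (fun t w => tnth (B t w) j)).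

End brownian.

Section mobile_geometric_graph.
Context {R : realType} {dO : measure_display} {O : measurableType dO}.
Variables (P : probability O R) (d : nat).

(* A point process is presented by an enumeration (X n) of its points; a
   Poisson process of positive intensity on R^d has infinitely many points
   almost surely, so that no partial enumeration is needed. *)
Definition npoints (X : nat -> O -> d.-tuple R) (A : set (d.-tuple R)) (w : O)
    : \bar R :=
  counting [set n | A (X n w)].

(* The library's [poisson_pmf] is not used because it is not the Poisson
   distribution at rate 0, which occurs here for null sets A. *)
Definition is_poisson_process (lambda : R) (X : nat -> O -> d.-tuple R) : Prop :=
  (forall A : set (d.-tuple R), measurable A -> (vol A < +oo)%E ->
     forall k : nat,
     let rate := lambda * fine (vol A) in
     P [set w | npoints X A w = k%:R%:E] =
     (rate ^+ k / k`!%:R * expR (- rate))%:E) /\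
  (forall A : nat -> set (d.-tuple R),
     (forall i, measurable (A i)) -> trivIset setT A ->
     indep P (fun i => sigma_rv (npoints X (A i)))).

Variables (X : nat -> {mfun O >-> d.-tuple R})
          (B : nat -> R -> {mfun O >-> d.-tuple R})
          (u : R -> {mfun O >-> d.-tuple R}).

Definition sigma_start : set (set O) := sigma_process setT X.

Definition sigma_motion (n : nat) : set (set O) :=
  sigma_process [set t : R | 0 <= t] (B n).

Definition sigma_nodes : set (set O) :=
  <<s sigma_start `|` \bigcup_n sigma_motion n >>.

(* [B n] is the displacement of node n, i.e. W_v - W_v(0) *)
Definition is_mgg (lambda s : R) : Prop :=
  [/\ is_poisson_process lambda X,
      (forall n, is_brownian P s (B n))
    & indep P (fun k : option nat =>
        if k is Some n then sigma_motion n else sigma_start)].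

Definition is_target (s : R) : Prop :=
  ((forall (t : R) (w : O), 0 <= t -> u t w = origin d) \/ is_brownian P s u) /\
  indep2 P (sigma_process [set t : R | 0 <= t] u) sigma_nodes.

Definition node_pos (n i : nat) (w : O) : d.-tuple R :=
  [tuple tnth (X n w) j + tnth (B n i%:R w) j | j < d].

Definition detects (r : R) (n i : nat) (w : O) : Prop :=
  edist (node_pos n i w) (u i%:R w) <= r.

(* +oo when the target is never detected *)
Definition Tdet (r : R) (w : O) : \bar R :=
  ereal_inf [set i%:R%:E | i in [set i : nat | exists n, detects r n i w]].

End mobile_geometric_graph.

(* Main.v *)
Require Import Defs.
From HB Require Import structures.
From mathcomp Require Import all_boot all_order all_algebra finmap.
From mathcomp Require Import zify ring lra.
From mathcomp Require Import all_classical all_reals all_analysis measurable_realfun.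
Import Order.TTheory GRing.Theory Num.Theory.
Import numFieldNormedType.Exports.
Import HBNNSimple.
Local Open Scope classical_set_scope.
Local Open Scope ring_scope.

Set Implicit Arguments.
Unset Strict Implicit.
Unset Printing Implicit Defensive.

(* Conditionally on the path g of the target, the nodes that ever come within
   distance r of g during the first t steps form a Poisson number of points
   (thinning), so the survival probability is E exp(-lambda V(U)), where U is
   the path of the target and V(g) is the integral over the starting point x of
   the probability that a walk from x meets g.
   Upper bound, uniformly in g: if M is the number of steps at which the walk is
   within r of g, then 1{M > 0} >= 2 M/K - (M/K)^2, int E M = t, and
   int E M^2 <= t K with K of order sum_(k < t) k^(-d/2), because two visits k
   steps apart force an increment of the walk into a fixed ball.  Hence
   V(g) >= t/K, and K is O(log t) if d = 2 and O(1) if d >= 3.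
   Lower bound: V(g) <= t always, which is enough for d >= 3.  For d = 2, by
   Jensen it is enough to bound E V(U), the integral over x of the probability
   that the difference walk from x hits the ball; once it is in the ball it makes
   on average at least a constant times log t visits in the next t steps, while
   the integral over x of the mean number of visits before 2t is 2t. *)

(** * Powers of a sigma-finite measure *)

(** Time is sampled at integers, so a path enters only through its t increments. These are
    independent, so the law of a path is an iterated product measure, and averages over starting
    points, walks and targets are exchanged by Tonelli. The Poisson process is known only through
    its counts on sets; the laws of the individual [X n] are not given. Thinning is therefore not
    performed on configurations: with the starting points frozen, each node misses g with one minus
    its hitting probability, and the resulting product over n is evaluated by the Laplace
    functional, itself derived from the counts. The quadratic minorant of the indicator is (1 -
    M/K)^2 >= 0 rearranged. It involves only the first two moments of M, and since Lebesgue measure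
    is translation invariant each step has mass exactly one whatever g is; this makes the bound
    uniform in g, so that a moving target costs nothing there. In the plane no bound of order t /
    log t holds from above uniformly in g: a path that moves away fast can have V(g) of order t.
    Hence the average over the target; a fixed target counts as a walk with null steps, so one
    difference walk covers both cases. *)

Section tuple_cons.
Context d (T : measurableType d) (n : nat).

Definition tcons (z : T * n.-tuple T) : n.+1.-tuple T := [tuple of z.1 :: z.2].

Lemma measurable_tcons : measurable_fun setT tcons.
Proof. exact: measurable_cons. Qed.

HB.instance Definition _ := isMeasurableFun.Build _ _ _ _ tcons measurable_tcons.

End tuple_cons.

Section cons_measure.
Context d (T : measurableType d) (R : realType) (n : nat).
Variables (mu : {sigma_finite_measure set T -> \bar R})
  (nu : {sigma_finite_measure set (n.-tuple T) -> \bar R}).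

Definition cons_measure : set (n.+1.-tuple T) -> \bar R :=
  pushforward (mu \x nu)%E (@tcons _ T n).

Let cons_measure' := measure_function_pushforward__canonical__measure_function_Measure
  (mu \x nu)%E (@measurable_tcons _ T n).

HB.instance Definition _ := isMeasure.Build _ _ _ cons_measure
  (measure0 cons_measure') (measure_ge0 cons_measure') (@measure_semi_sigma_additive _ _ _ cons_measure').

Definition tuncons (y : n.+1.-tuple T) : T * n.-tuple T :=
  (thead y, [tuple of behead y]).

Lemma measurable_tuncons : measurable_fun setT tuncons.
Proof.
by apply/measurable_fun_pairP; split; [exact: measurable_tnth|exact: measurable_behead].
Qed.

Lemma tconsK (z : T * n.-tuple T) : tuncons (tcons z) = z.
Proof. by case: z => x y; congr pair; apply: val_inj. Qed.

Lemma cons_measure_sigma_finite : sigma_finite setT cons_measure.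
Proof.
have /sigma_finiteP[F [TF ndF Foo]] := sigma_finiteT mu.
have /sigma_finiteP[G [TG ndG Goo]] := sigma_finiteT nu.
exists (fun k => tuncons @^-1` (F k `*` G k)).
  rewrite -preimage_bigcup predeqE => y; split => // _.
  have [k _ Fk] : (\bigcup_k F k) (tuncons y).1 by rewrite -TF.
  have [l _ Gl] : (\bigcup_k G k) (tuncons y).2 by rewrite -TG.
  exists (maxn k l) => //; split.
    by move: Fk; exact/subsetPset/ndF/leq_maxl.
  by move: Gl; exact/subsetPset/ndG/leq_maxr.
move=> k; have [mF Fkoo] := Foo k; have [mG Gkoo] := Goo k; split.
  by rewrite -[X in measurable X]setTI; apply: measurable_tuncons => //; exact: measurableX.
rewrite /cons_measure /pushforward (_ : _ @^-1` _ = F k `*` G k).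
  by rewrite product_measure1E// lte_mul_pinfty// ge0_fin_numE.
by apply/seteqP; split => z; rewrite /preimage/mkset tconsK.
Qed.

HB.instance Definition _ := Measure_isSigmaFinite.Build _ _ _ cons_measure cons_measure_sigma_finite.

Lemma cons_measure_integral (f : n.+1.-tuple T -> \bar R) :
  measurable_fun setT f -> (forall x, 0 <= f x)%E ->
  (\int[cons_measure]_y f y = \int[mu]_x \int[nu]_z f [tuple of x :: z])%E.
Proof.
move=> mf f0; rewrite ge0_integral_pushforward//= preimage_setT.
rewrite (@fubini_tonelli1 _ _ _ _ _ mu nu (f \o @tcons _ T n))//.
- by apply: measurableT_comp => //; exact: measurable_tcons.
- by move=> z; exact: f0.
Qed.

End cons_measure.

Section power_measure.
Context d (T : measurableType d) (R : realType).

(** One construction plays several roles: Lebesgue measure on R^d, the Gaussian law of one step,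
    and, as a power of a power, the law of t independent steps. Sigma-finiteness is bundled so that
    Tonelli applies at every level. *)
Fixpoint powm (mu : {sigma_finite_measure set T -> \bar R}) (n : nat) :
    {sigma_finite_measure set (n.-tuple T) -> \bar R} :=
  match n with
  | 0 => \d_([tuple] : 0.-tuple T)
  | n'.+1 => cons_measure mu (powm mu n')
  end.

Variable mu : {sigma_finite_measure set T -> \bar R}.

Lemma powm_integral0 (f : 0.-tuple T -> \bar R) :
  measurable_fun setT f -> (\int[powm mu 0]_y f y = f [tuple])%E.
Proof. by move=> mf; rewrite integral_dirac// diracT mul1e. Qed.

Lemma powm_integralS n (f : n.+1.-tuple T -> \bar R) :
  measurable_fun setT f -> (forall x, 0 <= f x)%E ->
  (\int[powm mu n.+1]_y f y = \int[mu]_x \int[powm mu n]_z f [tuple of x :: z])%E.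
Proof. exact: cons_measure_integral. Qed.

Lemma powm_consE n (A : set (n.+1.-tuple T)) :
  powm mu n.+1 A = (\int[mu]_x powm mu n [set z : n.-tuple T | A [tuple of x :: z]])%E.
Proof.
apply: eq_integral => x _ /=; congr (powm mu n _).
by apply/seteqP; split => z; rewrite /xsection/= in_setE.
Qed.

Lemma measurable_powm_section n (A : set (n.+1.-tuple T)) : measurable A ->
  measurable_fun setT (fun x => powm mu n [set z : n.-tuple T | A [tuple of x :: z]]).
Proof.
move=> mA; have mB : measurable (@tcons _ T n @^-1` A).
  by have := @measurable_tcons _ T n measurableT A mA; rewrite setTI.
have := measurable_fun_xsection (powm mu n) mB.
congr (measurable_fun _ _); apply/funext => x /=; congr (powm mu n _).
by apply/seteqP; split => z; rewrite /xsection/= in_setE.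
Qed.

Definition rect n (E : 'I_n -> set T) : set (n.-tuple T) :=
  [set a | forall i, E i (tnth a i)].

Lemma measurable_rect n (E : 'I_n -> set T) :
  (forall i, measurable (E i)) -> measurable (rect E).
Proof.
move=> mE; rewrite (_ : rect E = \bigcap_(i in setT) ((@tnth n T)^~ i @^-1` E i)).
  apply: fin_bigcap_measurable => // i _; rewrite -[X in measurable X]setTI.
  exact: measurable_tnth.
by apply/seteqP; split => a; [move=> h i _; exact: h|move=> h i; exact: h].
Qed.

Lemma powm_rect n (E : 'I_n -> set T) : (forall i, measurable (E i)) ->
  powm mu n (rect E) = (\prod_(i < n) mu (E i))%E.
Proof.
elim: n E => [|n ih] E mE.
  rewrite big_ord0 /= diracE (_ : _ \in _ = true)//; apply/mem_set.
  by case.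
rewrite big_ord_recl -ih// /= /cons_measure /pushforward.
have -> : @tcons _ T n @^-1` rect E = E ord0 `*` rect (fun i => E (lift ord0 i)).
  apply/seteqP; split => -[x y] /=.
    move=> h; split=> [|i]; first exact: (h ord0).
    by have := h (lift ord0 i); rewrite /tcons tnthS.
  move=> [h0 h] i; case: (unliftP ord0 i) => [j ->|->//].
  by rewrite tnthS; exact: h.
by rewrite product_measure1E//; exact: measurable_rect.
Qed.

Lemma powm_setT n : mu setT = 1%E -> powm mu n setT = 1%E.
Proof.
move=> mu1; rewrite (_ : setT = rect (fun _ : 'I_n => setT)).
  by rewrite powm_rect// mu1 big1.
by apply/seteqP; split.
Qed.

End power_measure.

Section rect_generation.
Context d (T : measurableType d) (n : nat).

Definition rects (G : set (set T)) : set (set (n.-tuple T)) :=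
  [set rect E | E in [set E : 'I_n -> set T | forall i, G (E i)]].

Lemma rects_setI_closed G : setI_closed G -> setI_closed (rects G).
Proof.
move=> GI _ _ [E GE <-] [F GF <-]; exists (fun i => E i `&` F i).
  by move=> i; exact: GI.
by apply/seteqP; split => a /=; [move=> h; split => i; case: (h i)|move=> [h k] i].
Qed.

Lemma rects_setT G : G setT -> rects G setT.
Proof. by move=> GT; exists (fun=> setT) => //; apply/seteqP; split. Qed.

(** Measurability into tuples is coordinatewise, and a condition on one coordinate is the rectangle
    whose other sides are [setT]; this is where [G setT] enters. *)
Lemma measurable_rects G : G setT -> measurable = <<s G >> ->
  measurable = <<s rects G >>.
Proof.
move=> GT mG; apply/seteqP; split; last first.
  apply: smallest_sub; first exact: sigma_algebra_measurable.
  move=> _ [E GE <-]; apply: measurable_rect => i.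
  by rewrite mG; apply: sub_sigma_algebra; exact: GE.
have mid : measurable_fun setT
    (idfun : g_sigma_algebraType (rects G) -> n.-tuple T).
  apply/measurable_fun_tnthP => i.
  apply: (measurability G) => // _ [A GA <-].
  apply: sub_sigma_algebra; exists (fun j => if j == i then A else setT).
    by move=> j; case: ifP.
  apply/seteqP; split => a /=.
    by move=> /(_ i); rewrite eqxx.
  by move=> -[_ Aa] j; case: eqP => // ->.
by move=> A mA; have := mid measurableT A mA; rewrite setTI.
Qed.

End rect_generation.

Lemma finite_measure_unique d (T : measurableType d) (R : realType)
    (G : set (set T)) (m1 m2 : {measure set T -> \bar R}) :
  measurable = <<s G >> -> setI_closed G -> G setT -> (m1 setT < +oo)%E ->
  (forall A, G A -> m1 A = m2 A) -> forall A, measurable A -> m1 A = m2 A.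
Proof.
move=> mG GI GT m1oo m12 A mA.
apply: (measure_unique G (fun=> setT)) => //.
by rewrite bigcup_const.
Qed.

Lemma setI_closed_measurable d (T : measurableType d) : setI_closed (@measurable _ T).
Proof. by move=> A B; exact: measurableI. Qed.

Lemma measurable_sigma d (T : measurableType d) : @measurable _ T = <<s measurable >>.
Proof. by apply/esym/sigma_algebra_id; exact: sigma_algebra_measurable. Qed.

(** * Lebesgue measure on R^d and its translations *)

Section volume.
Context {R : realType}.

(* [d.-tuple R] is built on the default display of R, whereas [lebesgue_measure]
   and [normal_prob] live on [measurableTypeR R]: same sets, different display. *)
Lemma measurable_toR : measurable_fun setT (idfun : measurableTypeR R -> R).
Proof. by move=> _ A mA; rewrite setTI. Qed.

Definition on_default_display (m : {measure set (measurableTypeR R) -> \bar R}) : set R -> \bar R :=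
  pushforward m (idfun : measurableTypeR R -> R).

Section on_default_display.
Variable m : {measure set (measurableTypeR R) -> \bar R}.
Let m' := measure_function_pushforward__canonical__measure_function_Measure
  m measurable_toR.

HB.instance Definition _ := isMeasure.Build _ _ _ (on_default_display m)
  (measure0 m') (measure_ge0 m') (@measure_semi_sigma_additive _ _ _ m').

End on_default_display.

Lemma on_default_display_integral (m : {measure set (measurableTypeR R) -> \bar R}) (f : R -> \bar R) :
  measurable_fun setT f -> (forall x, 0 <= f x)%E ->
  (\int[on_default_display m]_x f x = \int[m]_x f x)%E.
Proof.
move=> mf f0.
have := @ge0_integral_pushforward _ _ _ _ R _ measurable_toR m setT f measurableT mf.
by rewrite preimage_setT => <-.
Qed.

Definition lebesgue_R : set R -> \bar R := on_default_display lebesgue_measure.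

HB.instance Definition _ := Measure.on lebesgue_R.

Lemma lebesgue_R_sigma_finite : sigma_finite setT lebesgue_R.
Proof.
have [F TF Foo] := sigma_finiteT (@lebesgue_measure R).
by exists F => // k; have [mF Fk] := Foo k.
Qed.

HB.instance Definition _ := Measure_isSigmaFinite.Build _ _ _ lebesgue_R lebesgue_R_sigma_finite.

Definition vol_measure (d : nat) : {sigma_finite_measure set (d.-tuple R) -> \bar R} :=
  powm lebesgue_R d.

Lemma volE (d : nat) (A : set (d.-tuple R)) : measurable A -> vol A = vol_measure d A.
Proof.
elim: d A => [|d ih] A mA; first by rewrite /= diracE indicE.
have mS (x : R) : measurable [set z : d.-tuple R | A [tuple of x :: z]].
  have mc : measurable_fun setT (fun z : d.-tuple R => [tuple of x :: z]).
    exact: measurable_cons.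
  by have := mc measurableT A mA; rewrite setTI.
rewrite powm_consE /= on_default_display_integral//; last exact: measurable_powm_section.
by apply: eq_integral => x _; rewrite ih.
Qed.

(** The image of Lebesgue measure under a translation agrees with it on half-open intervals, which
    determine it. *)
Lemma lebesgue_R_shift (a : R) (A : set R) : measurable A ->
  lebesgue_R [set x | A (x + a)] = lebesgue_R A.
Proof.
move=> mA; have ma : measurable_fun setT (fun x : measurableTypeR R => x + a : measurableTypeR R).
  exact: measurable_funD.
apply/esym; pose mu := measure_function_pushforward__canonical__measure_function_Measure
  (@lebesgue_measure R) ma.
apply: (@lebesgue_measure_unique _ mu) => // _ [[b c] _ <-].
rewrite /mu/= /pushforward.
have -> : (fun x => x + a) @^-1` `]b, c]%classic = `]b - a, c - a]%classic.
  by apply/seteqP; split => x/=; rewrite !in_itv/= ltrBlDr lerBrDr.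
rewrite !lebesgue_measure_itv/= !lte_fin ltrD2r.
by case: ifP => // _; rewrite -!EFinB opprB addrA subrK.
Qed.

Lemma lebesgue_R_integral_shift (a : R) (f : R -> \bar R) :
  measurable_fun setT f -> (forall x, 0 <= f x)%E ->
  (\int[lebesgue_R]_x f (x + a)%R = \int[lebesgue_R]_x f x)%E.
Proof.
move=> mf f0; have ma : measurable_fun setT (fun x : R => x + a).
  exact: measurable_funD.
have := @ge0_integral_pushforward _ _ _ _ R _ ma lebesgue_R setT f measurableT mf.
rewrite preimage_setT => <- //.
by apply: eq_measure_integral => //= A mA _; exact/lebesgue_R_shift.
Qed.

Definition vec_add (d : nat) (x y : d.-tuple R) : d.-tuple R :=
  [tuple tnth x j + tnth y j | j < d].

Definition vec_opp (d : nat) (x : d.-tuple R) : d.-tuple R := [tuple - tnth x j | j < d].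

Lemma measurable_tnthT d0 (T : measurableType d0) d1 (T' : measurableType d1) d
    (f : T -> d.-tuple T') i :
  measurable_fun setT f -> measurable_fun setT (fun x => tnth (f x) i).
Proof. by move/measurable_fun_tnthP => /(_ i). Qed.

Lemma measurable_vec_add d0 (T : measurableType d0) d (f g : T -> d.-tuple R) :
  measurable_fun setT f -> measurable_fun setT g ->
  measurable_fun setT (fun x => vec_add (f x) (g x)).
Proof.
move=> mf mg; apply/measurable_fun_tnthP => i.
rewrite (_ : _ \o _ = (fun x => tnth (f x) i + tnth (g x) i)); last first.
  by apply/funext => x /=; rewrite tnth_mktuple.
by apply: measurable_funD; exact: measurable_tnthT.
Qed.

Lemma measurable_vec_opp d0 (T : measurableType d0) d (f : T -> d.-tuple R) :
  measurable_fun setT f -> measurable_fun setT (fun x => vec_opp (f x)).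
Proof.
move=> mf; apply/measurable_fun_tnthP => i.
rewrite (_ : _ \o _ = (fun x => - tnth (f x) i)); last first.
  by apply/funext => x /=; rewrite tnth_mktuple.
by apply: measurableT_comp => //; exact: measurable_tnthT.
Qed.

Lemma vol_measure_integral_shift (d : nat) (a : d.-tuple R) (f : d.-tuple R -> \bar R) :
  measurable_fun setT f -> (forall x, 0 <= f x)%E ->
  (\int[vol_measure d]_x f (vec_add x a) = \int[vol_measure d]_x f x)%E.
Proof.
elim: d a f => [|d ih] a f mf f0.
  by congr integral; apply/funext => x; congr f; rewrite [LHS]tuple0 [RHS]tuple0.
rewrite !powm_integralS//; last first.
  by apply: measurableT_comp => //; apply: measurable_vec_add.
have mcons x : measurable_fun setT (fun z : d.-tuple R => [tuple of x :: z]).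
  by apply: measurable_cons.
transitivity (\int[lebesgue_R]_x (\int[vol_measure d]_z f [tuple of (x + thead a)%R :: z]))%E.
  apply: eq_integral => x _.
  rewrite -(ih [tuple of behead a])//; last by apply: measurableT_comp.
  apply: eq_integral => z _; congr f; apply: eq_from_tnth => i.
  rewrite tnth_mktuple [a in LHS]tuple_eta.
  case: (unliftP ord0 i) => [j ->|->//].
  by rewrite !tnthS tnth_mktuple.
rewrite (@lebesgue_R_integral_shift (thead a) (fun y => \int[vol_measure d]_z f [tuple of y :: z])%E)//.
- apply: (@measurable_fun_fubini_tonelli_F _ _ _ _ R (vol_measure d) (f \o @tcons _ R d)).
  + by apply: measurableT_comp => //; exact: measurable_tcons.
  + by move=> z; exact: f0.
- by move=> x; apply: integral_ge0 => z _; exact: f0.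
Qed.

End volume.

(** * Laplace functional of a Poisson process *)

Section discrete_independence.
Context {R : realType} {dO : measure_display} {O : measurableType dO}.
Variable P : probability O R.
Context dT (T : measurableType dT).
Variables (Y : nat -> O -> T) (y : nat -> T).
Hypothesis yinj : injective y.
Hypothesis mY : forall i, measurable_fun setT (Y i).
Hypothesis my : forall k, measurable [set y k].
Hypothesis iY : indep P (fun i => sigma_rv (Y i)).
Variable g : nat -> nat -> R.
Hypothesis g0 : forall i k, 0 <= g i k.

Definition discrete_mean (i : nat) : \bar R :=
  (\sum_(k <oo) (g i k)%:E * P (Y i @^-1` [set y k]))%E.

Hypothesis gfin : forall i, discrete_mean i \is a fin_num.

(** This is [g i] at the index of [Y i w] in the list of values [y], and 0 when [Y i w] is none of
    them. The form of a series with at most one nonzero term lets monotone convergence replace any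
    computation with conditional laws. *)
Definition discrete_fun (i : nat) (w : O) : \bar R :=
  (\sum_(k <oo) (g i k * \1_(Y i @^-1` [set y k]) w)%:E)%E.

Lemma discrete_fun_eq i w k : Y i w = y k -> discrete_fun i w = (g i k)%:E.
Proof.
move=> Yk; rewrite /discrete_fun (@nneseriesD1 _ _ k)//; last first.
  by move=> j _; rewrite lee_fin mulr_ge0.
rewrite eseries0 ?adde0; last first.
  move=> j _ /andP[_ jk]; rewrite indicE memNset ?mulr0//= Yk => /yinj kj.
  by rewrite kj eqxx in jk.
by rewrite indicE mem_set ?mulr1.
Qed.

Lemma discrete_fun_eq0 i w : (forall k, Y i w <> y k) -> discrete_fun i w = 0%E.
Proof.
move=> Yk; rewrite /discrete_fun eseries0// => j _ _.
by rewrite indicE memNset ?mulr0//=; exact: Yk.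
Qed.

Lemma discrete_fun_fin i w : discrete_fun i w \is a fin_num.
Proof.
have [[k Yk]|/forallNP Yk] := pselect (exists k, Y i w = y k).
  by rewrite (discrete_fun_eq Yk).
by rewrite discrete_fun_eq0.
Qed.

Lemma discrete_fun_ge0 i w : (0 <= discrete_fun i w)%E.
Proof. by apply: nneseries_ge0 => k _ _; rewrite lee_fin mulr_ge0. Qed.

Let mpre i (A : set T) : measurable A -> measurable (Y i @^-1` A).
Proof. by move=> mA; rewrite -[X in measurable X]setTI; exact: mY. Qed.

Let mterm i k : measurable_fun setT (fun w => (g i k * \1_(Y i @^-1` [set y k]) w)%:E).
Proof.
by apply/measurable_EFinP; apply: measurable_funM => //; apply: measurable_indic; exact: mpre.
Qed.

Lemma measurable_discrete_fun i : measurable_fun setT (discrete_fun i).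
Proof.
apply: ge0_emeasurable_sum => //.
by move=> k w _ _; rewrite lee_fin mulr_ge0.
Qed.

(* The events on the indices m <= i < K make the induction on m go through:
   expanding the m-th factor over the values of Y m turns it into such an event. *)
Lemma integral_prod_discrete_fun (K m : nat) (E : nat -> set T) : (m <= K)%N ->
  (forall i, measurable (E i)) ->
  (\int[P]_w ((\prod_(i < m) discrete_fun i w) *
     (\1_[set w | forall i, (m <= i < K)%N -> E i (Y i w)] w)%:E) =
   (\prod_(i < m) discrete_mean i) *
     \prod_(m <= i < K) P (Y i @^-1` E i))%E.
Proof.
have mS n (F : nat -> set T) : (forall i, measurable (F i)) ->
    measurable [set w | forall i, (n <= i < K)%N -> F i (Y i w)].
  move=> mF; rewrite (_ : [set w | _] =
    \bigcap_(i in [set i | (n <= i < K)%N]) (Y i @^-1` F i))//.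
  by apply: bigcap_measurableType => i _; exact: mpre.
elim: m E => [|m ih] E mK mE.
  under eq_integral do rewrite big_ord0 mul1e.
  rewrite big_ord0 mul1e integral_indic ?setIT//; last exact: mS.
  have JE i : (i \in [fset i in iota 0 K]%fset) = (i < K)%N.
    by rewrite !inE/= mem_iota.
  rewrite (_ : [set w | _] =
    \bigcap_(i in [set` [fset i in iota 0 K]%fset]) (Y i @^-1` E i)); last first.
    apply/seteqP; split => w /= h i.
      by move=> /= iJ; apply: h; rewrite -JE.
    by move=> /= iK; apply: h => /=; rewrite JE.
  transitivity (\prod_(i <- [fset i in iota 0 K]%fset) P (Y i @^-1` E i))%E.
    by apply: iY => i _; exists (E i) => //; rewrite setTI.
  rewrite /index_iota subn0; apply: perm_big; apply: uniq_perm; first exact: fset_uniq.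
    exact: iota_uniq.
  by move=> i; rewrite [LHS]JE mem_iota.
pose E' k i := if i == m then [set y k] else E i.
have mE' k i : measurable (E' k i) by rewrite /E'; case: ifP.
pose H k w := ((g m k)%:E * ((\prod_(i < m) discrete_fun i w) *
     (\1_[set w | forall i, (m <= i < K)%N -> E' k i (Y i w)] w)%:E))%E.
have pd0 n w : (0 <= \prod_(i < n) discrete_fun i w)%E.
  by apply: prode_ge0 => i _; exact: discrete_fun_ge0.
have H0 k w : (0 <= H k w)%E.
  by rewrite /H !mule_ge0// ?lee_fin.
have mpd n : measurable_fun setT (fun w => \prod_(i < n) discrete_fun i w)%E.
  elim: n => [|n ihn]; first by under eq_fun do rewrite big_ord0; exact: measurable_cst.
  under eq_fun do rewrite big_ord_recr/=.
  by apply: emeasurable_funM => //; exact: measurable_discrete_fun.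
have mH k : measurable_fun setT (H k).
  apply: emeasurable_funM => //; apply: emeasurable_funM => //.
  by apply/measurable_EFinP; apply: measurable_indic; exact: mS.
transitivity (\int[P]_w \sum_(k <oo) H k w)%E.
  apply: eq_integral => w _; rewrite big_ord_recr /= -muleA.
  have pfin : (\prod_(i < m) discrete_fun i w)%E \is a fin_num.
    by apply: prode_fin_num => i _; exact: discrete_fun_fin.
  have mS1 k : ((\1_[set w0 | forall i, (m <= i < K)%N -> E' k i (Y i w0)] w)%:E =
      (\1_(Y m @^-1` [set y k]) w)%:E *
      (\1_[set w0 | forall i, (m < i < K)%N -> E i (Y i w0)] w)%:E :> \bar R)%E.
    rewrite -EFinM; congr EFin; transitivity (\1_((Y m @^-1` [set y k]) `&`
        [set w0 | forall i, (m < i < K)%N -> E i (Y i w0)]) w : R); last by rewrite indicI.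
    congr (\1_ _ _).
    apply/seteqP; split => v /=.
      move=> h; split; first by have := h m; rewrite /E' eqxx leqnn mK; exact.
      move=> i /andP[mi iK]; have := h i.
      by rewrite /E' gtn_eqF// (ltnW mi) iK; exact.
    move=> [hm h] i /andP[mi iK]; rewrite /E'; case: eqP => [->//|/eqP im].
    by apply: h; rewrite iK andbT ltn_neqAle eq_sym im.
  rewrite -(fineK pfin) [LHS]muleC -muleA -EFinM [LHS]muleC /discrete_fun.
  rewrite -nneseriesZl; last by move=> k _; rewrite lee_fin mulr_ge0.
  apply: eq_eseriesr => k _; rewrite /H mS1 -(fineK pfin) -!EFinM; congr EFin.
  by rewrite /=; ring.
rewrite integral_nneseries//.
under eq_eseriesr => k _.
  rewrite ge0_integralZl ?lee_fin//; last 2 first.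
  - by apply: emeasurable_funM => //; apply/measurable_EFinP; apply: measurable_indic; exact: mS.
  - by move=> w _; rewrite mule_ge0// lee_fin.
  rewrite ih ?(ltnW mK)// big_ltn// {1}/E' eqxx.
  rewrite (eq_big_nat _ _ (F2 := fun i => P (Y i @^-1` E i))); last first.
    by move=> i /andP[mi _]; rewrite /E' gtn_eqF.
  over.
have fP : (\prod_(m.+1 <= i < K) P (Y i @^-1` E i))%E \is a fin_num.
  by apply: prode_fin_num => i _; rewrite fin_num_measure//; exact: mpre.
have fE : (\prod_(i < m) discrete_mean i)%E \is a fin_num.
  by apply: prode_fin_num => i _.
rewrite big_ord_recr/= -(fineK fP) -(fineK fE) [RHS]muleAC -EFinM /discrete_mean.
rewrite -nneseriesZl; last by move=> k _; rewrite mule_ge0 ?lee_fin.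
apply: eq_eseriesr => k _.
by rewrite -(fineK (fin_num_measure P _ (mpre m (my k)))) -!EFinM; congr EFin; ring.
Qed.

End discrete_independence.

Section laplace_aux.
Context {R : realType}.

(** A finite count forces S to be finite, so the partial products are stationary beyond its last
    element. *)
Lemma counting_prod_cvg (S : set nat) (k : nat) (a : R) :
  counting S = k%:R%:E :> \bar R ->
  (\prod_(n < N) (1 - a * \1_S n)) @[N --> \oo] --> ((1 - a) ^+ k : R).
Proof.
rewrite /counting; case: asboolP => // finS [/eqP]; rewrite eqr_nat => /eqP Sk.
apply: cvg_near_cst.
have [M SM] : exists M : nat, forall n, S n -> (n < M)%N.
  (* The sum of the elements of S dominates each of them, which spares a maximum. *)
  exists (\sum_(i <- fset_set S) i).+1 => n Sn.
  rewrite ltnS (big_fsetD1 n)/= ?leq_addr//.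
  by rewrite in_fset_set// mem_set.
near=> N.
have MN : (M <= N)%N by near: N; exact: nbhs_infty_ge.
rewrite -(big_mkord xpredT (fun n => 1 - a * \1_S n)).
rewrite (eq_bigr (fun n => if n \in fset_set S then 1 - a else 1)); last first.
  by move=> n _; rewrite indicE in_fset_set//; case: (_ \in _); rewrite ?mulr1// mulr0 subr0.
rewrite -big_mkcond/= -big_filter big_const_seq count_predT -Sk.
rewrite (_ : size _ = #|` fset_set S|).
  by rewrite iter_mulr_1.
apply/perm_size/uniq_perm; [exact/filter_uniq/iota_uniq|exact: fset_uniq|].
move=> n; rewrite mem_filter mem_index_iota /= andb_idr//.
by rewrite in_fset_set// inE => /SM /leq_trans; exact.
Unshelve. all: by end_near. Qed.

(** The generating function of the Poisson law at 1 - a. The case a = 0 also serves: it says that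
    the masses add up to one. *)
Lemma poisson_generating (a rate : R) : 0 <= a <= 1 -> 0 <= rate ->
  (\sum_(k <oo) ((1 - a) ^+ k)%:E * (rate ^+ k / k`!%:R * expR (- rate))%:E =
   (expR (- (a * rate)))%:E)%E.
Proof.
move=> /andP[a0 a1] r0.
transitivity ((expR (- rate))%:E * \sum_(k <oo) (exp_coeff ((1 - a) * rate) k)%:E)%E.
  rewrite -nneseriesZl; last first.
    by move=> k _; rewrite lee_fin /exp_coeff divr_ge0// exprn_ge0// mulr_ge0// subr_ge0.
  by apply: eq_eseriesr => k _; rewrite -!EFinM /exp_coeff/= exprMn; congr EFin; ring.
transitivity ((expR (- rate))%:E * (expR ((1 - a) * rate))%:E)%E; last first.
  by rewrite -EFinM -expRD; congr (expR _)%:E; ring.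
congr *%E; rewrite /expR -EFin_lim; last exact: is_cvg_series_exp_coeff.
by apply/congr_lim/funext => n/=; rewrite sumEFin.
Qed.

End laplace_aux.

Section npoints_theory.
Context {R : realType} {dO : measure_display} {O : measurableType dO}.
Variables (d : nat) (X : nat -> {mfun O >-> d.-tuple R}).

Lemma npointsE (A : set (d.-tuple R)) w :
  npoints X A w = (\sum_(n <oo) (\1_A (X n w))%:E)%E.
Proof.
rewrite /npoints counting_dirac; apply: eq_eseriesr => n _.
by rewrite diracE indicE.
Qed.

Lemma measurable_npoints (A : set (d.-tuple R)) : measurable A ->
  measurable_fun setT (npoints X A).
Proof.
move=> mA; rewrite (_ : npoints X A = fun w => (\sum_(n <oo) (\1_A (X n w))%:E)%E).
  apply: ge0_emeasurable_sum => // n _; apply/measurable_EFinP.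
  by apply: measurableT_comp.
by apply/funext => w; rewrite npointsE.
Qed.

End npoints_theory.

Section poisson_laplace.
Context {R : realType} {dO : measure_display} {O : measurableType dO}.
Variables (P : probability O R) (d : nat) (X : nat -> {mfun O >-> d.-tuple R}).
Variable lambda : R.
Hypothesis lambda0 : 0 < lambda.
Hypothesis hX : is_poisson_process P lambda X.

Let y (k : nat) : \bar R := k%:R%:E.

Let yinj : injective y.
Proof. by move=> i j [] /eqP; rewrite eqr_nat => /eqP. Qed.

(** Exchanging the two products groups the points by the set that contains them: in the limit the
    i-th factor is 1 - a_i raised to the number of points in [A i]. These counts are independent
    Poisson variables, so their generating functions multiply. *)
Lemma poisson_laplace_simple (K : nat) (A : nat -> set (d.-tuple R)) (a : nat -> R) :
  (forall i, measurable (A i)) -> trivIset setT A ->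
  (forall i, (vol (A i) < +oo)%E) -> (forall i, 0 <= a i <= 1) ->
  (\int[P]_w (\prod_(n < N) \prod_(i < K) (1 - a i * \1_(A i) (X n w)))%:E)%E
    @[N --> \oo] -->
  (expR (- (lambda * \sum_(i < K) a i * fine (vol (A i)))))%:E.
Proof.
move=> mA tA vA a01.
pose Y i := npoints X (A i).
pose g i k := (1 - a i) ^+ k.
have mY i : measurable_fun setT (Y i) by exact: measurable_npoints.
have my k : measurable [set y k] by exact: emeasurable_set1.
have iY : indep P (fun i : nat => sigma_rv (Y i)) by exact: hX.2.
have g0 i k : 0 <= g i k.
  by rewrite exprn_ge0// subr_ge0; have /andP[] := a01 i.
have PY i k : P (Y i @^-1` [set y k]) = ((lambda * fine (vol (A i))) ^+ k / k`!%:R *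
    expR (- (lambda * fine (vol (A i)))))%:E by exact: hX.1.
have rate0 i : 0 <= lambda * fine (vol (A i)).
  by rewrite mulr_ge0 ?(ltW lambda0)//; apply: fine_ge0; rewrite volE.
have dE i : discrete_mean P Y y g i = (expR (- (a i * (lambda * fine (vol (A i))))))%:E.
  rewrite -poisson_generating//.
  by apply: eq_eseriesr => k _; rewrite PY.
have dfin i : discrete_mean P Y y g i \is a fin_num by rewrite dE.
(* The counts are almost surely finite. This matters because [discrete_fun] takes its default value
   0 at an infinite count, where the limit of the products is not controlled. *)
have Pok i : P (\bigcup_k (Y i @^-1` [set y k])) = 1%E.
  rewrite measure_bigcup//=; last 2 first.
  - by move=> k _; rewrite -[X in measurable X]setTI; exact: mY.
  - apply/trivIsetP => j k _ _ jk; apply/seteqP; split => // w /= [-> /yinj kj].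
    by rewrite kj eqxx in jk.
  rewrite [RHS](_ : _ = (expR (- (0 * (lambda * fine (vol (A i))))))%:E); last first.
    by rewrite mul0r oppr0 expR0.
  rewrite -poisson_generating ?lexx ?ler01//.
  rewrite (eq_eseriesl (Q := xpredT)); last by move=> k; rewrite in_setT.
  by apply: eq_eseriesr => k _; rewrite PY subr0 expr1n mul1e.
have f01 w n : 0 <= \prod_(i < K) (1 - a i * \1_(A i) (X n w)) <= 1.
  apply/andP; split.
    apply: prodr_ge0 => i _; have /andP[a0 a1] := a01 i.
    by rewrite subr_ge0 indicE; case: (_ \in _); rewrite ?mulr1 ?mulr0.
  apply: prodr_ile1 => i _; have /andP[a0 a1] := a01 i.
  rewrite indicE; case: (_ \in _); rewrite ?mulr1 ?mulr0 ?subr0 ?ler01 ?lexx//.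
  by rewrite subr_ge0 a1/= gerBl.
pose f_ N w := (\prod_(n < N) \prod_(i < K) (1 - a i * \1_(A i) (X n w)))%:E.
pose F w := (\prod_(i < K) discrete_fun Y y g i w)%E.
have mf_ N : measurable_fun setT (f_ N).
  apply/measurable_EFinP; apply: measurable_prod => n _.
  apply: measurable_prod => i _; apply: measurable_funB => //.
  apply: measurable_funM => //; apply: measurableT_comp => //.
have mF : measurable_fun setT F.
  rewrite /F; elim: K {F f_ mf_ f01} => [|m ihm].
    by under eq_fun do rewrite big_ord0; exact: measurable_cst.
  under eq_fun do rewrite big_ord_recr/=.
  by apply: emeasurable_funM => //; apply: measurable_discrete_fun.
have [] := @dominated_convergence _ _ _ P setT measurableT f_ F (cst 1%E) mf_ mF.
- have : {ae P, forall w, forall i, exists k, Y i w = y k}.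
    apply: ae_foralln => i; exists (~` (\bigcup_k (Y i @^-1` [set y k]))).
    have mU : measurable (\bigcup_k (Y i @^-1` [set y k])).
      by apply: bigcup_measurable => k _; rewrite -[X in measurable X]setTI; exact: mY.
    split; [exact: measurableC| |].
      by have := probability_setC P mU; rewrite Pok subee.
    by move=> w /= /forallNP h [k _ Yk]; exact: (h k).
  apply: filterS => w h _.
  have /choice[k Yk] := h.
  rewrite /F (eq_bigr (fun i : 'I_K => (g i (k i))%:E)); last first.
    by move=> i _; apply: discrete_fun_eq.
  rewrite prodEFin /f_; apply: cvg_EFin; first by near=> N.
  rewrite (_ : fine \o _ = fun N => \prod_(i < K) \prod_(n < N) (1 - a i * \1_(A i) (X n w))).
    elim: {+}K => [|m ihm].
      by under eq_fun do rewrite big_ord0; rewrite big_ord0; exact: cvg_cst.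
    under eq_fun do rewrite big_ord_recr/=.
    rewrite big_ord_recr/=; apply: cvgM => //.
    rewrite (_ : (fun _ => _) = (fun N => \prod_(n < N) (1 - a m * \1_([set n | A m (X n w)]) n))).
      by apply: counting_prod_cvg; exact: Yk.
    apply/funext => N; apply: eq_bigr => n _; rewrite !indicE.
    by congr (1 - _ * (nat_of_bool _)%:R); apply/idP/idP; rewrite !in_setE.
  by apply/funext => N /=; rewrite exchange_big.
- by apply: finite_measure_integrable_cst.
- apply: nearW => w N _; rewrite /f_ abse_EFin lee_fin ger0_norm.
    by apply: prodr_ile1 => n _; exact: f01.
  by apply: prodr_ge0 => n _; have /andP[] := f01 w n.
move=> _ _; rewrite /f_.
rewrite (_ : (\int[P]_w F w)%E = (expR (- (lambda * \sum_(i < K) a i * fine (vol (A i)))))%:E)//.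
have := @integral_prod_discrete_fun _ _ _ P _ _ Y y yinj mY my iY g g0 dfin K K
  (fun=> setT) (leqnn K) (fun=> measurableT).
rewrite big_geq// mule1.
under eq_integral => w _.
  rewrite indicE mem_set ?mule1; last by move=> i.
  over.
move=> ->; rewrite (eq_bigr (fun i : 'I_K => (expR (- (a i * (lambda * fine (vol (A i))))))%:E)); last first.
  by move=> i _; rewrite dE.
rewrite prodEFin -expR_sum sumrN; congr (expR (- _))%:E.
by rewrite mulr_sumr; apply: eq_bigr => i _; ring.
Unshelve. all: by end_near. Qed.

End poisson_laplace.

Section poisson_laplace_functional.
Context {R : realType} {dO : measure_display} {O : measurableType dO}.
Variables (P : probability O R) (d : nat) (X : nat -> {mfun O >-> d.-tuple R}).
Variable lambda : R.
Hypothesis lambda0 : 0 < lambda.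
Hypothesis hX : is_poisson_process P lambda X.

(** The Laplace functional of the first N points at the function - ln (1 - h). The form 1 - h is the
    one that thinning produces, and it allows h = 1, which occurs when a hit is certain. *)
Definition laplace (h : d.-tuple R -> R) (N : nat) : \bar R :=
  (\int[P]_w (\prod_(n < N) (1 - h (X n w)))%:E)%E.

Lemma laplace_nnsfun (phi : {nnsfun (d.-tuple R) >-> R}) :
  (forall x, phi x <= 1) -> (\int[vol_measure d]_x (phi x)%:E < +oo)%E ->
  laplace phi N @[N --> \oo] -->
  (expR (- (lambda * fine (\int[vol_measure d]_x (phi x)%:E)%E)))%:E.
Proof.
move=> phi1 phioo.
(* The value 0 is discarded, since its level set may have infinite volume. Past the last value the
   sets below are empty: the independence of the counts is stated for infinite sequences of disjoint
   sets. *)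
pose r := [seq x <- fset_set (range phi) | x != 0].
pose K := size r.
pose a i := nth 0 r i.
pose A i := if (i < K)%N then phi @^-1` [set a i] else set0.
have mA i : measurable (A i).
  by rewrite /A; case: ifP => // _; exact: measurable_sfunP.
have ur : uniq r by rewrite filter_uniq// fset_uniq.
have ar i : (i < K)%N -> a i \in r by move=> iK; exact: mem_nth.
have rP x : x \in r = (x \in range phi) && (x != 0).
  by rewrite mem_filter andbC (in_fset_set (fimfunP phi)).
have a01 i : 0 <= a i <= 1.
  have [iK|iK] := ltnP i K; last by rewrite /a nth_default// lexx ler01.
  by have := ar i iK; rewrite rP => /andP[]; rewrite inE => -[x _ <-] _; rewrite phi1 fun_ge0.
have tA : trivIset setT A.
  apply/trivIsetP => i j _ _ ij; rewrite /A.
  case: ifPn => iK; last by rewrite set0I.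
  case: ifPn => jK; last by rewrite setI0.
  apply/seteqP; split => // x /= [-> /eqP]; rewrite /a nth_uniq// => ijE.
  by rewrite ijE in ij.
have intE : (\int[vol_measure d]_x (phi x)%:E = \sum_(i < K) (a i)%:E * vol_measure d (A i))%E.
  rewrite integralT_nnsfun sintegralE fsbig_finite/=; last exact: fimfunP.
  rewrite (bigID (fun x => x != 0))/= [X in (_ + X)%E]big1 ?adde0; last first.
    by move=> x /negbNE/eqP ->; rewrite mul0e.
  rewrite -big_filter -/r (big_nth 0) big_mkord; apply: eq_bigr => i _.
  by rewrite /A ltn_ord.
have vA i : (vol_measure d (A i) < +oo)%E.
  have [iK|iK] := ltnP i K; last by rewrite /A ltnNge iK measure0.
  rewrite ltNge leye_eq; apply/negP => /eqP Aoo.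
  move: phioo; rewrite intE (bigD1 (Ordinal iK))//= Aoo.
  have := ar i iK; rewrite rP => /andP[_ ai0].
  have ai : (0 < (a i)%:E)%E.
    by rewrite lte_fin lt_neqAle eq_sym ai0; have /andP[] := a01 i.
  rewrite gt0_muley// addye// gt_eqF// (lt_le_trans ltNy0)//.
  apply: sume_ge0 => j _; rewrite mule_ge0// lee_fin.
  by have /andP[] := a01 j.
have phiE x : 1 - phi x = \prod_(i < K) (1 - a i * \1_(A i) x).
  have [phi0|phi0] := eqVneq (phi x) 0.
    rewrite phi0 subr0 big1// => i _; rewrite indicE memNset ?mulr0 ?subr0//.
    rewrite /A ltn_ord /= phi0 => ai0.
    have := ar i (ltn_ord i); rewrite rP -ai0 eqxx andbF//.
  have phr : phi x \in r by rewrite rP phi0 andbT inE; exists x.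
  have jK : (index (phi x) r < K)%N by rewrite index_mem.
  rewrite (bigD1 (Ordinal jK))//= [X in _ * X]big1 ?mulr1.
    rewrite /A jK /a nth_index// indicE mem_set ?mulr1//.
  move=> i ij; rewrite indicE memNset ?mulr0 ?subr0// /A ltn_ord /= /a => phia.
  by move: ij; rewrite -(inj_eq val_inj)/= phia index_uniq// eqxx.
rewrite (_ : fine _ = \sum_(i < K) a i * fine (vol (A i))); last first.
  rewrite intE (eq_bigr (fun i : 'I_K => (a i * fine (vol (A i)))%:E)).
    by rewrite sumEFin.
  move=> i _; rewrite EFinM volE// fineK// ge0_fin_numE//.
have := @poisson_laplace_simple _ _ _ P d X lambda lambda0 hX K A a mA tA _ a01.
rewrite (_ : (fun N => _) = laplace phi); first by apply=> i; rewrite volE.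
apply/funext => N; apply: eq_integral => w _; congr EFin.
by apply: eq_bigr => n _; rewrite phiE.
Qed.

Lemma measurable_laplace_prod (h : d.-tuple R -> R) N :
  measurable_fun setT h ->
  measurable_fun setT (fun w => (\prod_(n < N) (1 - h (X n w)))%:E).
Proof.
move=> mh; apply/measurable_EFinP; apply: measurable_prod => n _.
by apply: measurable_funB => //; apply: measurableT_comp.
Qed.

Lemma le_laplace (f h : d.-tuple R -> R) N :
  measurable_fun setT f -> measurable_fun setT h ->
  (forall x, f x <= h x) -> (forall x, h x <= 1) ->
  (laplace h N <= laplace f N)%E.
Proof.
move=> mf mh fh h1; apply: ge0_le_integral => //.
- by move=> w _; rewrite lee_fin prodr_ge0// => n _; rewrite subr_ge0.
- exact: measurable_laplace_prod.
- exact: measurable_laplace_prod.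
- move=> w _; rewrite lee_fin; apply: ler_prod => n _.
  by rewrite subr_ge0 h1 lerB.
Qed.

Lemma laplace_nonincreasing (h : d.-tuple R -> R) :
  measurable_fun setT h -> (forall x, 0 <= h x <= 1) ->
  {homo laplace h : m n / (m <= n)%N >-> (n <= m)%E}.
Proof.
move=> mh h01; have p01 m w : 0 <= \prod_(n < m) (1 - h (X n w)).
  by rewrite prodr_ge0// => n _; rewrite subr_ge0; have /andP[] := h01 (X n w).
apply: (@homo_leq _ _ (fun x y => (y <= x)%E)).
- by [].
- by move=> x y0 z; move=> xy yz; exact: le_trans xy.
- move=> m; apply: ge0_le_integral => //.
  + by move=> w _; rewrite lee_fin.
  + exact: measurable_laplace_prod.
  + exact: measurable_laplace_prod.
  + move=> w _; rewrite lee_fin big_ord_recr/=; apply: ler_piMr; first exact: p01.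
    by have /andP[hx0 _] := h01 (X m w); rewrite lerBlDr lerDl.
Qed.

(* Approximate h from below by simple functions: they bound the limit from above
   directly, and from below because all products decrease in the number of points. *)
Lemma laplace_cvg (h : d.-tuple R -> R) :
  measurable_fun setT h -> (forall x, 0 <= h x <= 1) ->
  (\int[vol_measure d]_x (h x)%:E < +oo)%E ->
  laplace h N @[N --> \oo] -->
  (expR (- (lambda * fine (\int[vol_measure d]_x (h x)%:E)%E)))%:E.
Proof.
move=> mh h01 hoo.
have mhE : measurable_fun setT (EFin \o h) by exact/measurable_EFinP.
pose phi := nnsfun_approx measurableT mhE.
have h0 x : (0 <= (EFin \o h) x)%E by rewrite lee_fin; have /andP[] := h01 x.
have phi_cvg x : EFin \o phi ^~ x @ \oo --> (h x)%:E.
  exact: (cvg_nnsfun_approx (D := setT)).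
have phi_cvgR x : phi ^~ x @ \oo --> h x.
  exact: (fine_cvg (phi_cvg x)).
have phi_nd x : nondecreasing_seq (phi ^~ x).
  by move=> m n mn; exact/lefP/nd_nnsfun_approx.
have phih k x : phi k x <= h x.
  have := nondecreasing_cvgn_le (phi_nd x) (cvgP _ (phi_cvgR x)) k.
  by rewrite (cvg_lim _ (phi_cvgR x)).
have phi1 k x : phi k x <= 1 by rewrite (le_trans (phih k x))//; have /andP[] := h01 x.
have mphi k : measurable_fun setT (phi k) by [].
have phi0 k x : 0 <= phi k x by exact: fun_ge0.
have intphi_le k : (\int[vol_measure d]_x (phi k x)%:E <= \int[vol_measure d]_x (h x)%:E)%E.
  by apply: ge0_le_integral => //; [move=> x _; rewrite lee_fin|exact/measurable_EFinP|
    move=> x _; rewrite lee_fin].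
have intphi_oo k : (\int[vol_measure d]_x (phi k x)%:E < +oo)%E by exact: le_lt_trans hoo.
have int0 (f : d.-tuple R -> R) : (forall x, 0 <= f x) -> (0 <= \int[vol_measure d]_x (f x)%:E)%E.
  by move=> f0; apply: integral_ge0 => x _; rewrite lee_fin.
have hfin : (\int[vol_measure d]_x (h x)%:E)%E \is a fin_num.
  by rewrite ge0_fin_numE// int0// => x; have /andP[] := h01 x.
have phifin k : (\int[vol_measure d]_x (phi k x)%:E)%E \is a fin_num.
  by rewrite ge0_fin_numE// int0.
pose m k := fine (\int[vol_measure d]_x (phi k x)%:E)%E.
pose mh' := fine (\int[vol_measure d]_x (h x)%:E)%E.
have mm k : m k <= mh' by exact: fine_le.
have m_cvg : m @ \oo --> mh'.
  apply: fine_cvg; rewrite fineK//.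
  have := @cvg_monotone_convergence _ _ _ (vol_measure d) setT measurableT (fun k x => (phi k x)%:E).
  move=> /(_ _ _ _); rewrite (_ : (fun x => limn _) = EFin \o h); last first.
    by apply/funext => x; apply/cvg_lim => //; exact: phi_cvg.
  apply => //.
  - by move=> k; exact/measurable_EFinP.
  - by move=> k x _; rewrite lee_fin.
  - by move=> x _ i j ij; rewrite lee_fin; exact: phi_nd.
pose L := expR (- (lambda * mh')).
have lap_lim k : laplace (phi k) N @[N --> \oo] --> (expR (- (lambda * m k)))%:E.
  exact: laplace_nnsfun.
have lap_ge k N : ((expR (- (lambda * m k)))%:E <= laplace (phi k) N)%E.
  rewrite -(cvg_lim _ (lap_lim k))//; apply: lime_le; first exact: cvgP (lap_lim k).
  near=> N'; apply: laplace_nonincreasing => //; last by near: N'; exact: nbhs_infty_ge.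
  by move=> x; rewrite phi0 phi1.
have lap_k N : laplace (phi k) N @[k --> \oo] --> laplace h N.
  apply: (@dominated_cvg _ _ _ P setT measurableT
    (fun k w => (\prod_(n < N) (1 - phi k (X n w)))%:E) _ (cst 1%E)) => //.
  - by move=> k; exact: measurable_laplace_prod.
  - move=> w _; apply: cvg_EFin; first by near=> k.
    rewrite (_ : fine \o _ = fun k => \prod_(n < N) (1 - phi k (X n w)))//.
    elim: N => [|N ihN].
      by under eq_fun do rewrite big_ord0; rewrite big_ord0; exact: cvg_cst.
    under eq_fun do rewrite big_ord_recr/=.
    rewrite big_ord_recr/=; apply: cvgM => //.
    by apply: cvgB; [exact: cvg_cst|exact: phi_cvgR].
  - by apply: finite_measure_integrable_cst.
  - move=> k w _; rewrite abse_EFin lee_fin ger0_norm.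
      by apply: prodr_ile1 => n _; rewrite subr_ge0 phi1/= lerBlDr lerDl phi0.
    by apply: prodr_ge0 => n _; rewrite subr_ge0.
have lap_geL N : (L%:E <= laplace h N)%E.
  rewrite -(cvg_lim _ (lap_k N))//; apply: lime_ge; first exact: cvgP (lap_k N).
  near=> k; apply: le_trans (lap_ge k N).
  by rewrite lee_fin ler_expR lerN2 ler_wpM2l// ltW.
have lap_leh k N : (laplace h N <= laplace (phi k) N)%E by apply: le_laplace => // x; have /andP[] := h01 x.
have lap_fin N : laplace h N \is a fin_num.
  rewrite fin_numElt (lt_le_trans _ (lap_geL N)) ?ltNyr//=.
  have := @laplace_nonincreasing h mh h01 0%N N (leq0n N).
  move/le_lt_trans; apply; rewrite /laplace.
  under eq_integral do rewrite big_ord0.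
  rewrite integral_cst// mul1e; exact: le_lt_trans (probability_le1 P measurableT) (ltry 1).
apply: cvg_EFin; first by near=> N.
apply/cvgrPdist_lt => e e0.
have expm : (fun k => expR (- (lambda * m k))) @ \oo --> L.
  apply: continuous_cvg; first exact: continuous_expR.
  by apply: cvgN; apply: cvgM => //; exact: cvg_cst.
have e2 : 0 < e / 2 by rewrite divr_gt0.
(* The order of choices is k first, which brings the limit of [laplace (phi k)] within e / 2 of L,
   and then N; [laplace h N] lies between L and [laplace (phi k) N]. *)
have [k hk] : exists k, `|L - expR (- (lambda * m k))| < e / 2.
  have /cvgrPdist_lt/(_ _ e2)[k _ kP] := expm.
  by exists k; apply: kP => /=.
have lk : fine \o laplace (phi k) @ \oo --> expR (- (lambda * m k)).
  exact: fine_cvg (lap_lim k).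
have lap_fink N : laplace (phi k) N \is a fin_num.
  rewrite fin_numElt (lt_le_trans _ (lap_ge k N)) ?ltNyr//=.
  have phi01 x : 0 <= phi k x <= 1 by rewrite phi0 phi1.
  have := @laplace_nonincreasing (phi k) (mphi k) phi01 0%N N (leq0n N).
  move/le_lt_trans; apply; rewrite /laplace.
  under eq_integral do rewrite big_ord0.
  rewrite integral_cst// mul1e; exact: le_lt_trans (probability_le1 P measurableT) (ltry 1).
near=> N.
have : `|expR (- (lambda * m k)) - fine (laplace (phi k) N)| < e / 2.
  by near: N; have /cvgrPdist_lt/(_ _ e2) := lk.
have l1 : L <= fine (laplace h N) by rewrite -lee_fin fineK.
have l2 : fine (laplace h N) <= fine (laplace (phi k) N) by exact: fine_le.
move=> l3; rewrite /= distrC ger0_norm ?subr_ge0//.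
move: hk l3; rewrite !ltr_norml => /andP[a1 a2] /andP[b1 b2]; rewrite -/mh' -/L; lra.
Unshelve. all: by end_near. Qed.

End poisson_laplace_functional.

(** * Independence and laws of the paths *)

Section independence_theory.
Context {R : realType} {dO : measure_display} {O : measurableType dO}.
Variable P : probability O R.

Lemma indep_seq (I : choiceType) (F : I -> set (set O)) (E : I -> set O) (s : seq I) :
  indep P F -> uniq s -> (forall i, i \in s -> F i (E i)) ->
  P [set w | forall i, i \in s -> E i w] = (\prod_(i <- s) P (E i))%E.
Proof.
move=> iF us FE.
have JE i : (i \in [fset i in s]%fset) = (i \in s) by rewrite !inE.
rewrite (_ : [set w | _] = \bigcap_(i in [set` [fset i in s]%fset]) E i); last first.
  apply/seteqP; split => w /= h i.
    by move=> /= iJ; apply: h; rewrite -JE.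
  by move=> /= iK; apply: h => /=; rewrite JE.
transitivity (\prod_(i <- [fset i in s]%fset) P (E i))%E.
  by apply: iF => i iJ; apply: FE; rewrite -JE.
by apply: perm_big; apply: uniq_perm => //; exact: fset_uniq.
Qed.

Lemma indep_fin (I : finType) (F : I -> set (set O)) (E : I -> set O) :
  indep P F -> (forall i, F i (E i)) ->
  P [set w | forall i, E i w] = (\prod_i P (E i))%E.
Proof.
move=> iF FE; rewrite -(indep_seq iF (index_enum_uniq I))//.
congr (P _); apply/seteqP; split => w /= h i; first by move=> _; exact: h.
by apply: h; exact: mem_index_enum.
Qed.

Lemma indep_nat (F : nat -> set (set O)) (n : nat) (E : 'I_n -> set O) :
  indep P F -> (forall i : 'I_n, F i (E i)) ->
  P [set w | forall i, E i w] = (\prod_i P (E i))%E.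
Proof.
case: n E => [|n] E iF FE.
  rewrite big_ord0 (_ : [set w | _] = setT) ?probability_setT//.
  by apply/seteqP; split => // w _ [].
pose E' (k : nat) := E (inord k).
transitivity (P [set w | forall i, i \in iota 0 n.+1 -> E' i w]).
  congr (P _); apply/seteqP; split => w h i; first by move=> _; exact: h.
  by have := h i; rewrite /E' inord_val mem_iota ltn_ord; exact.
rewrite (indep_seq iF (iota_uniq 0 n.+1))//; last first.
  move=> k; rewrite mem_iota add0n => /andP[_ kn].
  by rewrite /E' -{1}(inordK kn); exact: FE.
rewrite -[iota 0 n.+1]/(index_iota 0 n.+1) big_mkord.
by apply: eq_bigr => i _; rewrite /E' inord_val.
Qed.

(** Independence makes the joint law of f and g the product of their laws, so f can be frozen while
    g is averaged. All conditioning in the proof is done through this identity. *)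
Lemma integral_joint d1 (T1 : measurableType d1) d2 (T2 : measurableType d2)
    (f : O -> T1) (g : O -> T2) (C : set (T1 * T2)) :
  measurable_fun setT f -> measurable_fun setT g ->
  (forall A B, measurable A -> measurable B ->
    P (f @^-1` A `&` g @^-1` B) = (P (f @^-1` A) * P (g @^-1` B))%E) ->
  measurable C ->
  P [set w | C (f w, g w)] = (\int[P]_w P [set w' | C (f w, g w')])%E.
Proof.
move=> mf mg fg mC.
pose f' : {mfun O >-> T1} := HB.pack f (isMeasurableFun.Build _ _ _ _ f mf).
pose g' : {mfun O >-> T2} := HB.pack g (isMeasurableFun.Build _ _ _ _ g mg).
have mfg : measurable_fun setT (fun w => (f w, g w)).
  by apply/measurable_fun_pairP; split.
pose m' := measure_function_pushforward__canonical__measure_function_Measure P mfg.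
have := @product_measure_unique _ _ _ _ R (distribution P f') (distribution P g') m' _ C mC.
move=> /(_ _); rewrite /m' /= {2}/pushforward => <-; last first.
  by move=> A B mA mB; rewrite /pushforward -fg.
rewrite /product_measure1 ge0_integral_distribution//.
- apply: eq_integral => w _ /=; rewrite /distribution /pushforward/=.
  by congr (P _); apply/seteqP; split => w'; rewrite /xsection/= in_setE.
- exact: measurable_fun_xsection.
Qed.

Lemma measurable_joint d1 (T1 : measurableType d1) d2 (T2 : measurableType d2)
    (f : O -> T1) (g : O -> T2) (C : set (T1 * T2)) :
  measurable_fun setT f -> measurable_fun setT g -> measurable C ->
  measurable_fun setT (fun w => P [set w' | C (f w, g w')]).
Proof.
move=> mf mg mC.
pose g' : {mfun O >-> T2} := HB.pack g (isMeasurableFun.Build _ _ _ _ g mg).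
have := measurableT_comp (measurable_fun_xsection (distribution P g') mC) mf.
congr (measurable_fun _ _); apply/funext => w /=; rewrite /distribution /pushforward/=.
by congr (P _); apply/seteqP; split => w'; rewrite /xsection/= in_setE.
Qed.

Lemma indep_comp (I J : choiceType) (h : I -> J) (F : J -> set (set O)) :
  injective h -> indep P F -> indep P (F \o h).
Proof.
move=> hinj iF K E FE.
(* Transports E along h without an inverse: injectivity gives back [E i] at [h i], and the empty
   condition elsewhere gives the whole space. *)
pose E' j := [set w | forall i, i \in K -> h i = j -> E i w].
have E'h i : i \in K -> E' (h i) = E i.
  move=> iK; apply/seteqP; split => w /= Ew; first exact: Ew.
  by move=> i' _ /hinj ->.
have -> : \bigcap_(i in [set` K]) E i = [set w | forall j, j \in map h K -> E' j w].
  apply/seteqP; split => w /= Ew; first by move=> j _ i iK _; exact: Ew.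
  by move=> i iK; apply: (Ew (h i)) => //; apply/mapP; exists i.
rewrite (indep_seq iF); last 2 first.
- by rewrite map_inj_uniq ?fset_uniq.
- by move=> j /mapP[i iK ->]; rewrite E'h//; exact: FE.
by rewrite big_map big_seq [RHS]big_seq; apply: eq_bigr => i iK; rewrite E'h.
Qed.

End independence_theory.

Section sigma_membership.
Context {dO : measure_display} {O : measurableType dO}.

(** Membership in a generated sigma-algebra becomes measurability on O equipped with that
    sigma-algebra, so the usual closure properties of measurable functions apply to it. *)
Lemma sigma_pre (G : set (set O)) d (T : measurableType d) (f : O -> T) (A : set T) :
  measurable_fun setT (f : g_sigma_algebraType G -> T) -> measurable A ->
  <<s G >> (f @^-1` A).
Proof. by move=> mf mA; have := mf measurableT A mA; rewrite setTI. Qed.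

Lemma measurable_sigma_process (I : Type) (D : set I) (G : set (set O)) d
    (T : measurableType d) (f : I -> O -> T) (i : I) :
  sigma_process D f `<=` <<s G >> -> D i ->
  measurable_fun setT (f i : g_sigma_algebraType G -> T).
Proof.
move=> DG Di _ A mA; apply: DG; apply: sub_sigma_algebra.
by exists i => //; exists A.
Qed.

End sigma_membership.

(** * Law of the increments of Brownian motion at integer times *)

Section gaussian_walk.
Context {R : realType}.

Definition gauss1 (s : R) : set R -> \bar R := on_default_display (normal_prob 0 s).

HB.instance Definition _ (s : R) := Measure.on (gauss1 s).

Lemma gauss1_setT (s : R) : gauss1 s setT = 1%E.
Proof. exact: (@probability_setT _ _ _ (normal_prob 0 s)). Qed.

HB.instance Definition _ (s : R) :=
  Measure_isProbability.Build _ _ _ (gauss1 s) (gauss1_setT s).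

Definition gauss (d : nat) (s : R) : {sigma_finite_measure set (d.-tuple R) -> \bar R} :=
  powm (gauss1 s) d.

(** Paths are encoded by increments rather than positions because the law is then a product;
    [partial_sum] recovers the displacement from the value at time 0. *)
Definition path_increments (d t : nat) (b : nat -> d.-tuple R) : t.-tuple (d.-tuple R) :=
  [tuple vec_add (b m.+1) (vec_opp (b m)) | m < t].

Definition partial_sum (d t : nat) (a : t.-tuple (d.-tuple R)) (i : nat) : d.-tuple R :=
  [tuple \sum_(m < t | (m < i)%N) tnth (tnth a m) j | j < d].

Lemma partial_sum_diff (d t : nat) (b : nat -> d.-tuple R) i l : (i <= t)%N ->
  tnth (partial_sum (path_increments t b) i) l = tnth (b i) l - tnth (b 0) l.
Proof.
move=> it; rewrite tnth_mktuple.
rewrite (eq_bigr (fun m : 'I_t => tnth (b m.+1) l - tnth (b m) l)); last first.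
  by move=> m _; rewrite !tnth_mktuple.
rewrite -(big_ord_widen _ (fun m => tnth (b m.+1) l - tnth (b m) l) it).
rewrite -(big_mkord xpredT (fun m => tnth (b m.+1) l - tnth (b m) l)).
by rewrite telescope_sumr.
Qed.

Lemma partial_sum_increments (d t : nat) (b : nat -> d.-tuple R) (i : nat) :
  (i <= t)%N -> b 0 = origin d -> partial_sum (path_increments t b) i = b i.
Proof.
move=> it b0; apply: eq_from_tnth => l.
by rewrite partial_sum_diff// b0 tnth_mktuple subr0.
Qed.

Lemma measurable_path_increments d0 (T : measurableType d0) (d t : nat)
    (b : nat -> T -> d.-tuple R) : (forall i, measurable_fun setT (b i)) ->
  measurable_fun setT (fun w => path_increments t (b ^~ w)).
Proof.
move=> mb; apply/measurable_fun_tnthP => m.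
rewrite (_ : _ \o _ = fun w => vec_add (b m.+1 w) (vec_opp (b m w))); last first.
  by apply/funext => w /=; rewrite tnth_mktuple.
by apply: measurable_vec_add => //; exact: measurable_vec_opp.
Qed.

Lemma measurable_partial_sum d0 (T : measurableType d0) (d t : nat)
    (f : T -> t.-tuple (d.-tuple R)) (i : nat) : measurable_fun setT f ->
  measurable_fun setT (fun w => partial_sum (f w) i).
Proof.
move=> mf; apply/measurable_fun_tnthP => j.
rewrite (_ : _ \o _ = fun w => \sum_(m < t)
    if (m < i)%N then tnth (tnth (f w) m) j else 0); last first.
  by apply/funext => w /=; rewrite tnth_mktuple big_mkcond.
apply: measurable_sum => m; case: (m < i)%N => //.
by do 2!apply: measurable_tnthT.
Qed.

Section law.
Context {dO : measure_display} {O : measurableType dO}.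
Variable P : probability O R.

(** Both sides are finite measures, so it is enough to compare them on boxes, one interval-like side
    for each time and each coordinate; these are rectangles of rectangles and generate the
    sigma-algebra. *)
Lemma increments_law (d t : nat) (s : R) (B : R -> {mfun O >-> d.-tuple R})
    (A : set (t.-tuple (d.-tuple R))) :
  is_brownian P s B -> measurable A ->
  P [set w | A (path_increments t (fun i => B i%:R w))] = powm (gauss d s) t A.
Proof.
move=> [hB iB] mA.
have mi : measurable_fun setT (fun w => path_increments t (fun i => B i%:R w)).
  exact: (@measurable_path_increments _ O d t (fun i => B i%:R)).
pose m1 := measure_function_pushforward__canonical__measure_function_Measure P mi.
pose G := @rects _ _ t (@rects _ R d measurable).
have GI : setI_closed G.
  by do 2!apply: rects_setI_closed; exact: setI_closed_measurable.
have GT : G setT by do 2!apply: rects_setT.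
have mG : measurable = <<s G >>.
  apply: measurable_rects; first exact: rects_setT.
  by apply: measurable_rects => //; exact: measurable_sigma.
apply: (@finite_measure_unique _ _ R G m1 (powm (gauss d s) t) mG GI GT) => //.
  by rewrite /m1/= /pushforward preimage_setT; exact: le_lt_trans (probability_le1 P measurableT) (ltry 1).
move=> _ [E GE <-].
have {GE}/choice[F FE] : forall m, exists F : 'I_d -> set R,
    (forall j, measurable (F j)) /\ rect F = E m.
  by move=> m; have [F mF FE] := GE m; exists F.
have -> : E = fun m => rect (F m) by apply/funext => m; rewrite (FE m).2.
have mF m j : measurable (F m j) by exact: (FE m).1.
transitivity (\prod_(m < t) \prod_(j < d) gauss1 s (F m j))%E; last first.
  apply/esym; etransitivity.
    by apply: (@powm_rect _ _ R (gauss d s) t) => m; exact: measurable_rect.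
  by apply: eq_bigr => m _; apply: powm_rect.
(* Coordinates must come outermost: [is_brownian] separates the coordinate processes first, and only
   then the successive increments of each one. *)
rewrite exchange_big/= /pushforward.
pose D j m w := tnth (B m.+1%:R w) j - tnth (B m%:R w) j : R.
pose Ev (j : 'I_d) := [set w | forall m : 'I_t, F m j (D j m w)].
transitivity (P [set w | forall j, Ev j w]).
  congr (P _); apply/seteqP; split => w /= h.
    by move=> j m; have := h m j; rewrite !tnth_mktuple.
  by move=> m j; rewrite !tnth_mktuple; exact: h.
rewrite (indep_fin iB); last first.
  move=> j; rewrite /sigma_process.
  rewrite (_ : Ev j = (fun w => [tuple D j m w | m < t]) @^-1` rect (fun m => F m j)).
    apply: sigma_pre; last exact: measurable_rect.
    apply/measurable_fun_tnthP => m.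
    rewrite (_ : _ \o _ = D j m); last by apply/funext => w /=; rewrite tnth_mktuple.
    apply: measurable_funB.
      by apply: (@measurable_sigma_process _ _ R [set t : R | 0 <= t] _ _ _ (fun t w => tnth (B t w) j)) => /=.
    by apply: (@measurable_sigma_process _ _ R [set t : R | 0 <= t] _ _ _ (fun t w => tnth (B t w) j)) => /=.
  apply/seteqP; split => w h m; first by rewrite tnth_mktuple; exact: h.
  by have := h m; rewrite tnth_mktuple.
apply: eq_bigr => j _; have [_ ind nor _] := hB j.
have indj : indep P (fun k : nat => sigma_rv (D j k)).
  by apply: (ind (fun k => k%:R)) => // i k ik; rewrite ler_nat.
rewrite (indep_nat indj); last first.
  by move=> m; exists (F m j) => //; rewrite setTI.
apply: eq_bigr => m _.
have := nor m%:R 1 (ler0n _ _) ltr01 (F m j) (mF m j).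
by rewrite natr1 sqrtr1 mulr1; exact.
Qed.

End law.
End gaussian_walk.

(** * Void probability *)

Section hitting.
Context {R : realType}.
Variables (d t : nat) (s r : R).
Hypothesis r0 : 0 < r.
Local Notation vec := (d.-tuple R).
Local Notation path := (t.-tuple (d.-tuple R)).

Lemma edist_le (x y : vec) :
  (Defs.edist x y <= r) = (\sum_(j < d) (tnth x j - tnth y j) ^+ 2 <= r ^+ 2).
Proof.
rewrite /Defs.edist -{1}(ger0_norm (ltW r0)) -sqrtr_sqr ler_sqrt// exprn_ge0// ltW//.
Qed.

Lemma measurable_edist_le d0 (T : measurableType d0) (f g : T -> vec) :
  measurable_fun setT f -> measurable_fun setT g ->
  measurable [set z | Defs.edist (f z) (g z) <= r].
Proof.
move=> mf mg; rewrite (_ : [set z | _] =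
  (fun z => \sum_(j < d) (tnth (f z) j - tnth (g z) j) ^+ 2) @^-1` `]-oo, r ^+ 2]).
  rewrite -[X in measurable X]setTI.
  have : measurable_fun setT (fun z => \sum_(j < d) (tnth (f z) j - tnth (g z) j) ^+ 2).
    apply: measurable_sum => j; apply: measurable_funX; apply: measurable_funB;
    exact: measurable_tnthT.
  by apply => //; exact: measurable_itv.
by apply/seteqP; split => z /=; rewrite edist_le in_itv.
Qed.

(** Translation invariance and the normalisation of r: whatever the displacements of node and
    target, the starting points that give a visit at a fixed time have volume exactly one. *)
Lemma eball_shift (a c : vec) : vol (eball (origin d) r) = 1%E ->
  (\int[vol_measure d]_x (\1_[set x | Defs.edist (vec_add x a) c <= r] x)%:E = 1)%E.
Proof.
move=> v1; pose f (x : vec) := (\1_(eball (origin d) r) x)%:E : \bar R.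
have mb : measurable (eball (origin d : vec) r).
  by apply: measurable_edist_le => //; exact: measurable_cst.
transitivity (\int[vol_measure d]_x f (vec_add x (vec_add a (vec_opp c))))%E.
  apply: eq_integral => x _; rewrite /f !indicE; congr ((nat_of_bool _)%:R%:E).
  apply/idP/idP; rewrite !inE /eball/= !edist_le => h; apply: le_trans h;
  rewrite le_eqVlt; apply/orP; left; apply/eqP; apply: eq_bigr => j _;
  by rewrite !tnth_mktuple; ring.
rewrite vol_measure_integral_shift.
- by rewrite /f integral_indic// setIT -v1 volE.
- by apply/measurable_EFinP; exact: measurable_indic.
- by move=> x; rewrite lee_fin.
Qed.

(** The times are 0, ..., t - 1, so that the absence of a hit means detection at time t or later. *)
Definition hit (x : vec) (b g : path) : Prop :=
  exists i : 'I_t, Defs.edist (vec_add x (partial_sum b i)) (partial_sum g i) <= r.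

Lemma measurable_hit d0 (T : measurableType d0) (f : T -> vec) (b g : T -> path) :
  measurable_fun setT f -> measurable_fun setT b -> measurable_fun setT g ->
  measurable [set z | hit (f z) (b z) (g z)].
Proof.
move=> mf mb mg; rewrite (_ : [set z | _] = \bigcup_(i in [set: 'I_t])
  [set z | Defs.edist (vec_add (f z) (partial_sum (b z) i)) (partial_sum (g z) i) <= r]).
  apply: fin_bigcup_measurable => // i _; apply: measurable_edist_le.
    by apply: measurable_vec_add => //; exact: measurable_partial_sum.
  exact: measurable_partial_sum.
by apply/seteqP; split => z; [move=> [i h]; exists i|move=> [i _ h]; exists i].
Qed.

Definition hit_prob (g : path) (x : vec) : \bar R := powm (gauss d s) t [set b | hit x b g].

Lemma powm_gauss_setT : powm (gauss d s) t setT = 1%E.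
Proof. by apply: powm_setT; apply: powm_setT; exact: probability_setT. Qed.

Lemma hit_prob_le1 g x : (hit_prob g x <= 1)%E.
Proof.
rewrite -powm_gauss_setT; apply: le_measure; rewrite ?inE//.
by apply: measurable_hit => //; exact: measurable_cst.
Qed.

Lemma hit_prob_ge0 g x : (0 <= hit_prob g x)%E.
Proof. exact: measure_ge0. Qed.

Lemma hit_prob_fin g x : hit_prob g x \is a fin_num.
Proof. by rewrite ge0_fin_numE ?hit_prob_ge0// (le_lt_trans (hit_prob_le1 g x)) ?ltry. Qed.

Lemma measurable_hit_prob2 : measurable_fun setT (fun z : path * vec => hit_prob z.1 z.2).
Proof.
pose A := [set z : (path * vec) * path | hit z.1.2 z.2 z.1.1].
have mA : measurable A by apply: measurable_hit => //; apply: measurableT_comp.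
have := measurable_fun_xsection (powm (gauss d s) t) mA.
congr (measurable_fun _ _); apply/funext => -[g x]; congr (powm (gauss d s) t _).
by apply/seteqP; split => b; rewrite /xsection/= in_setE.
Qed.

Lemma measurable_hit_prob d0 (T : measurableType d0) (g : T -> path) (x : T -> vec) :
  measurable_fun setT g -> measurable_fun setT x ->
  measurable_fun setT (fun z => hit_prob (g z) (x z)).
Proof.
move=> mg mx.
apply: (@measurableT_comp _ _ _ _ _ _ (fun z : path * vec => hit_prob z.1 z.2) _ (fun z => (g z, x z))).
  exact: measurable_hit_prob2.
by apply/measurable_fun_pairP; split.
Qed.

(** By Tonelli, also the mean volume of a discrete Wiener sausage: the set of starting points from
    which the random walk meets g. *)
Definition hit_volume (g : path) : \bar R := (\int[vol_measure d]_x hit_prob g x)%E.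

Lemma hit_volume_ge0 g : (0 <= hit_volume g)%E.
Proof. by apply: integral_ge0 => x _; exact: hit_prob_ge0. Qed.

Lemma measurable_hit_volume : measurable_fun setT hit_volume.
Proof.
apply: (@measurable_fun_fubini_tonelli_F _ _ _ _ R (vol_measure d) (fun z : path * vec => hit_prob z.1 z.2)).
- exact: measurable_hit_prob2.
- by move=> z; exact: hit_prob_ge0.
Qed.

Lemma hit_prob_integral g x : hit_prob g x = (\int[powm (gauss d s) t]_b (\1_[set b | hit x b g] b)%:E)%E.
Proof.
rewrite integral_indic ?setIT//.
by apply: measurable_hit => //; exact: measurable_cst.
Qed.

(** A union bound over the t times, each of which contributes volume one by [eball_shift]. *)
Lemma hit_volume_le g : vol (eball (origin d) r) = 1%E -> (hit_volume g <= t%:R%:E)%E.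
Proof.
move=> v1.
pose I i (z : vec * path) : \bar R :=
  (\1_[set z : vec * path | Defs.edist (vec_add z.1 (partial_sum z.2 i)) (partial_sum g i) <= r] z)%:E.
have mI i : measurable_fun setT (I i).
  apply/measurable_EFinP; apply: measurable_indic; apply: measurable_edist_le => //.
  by apply: measurable_vec_add => //; apply: measurable_partial_sum.
have I0 i z : (0 <= I i z)%E by rewrite lee_fin.
have mF : measurable_fun setT (fun z => \sum_(i < t) I i z)%E by apply: emeasurable_sum.
have F0 z : (0 <= \sum_(i < t) I i z)%E by apply: sume_ge0.
rewrite /hit_volume.
apply: (@le_trans _ _ (\int[vol_measure d]_x \int[powm (gauss d s) t]_b (\sum_(i < t) I i (x, b))%E)%E).
  apply: ge0_le_integral => //.
  - by apply: measurable_hit_prob => //; exact: measurable_cst.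
  - by apply: (@measurable_fun_fubini_tonelli_F _ _ _ _ R (powm (gauss d s) t) (fun z => \sum_(i < t) I i z)%E).
  - move=> x _; rewrite hit_prob_integral; apply: ge0_le_integral => //.
    + by apply/measurable_EFinP; apply: measurable_indic; apply: measurable_hit => //; exact: measurable_cst.
    + by apply: measurableT_comp mF _; exact: pair1_measurable.
    move=> b _; rewrite indicE; case: (boolP (b \in _)); last by move=> _; exact: F0.
    rewrite inE => -[i hi]; rewrite (bigD1 i)//= {1}/I indicE mem_set//.
    by rewrite leeDl// sume_ge0.
rewrite (@fubini_tonelli _ _ _ _ R (vol_measure d) (powm (gauss d s) t) (fun z => \sum_(i < t) I i z)%E)//.
rewrite (_ : t%:R%:E = \int[powm (gauss d s) t]_b t%:R%:E)%E; last first.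
  by rewrite integral_cst// [X in (_ * X)%E]powm_gauss_setT mule1.
apply: ge0_le_integral => //.
- by move=> b _; apply: integral_ge0 => x _; exact: F0.
- by apply: (@measurable_fun_fubini_tonelli_G _ _ _ _ R (vol_measure d) (fun z => \sum_(i < t) I i z)%E).
move=> b _; rewrite ge0_integral_sum//; last first.
  by move=> i; apply: measurableT_comp (mI i) _; exact: pair2_measurable.
rewrite (eq_bigr (fun=> 1%E)); last first.
  by move=> i _; rewrite -[RHS](eball_shift (partial_sum b i) (partial_sum g i) v1).
by rewrite sumEFin sumr_const card_ord.
Qed.

End hitting.

Section void_probability.
Context {R : realType} {dO : measure_display} {O : measurableType dO}.
Variables (P : probability O R) (d t : nat) (lambda s r : R).
Hypotheses (lambda0 : 0 < lambda) (r0 : 0 < r).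
Hypothesis v1 : vol (eball (origin d) r) = 1%E.
Variables (X : nat -> {mfun O >-> d.-tuple R})
          (B : nat -> R -> {mfun O >-> d.-tuple R}).
Hypothesis hmgg : is_mgg P X B lambda s.
Local Notation vec := (d.-tuple R).
Local Notation path := (t.-tuple (d.-tuple R)).

Let incB (n : nat) (w : O) : path := path_increments t (fun i => B n i%:R w).

Let mincB n : measurable_fun setT (incB n).
Proof. exact: (@measurable_path_increments _ _ O d t (fun i => B n i%:R)). Qed.

Let incB_sigma (G : set (set O)) n : sigma_motion B n `<=` <<s G >> ->
  measurable_fun setT (incB n : g_sigma_algebraType G -> path).
Proof.
move=> mG.
apply: (@measurable_path_increments _ _ (g_sigma_algebraType G) d t (fun i => B n i%:R)).
move=> i; apply: (@measurable_sigma_process _ _ R [set t : R | 0 <= t] _ _ _ (fun t w => B n t w)) => //.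
by rewrite /=.
Qed.

Let X_sigma (G : set (set O)) n : sigma_start X `<=` <<s G >> ->
  measurable_fun setT (X n : g_sigma_algebraType G -> vec).
Proof.
move=> mG.
by apply: (@measurable_sigma_process _ _ nat setT _ _ _ (fun n w => X n w)).
Qed.

(** Only the first N nodes are considered, so that finite rectangles generate the events; N tends to
    infinity in [void_probability]. *)
Let Xs (N : nat) (w : O) : N.-tuple vec := [tuple X n w | n < N].
Let Bs (N : nat) (w : O) : N.-tuple path := [tuple incB n w | n < N].

Let mXs N : measurable_fun setT (Xs N).
Proof.
apply/measurable_fun_tnthP => n.
by rewrite (_ : _ \o _ = X n)//; apply/funext => w /=; rewrite tnth_mktuple.
Qed.

Let mBs N : measurable_fun setT (Bs N).
Proof.
apply/measurable_fun_tnthP => n.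
by rewrite (_ : _ \o _ = incB n)//; apply/funext => w /=; rewrite tnth_mktuple.
Qed.

Let indB : indep P (fun n : nat => sigma_motion B n).
Proof.
have [_ _ iXB] := hmgg.
by have /(_ _) := @indep_comp _ _ _ P _ _ (@Some nat) _ _ iXB; apply => ? ? [].
Qed.

Let indXB N (A : set (N.-tuple vec)) (E : 'I_N -> set path) :
  measurable A -> (forall n, measurable (E n)) ->
  P (Xs N @^-1` A `&` Bs N @^-1` rect E) = (P (Xs N @^-1` A) * P (Bs N @^-1` rect E))%E.
Proof.
move=> mA mE; have [_ _ iXB] := hmgg.
have BE : Bs N @^-1` rect E = [set w | forall n : 'I_N, (incB n @^-1` E n) w].
  by apply/seteqP; split => w h n; have := h n; rewrite /= tnth_mktuple.
have sB (n : 'I_N) : sigma_motion B n (incB n @^-1` E n).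
  by apply: sigma_pre => //; exact: incB_sigma.
(* The index [None] carries the event on the starting points and [Some n] the event on the motion of
   node n, with the whole space as default when n is not below N. *)
pose F (o : option nat) := if o is Some n then
  (if insub n is Some i then incB n @^-1` E i else setT) else Xs N @^-1` A.
have FE (n : 'I_N) : F (Some (n : nat)) = incB n @^-1` E n.
  rewrite /F; case: insubP => [i _ ni|]; last by rewrite ltn_ord.
  by have -> : i = n by exact: val_inj.
have -> : Xs N @^-1` A `&` Bs N @^-1` rect E =
    [set w | forall o, o \in None :: map Some (iota 0 N) -> F o w].
  rewrite BE; apply/seteqP; split => w.
    move=> [hX hB] [n|_ //]; rewrite in_cons => /orP[//|] /mapP[m]; rewrite mem_iota add0n.
    move=> /andP[_ mN] [->]; rewrite -[m]/(val (Ordinal mN)) FE; exact: hB.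
  move=> h; split; first exact: (h None).
  move=> n; rewrite -FE; apply: h; rewrite in_cons; apply/orP; right; apply/mapP; exists (n : nat) => //.
  by rewrite mem_iota add0n ltn_ord.
rewrite (indep_seq iXB); last 2 first.
- rewrite cons_uniq map_inj_uniq ?iota_uniq ?andbT; last by move=> ? ? [].
  by apply/negP => /mapP[].
- move=> [n|_].
    rewrite in_cons => /orP[//|] /mapP[m]; rewrite mem_iota add0n => /andP[_ mN] [->].
    by rewrite -[m]/(val (Ordinal mN)) FE; exact: sB.
  rewrite /F; apply: sigma_pre => //; apply/measurable_fun_tnthP => n.
  rewrite (_ : _ \o _ = X n); last by apply/funext => w /=; rewrite tnth_mktuple.
  exact: X_sigma.
rewrite big_cons; congr (_ * _)%E.
rewrite BE (indep_nat indB) // big_map.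
rewrite (_ : iota 0 N = index_iota 0 N) ?big_mkord; last by rewrite /index_iota subn0.
by apply: eq_bigr => n _; rewrite FE.
Qed.

(** For fixed A both sides are finite measures in C that agree on rectangles. The passage to general
    C is needed because the event of missing the target ties starting points to motions. *)
Let indXB' N (A : set (N.-tuple vec)) (C : set (N.-tuple path)) :
  measurable A -> measurable C ->
  P (Xs N @^-1` A `&` Bs N @^-1` C) = (P (Xs N @^-1` A) * P (Bs N @^-1` C))%E.
Proof.
move=> mA mC.
have mXA : measurable (Xs N @^-1` A) by rewrite -[X in measurable X]setTI; exact: mXs.
have pfin : P (Xs N @^-1` A) \is a fin_num by rewrite fin_num_measure.
have p0 : 0 <= fine (P (Xs N @^-1` A)) by rewrite fine_ge0.
pose m1 := measure_function_pushforward__canonical__measure_function_Measure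
  (mrestr P mXA) (@mBs N).
pose m2 := mscale (NngNum p0)
  (measure_function_pushforward__canonical__measure_function_Measure P (@mBs N)).
have m1E D : m1 D = P (Xs N @^-1` A `&` Bs N @^-1` D).
  by rewrite /m1/= /pushforward /mrestr setIC.
have m2E D : m2 D = (P (Xs N @^-1` A) * P (Bs N @^-1` D))%E.
  by rewrite /m2 /mscale/= fineK.
rewrite -m1E -m2E.
apply: (@finite_measure_unique _ _ R (@rects _ _ N measurable) m1 m2) => //.
- by apply: measurable_rects => //; exact: measurable_sigma.
- by apply: rects_setI_closed; exact: setI_closed_measurable.
- exact: rects_setT.
- rewrite m1E; apply: (@le_lt_trans _ _ 1%E); last exact: ltry.
  by apply: probability_le1; rewrite preimage_setT setIT.
- move=> _ [E mE <-].
  exact: (eq_trans (m1E _) (eq_trans (indXB mA mE) (esym (m2E _)))).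
Qed.

Definition misses (N : nat) (x : N.-tuple vec) (b : N.-tuple path) (g : path) : Prop :=
  forall n : 'I_N, ~ hit r (tnth x n) (tnth b n) g.

Lemma measurable_misses N d0 (T : measurableType d0) (x : T -> N.-tuple vec)
    (b : T -> N.-tuple path) (g : T -> path) :
  measurable_fun setT x -> measurable_fun setT b -> measurable_fun setT g ->
  measurable [set z | misses (x z) (b z) (g z)].
Proof.
move=> mx mb mg; rewrite (_ : [set z | _] = \bigcap_(n in [set: 'I_N])
  ~` [set z | hit r (tnth (x z) n) (tnth (b z) n) (g z)]).
  apply: fin_bigcap_measurable => // n _; apply: measurableC; apply: measurable_hit => //.
    exact: measurable_tnthT.
  exact: measurable_tnthT.
by apply/seteqP; split => z; [move=> h n _; exact: h|move=> h n; exact: h].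
Qed.

(** The thinning step. With the starting points frozen the motions remain independent, and node n
    misses g with probability 1 - [hit_prob s r g (X n w)]. *)
Lemma nodes_void N (g : path) :
  P [set w | misses (Xs N w) (Bs N w) g] = laplace P X (fun x => fine (hit_prob s r g x)) N.
Proof.
pose C := [set z : N.-tuple vec * N.-tuple path | misses z.1 z.2 g].
have mC : measurable C by apply: measurable_misses.
rewrite -[X in P X]/[set w | C (Xs N w, Bs N w)] (integral_joint (@mXs N) (@mBs N))//; last first.
  exact: indXB'.
apply: eq_integral => w _; rewrite /C /=.
have sB (n : 'I_N) A : measurable A -> sigma_motion B n (incB n @^-1` A).
  by move=> mA; apply: sigma_pre => //; exact: incB_sigma.
have mhit x : measurable [set b : path | hit r x b g].
  by apply: measurable_hit => //; exact: measurable_cst.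
transitivity (P [set w' | forall n : 'I_N, (incB n @^-1` ~` [set b | hit r (X n w) b g]) w']).
  by congr (P _); apply/seteqP; split => w' h n; have := h n; rewrite !tnth_mktuple.
rewrite (indep_nat indB); last by move=> n; apply: sB; exact: measurableC.
rewrite -prodEFin; apply: eq_bigr => n _.
rewrite preimage_setC probability_setC; last first.
  by apply: (@measurable_hit _ d t r r0 _ O (fun=> X n w) (incB n) (fun=> g)).
have [_ hB _] := hmgg.
rewrite (_ : P _ = hit_prob s r g (X n w)); last exact: (increments_law (hB n) (mhit (X n w))).
by rewrite EFinB fineK// hit_prob_fin.
Qed.

Section target.
Variable U : O -> path.
Hypothesis mU : measurable_fun setT U.
Hypothesis iU : forall A C, measurable C -> sigma_nodes X B A ->
  P (U @^-1` C `&` A) = (P (U @^-1` C) * P A)%E.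

(** The target is frozen in its turn, by its independence from all the nodes. The measurability is
    recorded because the limit in N is later taken under this integral. *)
Lemma target_void N :
  P [set w | misses (Xs N w) (Bs N w) (U w)] =
  (\int[P]_w laplace P X (fun x => fine (hit_prob s r (U w) x)) N)%E /\
  measurable_fun setT (fun w => laplace P X (fun x => fine (hit_prob s r (U w) x)) N).
Proof.
pose V w := (Xs N w, Bs N w).
have mV : measurable_fun setT V.
  by apply/measurable_fun_pairP; split; [exact: mXs|exact: mBs].
pose C := [set z : path * (N.-tuple vec * N.-tuple path) | misses z.2.1 z.2.2 z.1].
have mC : measurable C by apply: measurable_misses => //; apply: measurableT_comp.
have lapE w : laplace P X (fun x => fine (hit_prob s r (U w) x)) N = P [set w' | C (U w, V w')].
  exact: (esym (nodes_void N (U w))).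
split; last first.
  by under eq_fun do rewrite lapE; exact: measurable_joint.
under eq_integral do rewrite lapE.
apply: (integral_joint mU mV) => // A D mA mD.
apply: iU => //; apply: sigma_pre => //.
have sX : sigma_start X `<=` sigma_nodes X B.
  by apply: subset_trans (@sub_sigma_algebra _ setT _) => A' ?; left.
have sB n : sigma_motion B n `<=` sigma_nodes X B.
  by apply: subset_trans (@sub_sigma_algebra _ setT _) => A' ?; right; exists n.
apply/measurable_fun_pairP; split; apply/measurable_fun_tnthP => n.
  rewrite (_ : _ \o _ = X n); last by apply/funext => w /=; rewrite tnth_mktuple.
  exact: X_sigma.
rewrite (_ : _ \o _ = incB n); last by apply/funext => w /=; rewrite tnth_mktuple.
exact: incB_sigma.
Qed.

(** The events for the first N nodes decrease to the event on the left, while [laplace_cvg] and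
    dominated convergence give the limit on the right; the bound [hit_volume_le] supplies the
    finiteness that [laplace_cvg] asks for. *)
Lemma void_probability :
  P [set w | forall n, ~ hit r (X n w) (path_increments t (fun i => B n i%:R w)) (U w)] =
  (\int[P]_w (expR (- (lambda * fine (hit_volume s r (U w)))))%:E)%E.
Proof.
pose S N := [set w | misses (Xs N w) (Bs N w) (U w)].
have mS N : measurable (S N) by apply: measurable_misses.
have SE : [set w | forall n, ~ hit r (X n w) (path_increments t (fun i => B n i%:R w)) (U w)] =
    \bigcap_N S N.
  apply/seteqP; split => w /=; first by move=> h N _ n; rewrite !tnth_mktuple; exact: h.
  by move=> h n; have := h n.+1 I (Ordinal (ltnSn n)); rewrite !tnth_mktuple.
have cvg1 : P \o S @ \oo --> P (\bigcap_N S N).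
  apply: nonincreasing_cvg_mu => //.
  - exact: le_lt_trans (probability_le1 P (mS 0%N)) (ltry 1).
  - by apply: bigcap_measurable.
  - move=> m n mn; apply/subsetPset => w h i.
    by have := h (widen_ord mn i); rewrite !tnth_mktuple.
pose L w N := laplace P X (fun x => fine (hit_prob s r (U w) x)) N.
have h01 w x : 0 <= fine (hit_prob s r (U w) x) <= 1.
  by rewrite fine_ge0 ?hit_prob_ge0//= -lee_fin fineK ?hit_prob_fin// hit_prob_le1.
have mh w : measurable_fun setT (fun x => fine (hit_prob s r (U w) x)).
  apply: (@measurableT_comp _ _ _ _ _ _ (@fine R)) => //.
  by apply: measurable_hit_prob => //; exact: measurable_cst.
have hVE w : (\int[vol_measure d]_x (fine (hit_prob s r (U w) x))%:E = hit_volume s r (U w))%E.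
  by apply: eq_integral => x _; rewrite fineK// hit_prob_fin.
have Lcvg w : L w N @[N --> \oo] --> (expR (- (lambda * fine (hit_volume s r (U w)))))%:E.
  rewrite -hVE; apply: laplace_cvg => //.
    by have [] := hmgg.
  by rewrite hVE; apply: le_lt_trans (hit_volume_le s r0 (U w) v1) (ltry _).
have cvg2 : (\int[P]_w L w N)%E @[N --> \oo] -->
    (\int[P]_w (expR (- (lambda * fine (hit_volume s r (U w)))))%:E)%E.
  apply: (@dominated_cvg _ _ _ P setT measurableT (fun N w => L w N) _ (cst 1%E)) => //.
  - by move=> N; exact: (target_void N).2.
  - by apply: finite_measure_integrable_cst.
  - move=> N w _; rewrite gee0_abs.
      have := @laplace_nonincreasing _ _ _ P d X _ (mh w) (h01 w) 0%N N (leq0n N).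
      move/le_trans; apply; rewrite /laplace.
      under eq_integral do rewrite big_ord0.
      by rewrite integral_cst// mul1e; exact: probability_le1.
    apply: integral_ge0 => v _; rewrite lee_fin prodr_ge0// => n _.
    by rewrite subr_ge0; have /andP[] := h01 w (X n v).
rewrite SE -(cvg_lim _ cvg1)// -(cvg_lim _ cvg2)//.
by apply/congr_lim/funext => N; exact: (target_void N).1.
Qed.

End target.
End void_probability.

(** * Lower bound on the hit volume *)

Section second_moment.
Context {R : realType}.
Variables (d t : nat) (s r : R).
Hypothesis r0 : 0 < r.
Hypothesis v1 : vol (eball (origin d) r) = 1%E.
Local Notation vec := (d.-tuple R).
Local Notation path := (t.-tuple (d.-tuple R)).

(* If x + S_i(b) and x + S_j(b) are within r of S_i(g) and S_j(g), then b is
   close to g in this sense, whatever x is. *)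
Definition close_at (i j : nat) (g b : path) : Prop :=
  forall l, `|tnth (partial_sum b j) l - tnth (partial_sum b i) l -
     (tnth (partial_sum g j) l - tnth (partial_sum g i) l)| <= 2 * r.

Lemma edist_coord (x y : vec) l : Defs.edist x y <= r -> `|tnth x l - tnth y l| <= r.
Proof.
rewrite (edist_le r0) => h.
rewrite -(ler_pXn2r (n := 2))// ?nnegrE ?(ltW r0)//.
rewrite real_normK ?num_real//; apply: le_trans h.
by rewrite (bigD1 l)//= lerDl sumr_ge0// => i _; exact: sqr_ge0.
Qed.

Lemma measurable_close_at i j g : measurable [set b : path | close_at i j g b].
Proof.
rewrite (_ : [set b | _] = \bigcap_(l in [set: 'I_d])
  (fun b : path => `|tnth (partial_sum b j) l - tnth (partial_sum b i) l -
     (tnth (partial_sum g j) l - tnth (partial_sum g i) l)|) @^-1` `]-oo, 2 * r]).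
  apply: fin_bigcap_measurable => // l _; rewrite -[X in measurable X]setTI.
  have : measurable_fun setT (fun b : path => `|tnth (partial_sum b j) l - tnth (partial_sum b i) l -
     (tnth (partial_sum g j) l - tnth (partial_sum g i) l)|).
    apply: measurableT_comp => //; apply: measurable_funB => //.
    by apply: measurable_funB; apply: measurable_tnthT; exact: measurable_partial_sum.
  by apply => //; exact: measurable_itv.
apply/seteqP; split => b /=.
  by move=> h l _; rewrite /= in_itv/=; exact: h.
by move=> h l; have := h l I; rewrite /= in_itv.
Qed.

Let Ind (g : path) i (z : vec * path) : R :=
  \1_[set z : vec * path | Defs.edist (vec_add z.1 (partial_sum z.2 i)) (partial_sum g i) <= r] z.

Let mInd g i : measurable_fun setT (Ind g i).
Proof.
apply: measurable_indic; apply: measurable_edist_le => //.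
by apply: measurable_vec_add => //; apply: measurable_partial_sum.
Qed.

(** Trades the second visit for a condition on the walk alone: the integral over x then acts on a
    single visit, where it equals one. *)
Let Ind_le g i j x b : Ind g i (x, b) * Ind g j (x, b) <=
  \1_[set b | close_at i j g b] b * Ind g i (x, b).
Proof.
rewrite /Ind !indicE.
case: (boolP (_ \in _)) => [|_]; last by rewrite mul0r mulr0.
rewrite inE /= => hi; rewrite !mulr1 !mul1r.
case: (boolP (_ \in _)) => [|_]; last by case: (_ \in _).
rewrite inE /= => hj; rewrite mem_set// => l.
have := edist_coord l hi; have := edist_coord l hj; rewrite !tnth_mktuple.
move=> /ler_normlP[a1 a2] /ler_normlP[b1 b2]; apply/ler_normlP; split; lra.
Qed.

Let IndI g b i : (\int[vol_measure d]_x (Ind g i (x, b))%:E = 1)%E.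
Proof. by rewrite -[RHS](eball_shift r0 (partial_sum b i) (partial_sum g i) v1). Qed.

Let mu := powm (gauss d s) t.

(** K dominates the mean number of steps close to a given step, so the integral of M^2 is at most t
    K. Integrating the pointwise inequality leaves 2 t / K - t K / K^2 = t / K. *)
Lemma second_moment (g : path) (K : R) : 0 < K ->
  (forall i : 'I_t, \sum_(j < t) mu [set b | close_at i j g b] <= K%:E)%E ->
  ((t%:R / K)%:E <= hit_volume s r g)%E.
Proof.
move=> K0 hK.
pose M z := \sum_(i < t) Ind g i z.
have mM : measurable_fun setT M by apply: measurable_sum.
have M0 z : 0 <= M z by apply: sumr_ge0.
pose H (z : vec * path) : R := \1_[set z : vec * path | hit r z.1 z.2 g] z.
have mH : measurable_fun setT H.
  by apply: measurable_indic; apply: measurable_hit => //; exact: measurable_cst.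
(* off the event it is 0 <= 0, on it (1 - M / K) ^+ 2 >= 0 *)
have pointwise z : 2 * K^-1 * M z <= H z + K^-1 ^+ 2 * M z ^+ 2.
  rewrite /H indicE; case: (boolP (z \in _)) => [_|].
    rewrite -subr_ge0 [X in 0 <= X](_ : _ = (1 - K^-1 * M z) ^+ 2); last by rewrite mulr1n; ring.
    exact: sqr_ge0.
  rewrite notin_setE /= => nh; rewrite [M z](_ : _ = 0) ?expr0n ?mulr0 ?addr0//=.
  rewrite /M big1// => i _; rewrite /Ind indicE memNset//= => h.
  by apply: nh; exists i.
(* The starting point is integrated first: for a fixed walk b the integral over x of a visit is
   exactly one. *)
pose II (f : vec * path -> R) := (\int[mu]_b \int[vol_measure d]_x (f (x, b))%:E)%E.
have mslice (f : vec * path -> R) b : measurable_fun setT f ->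
    measurable_fun setT (fun x => (f (x, b))%:E).
  by move=> mf; apply/measurable_EFinP; apply: measurableT_comp mf _; exact: pair2_measurable.
have mG (f : vec * path -> R) : measurable_fun setT f -> (forall z, 0 <= f z) ->
    measurable_fun setT (fun b => \int[vol_measure d]_x (f (x, b))%:E)%E.
  move=> mf f0; apply: (@measurable_fun_fubini_tonelli_G _ _ _ _ R (vol_measure d) (EFin \o f)).
    exact/measurable_EFinP.
  by move=> z; rewrite lee_fin.
have IIle (f h : vec * path -> R) : measurable_fun setT f -> measurable_fun setT h ->
    (forall z, 0 <= f z) -> (forall z, f z <= h z) -> (II f <= II h)%E.
  move=> mf mh f0 fh; have h0 z : 0 <= h z by rewrite (le_trans (f0 z)).
  apply: ge0_le_integral => //.
  - by move=> b _; apply: integral_ge0 => x _; rewrite lee_fin.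
  - exact: mG.
  - exact: mG.
  - move=> b _; apply: ge0_le_integral => //.
    + by move=> x _; rewrite lee_fin.
    + exact: mslice.
    + exact: mslice.
    + by move=> x _; rewrite lee_fin.
have IID (f h : vec * path -> R) : measurable_fun setT f -> measurable_fun setT h ->
    (forall z, 0 <= f z) -> (forall z, 0 <= h z) -> (II (fun z => f z + h z)%R = II f + II h)%E.
  move=> mf mh f0 h0; rewrite /II -ge0_integralD//; last 4 first.
  - by move=> b _; apply: integral_ge0 => x _; rewrite lee_fin.
  - exact: mG.
  - by move=> b _; apply: integral_ge0 => x _; rewrite lee_fin.
  - exact: mG.
  apply: eq_integral => b _; rewrite -ge0_integralD//; last 4 first.
  - by move=> x _; rewrite lee_fin.
  - exact: mslice.
  - by move=> x _; rewrite lee_fin.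
  - exact: mslice.
have IIZ (a : R) (f : vec * path -> R) : measurable_fun setT f -> 0 <= a ->
    (forall z, 0 <= f z) -> (II (fun z => a * f z)%R = a%:E * II f)%E.
  move=> mf a0 f0; rewrite /II -ge0_integralZl//; last 2 first.
  - exact: mG.
  - by move=> b _; apply: integral_ge0 => x _; rewrite lee_fin.
  apply: eq_integral => b _; rewrite -ge0_integralZl//; last 2 first.
  - exact: mslice.
  - by move=> x _; rewrite lee_fin.
have IIsum n (f : 'I_n -> vec * path -> R) : (forall i, measurable_fun setT (f i)) ->
    (forall i z, 0 <= f i z) ->
    (II (fun z => \sum_(i < n) f i z)%R = \sum_(i < n) II (f i))%E.
  elim: n f => [|n ih] f mf f0.
    rewrite big_ord0 /II; apply: integral0_eq => b _; apply: integral0_eq => x _.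
    by rewrite big_ord0.
  rewrite big_ord_recr/= -ih// -IID//; last 2 first.
  - exact: measurable_sum.
  - by move=> z; apply: sumr_ge0.
  by apply: eq_integral => b _; apply: eq_integral => x _; rewrite big_ord_recr.
have mu1 : mu setT = 1%E by exact: powm_gauss_setT.
have IM : II M = t%:R%:E.
  rewrite IIsum// (eq_bigr (fun=> 1%E)); last first.
    move=> i _; rewrite /II; under eq_integral do rewrite IndI.
    by rewrite integral_cst// mul1e; exact: mu1.
  by rewrite sumEFin sumr_const card_ord.
have IH : II H = hit_volume s r g.
  rewrite /II /hit_volume -(@fubini_tonelli _ _ _ _ R (vol_measure d) mu (EFin \o H)); last 2 first.
  - exact/measurable_EFinP.
  - by move=> z; rewrite lee_fin.
  apply: eq_integral => x _; rewrite (hit_prob_integral s r0).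
  by apply: eq_integral => b _; rewrite /fubini_F /H /= !indicE.
have IM2 : (II (fun z => M z ^+ 2)%R <= (t%:R * K)%R%:E)%E.
  rewrite (_ : (fun z => _) = fun z => \sum_(i < t) \sum_(j < t) Ind g i z * Ind g j z); last first.
    apply/funext => z; rewrite expr2 {1}/M mulr_suml; apply: eq_bigr => i _.
    by rewrite /M mulr_sumr.
  rewrite IIsum; last 2 first.
  - by move=> i; apply: measurable_sum => j; apply: measurable_funM.
  - by move=> i z; apply: sumr_ge0 => j _; rewrite mulr_ge0.
  rewrite (_ : (t%:R * K)%:E = \sum_(i < t) K%:E)%E; last first.
    by rewrite sumEFin sumr_const card_ord mulr_natl.
  apply: lee_sum => i _; rewrite IIsum; last 2 first.
  - by move=> j; apply: measurable_funM.
  - by move=> j z; rewrite mulr_ge0.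
  apply: le_trans (hK i); apply: lee_sum => j _.
  pose G (z : vec * path) := \1_[set b | close_at i j g b] z.2 * Ind g i z.
  have mc : measurable_fun setT (fun z : vec * path => \1_[set b | close_at i j g b] z.2 : R).
    by apply: measurableT_comp => //; apply: measurable_indic; exact: measurable_close_at.
  apply: (@le_trans _ _ (II G)).
    apply: IIle => //.
    - exact: measurable_funM.
    - exact: measurable_funM.
    - by move=> z; rewrite mulr_ge0.
    - by move=> [x b]; exact: Ind_le.
  have -> : mu [set b | close_at i j g b] = (\int[mu]_b (\1_[set b | close_at i j g b] b)%:E)%E.
    by rewrite integral_indic ?setIT//; exact: measurable_close_at.
  rewrite le_eqVlt; apply/orP; left; apply/eqP; apply: eq_integral => b _; rewrite /G/=.
  under eq_integral do rewrite EFinM.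
  rewrite ge0_integralZl ?lee_fin//; last 2 first.
  - exact: mslice.
  - by move=> x _; rewrite lee_fin.
  by rewrite IndI mule1.
have Vfin : hit_volume s r g \is a fin_num.
  rewrite ge0_fin_numE ?hit_volume_ge0//; exact: le_lt_trans (hit_volume_le s r0 g v1) (ltry _).
have ki : 0 <= K^-1 by rewrite invr_ge0 ltW.
have /= := IIle (fun z => 2 * K^-1 * M z) (fun z => H z + K^-1 ^+ 2 * M z ^+ 2).
have mM2 : measurable_fun setT (fun z => M z ^+ 2) by exact: measurable_funX.
move=> /(_ _ _ _ pointwise).
rewrite IIZ ?mulr_ge0// IM IID//; last 2 first.
- exact: measurable_funM.
- by move=> z; rewrite mulr_ge0// ?exprn_ge0.
rewrite IIZ ?exprn_ge0//; last by move=> z; exact: sqr_ge0.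
rewrite IH => main.
have {main} : ((2 * K^-1)%:E * t%:R%:E <= hit_volume s r g + (K^-1 ^+ 2)%:E * II (fun z => M z ^+ 2)%R)%E.
  apply: main.
  - exact: measurable_funM.
  - by apply: measurable_funD => //; exact: measurable_funM.
  - by move=> z; rewrite mulr_ge0// mulr_ge0.
move=> main; have {main} : ((2 * K^-1)%:E * t%:R%:E <= hit_volume s r g + (K^-1 ^+ 2)%:E * (t%:R * K)%:E)%E.
  apply: le_trans main _; rewrite leeD2l// lee_pmul2l//.
  by rewrite lte_fin exprn_gt0// invr_gt0.
rewrite -(fineK Vfin) -!EFinM -EFinD !lee_fin => main.
have : K^-1 ^+ 2 * (t%:R * K) = t%:R / K by field; rewrite gt_eqF.
lra.
Qed.

End second_moment.

(** * Gaussian estimates and sums of return probabilities *)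

Section normal_bounds.
Context {R : realType}.

Lemma normal_peak_le (sigma : R) : 0 < sigma -> normal_peak sigma <= sigma^-1.
Proof.
move=> s0; rewrite /normal_peak lef_pV2 ?posrE ?sqrtr_gt0//; last first.
  by rewrite mulrn_wgt0// mulr_gt0 ?pi_gt0// exprn_gt0.
rewrite -{1}(ger0_norm (ltW s0)) -sqrtr_sqr ler_sqrt.
  rewrite -mulrnAr ler_peMr ?sqr_ge0//.
  by have := @pi_ge2 R; rewrite mulr2n; lra.
by rewrite mulrn_wge0// mulr_ge0 ?pi_ge0// sqr_ge0.
Qed.

(** The factor 3 comes from 2 pi < 8 <= 3^2. *)
Lemma normal_peak_ge (sigma : R) : 0 < sigma -> (3 * sigma)^-1 <= normal_peak sigma.
Proof.
move=> s0; have s3 : 0 < 3 * sigma by rewrite mulr_gt0.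
rewrite /normal_peak lef_pV2 ?posrE ?sqrtr_gt0//; last first.
  by rewrite mulrn_wgt0// mulr_gt0 ?pi_gt0// exprn_gt0.
rewrite -(ger0_norm (ltW s3)) -sqrtr_sqr ler_sqrt ?sqr_ge0//.
have := @pihalf_lt2 R => pi4; rewrite mulr2n.
have : 0 < sigma ^+ 2 by rewrite exprn_gt0.
nra.
Qed.

Lemma normal_itv_le (sigma c rho : R) : 0 < sigma -> 0 <= rho ->
  (normal_prob 0 sigma [set x | `|x - c| <= rho]%R <= (2 * rho / sigma)%:E)%E.
Proof.
move=> s0 rho0.
have -> : [set x | `|x - c| <= rho] = `[c - rho, c + rho]%classic.
  by apply/seteqP; split => x; rewrite /= in_itv/= ler_distl.
rewrite /normal_prob.
set D := `[c - rho, c + rho]%classic.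
apply: (@le_trans _ _ (\int[lebesgue_measure]_(x in D) (sigma^-1)%:E)%E).
  apply: ge0_le_integral => //.
  - exact: measurable_itv.
  - by move=> x _; rewrite lee_fin normal_pdf_ge0.
  - by apply/measurable_EFinP; apply: measurable_funTS; exact: measurable_normal_pdf.
  - move=> x _; rewrite lee_fin; apply: le_trans (normal_peak_le s0).
    by apply: normal_pdf_ub; rewrite gt_eqF.
rewrite integral_cst; last exact: measurable_itv.
rewrite /D /= lebesgue_measure_itv/= lte_fin.
case: ifPn => [_|]; last by rewrite mule0 lee_fin divr_ge0// ?mulr_ge0// ltW.
by rewrite -EFinB -EFinM lee_fin le_eqVlt; apply/orP; left; apply/eqP; field; rewrite gt_eqF.
Qed.

(** On [-M, M] the density is at least its value at M. *)
Lemma normal_itv_ge (sigma a b M : R) : 0 < sigma -> a <= b -> - M <= a -> b <= M ->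
  (((b - a) / (3 * sigma) * expR (- (M ^+ 2 / (sigma ^+ 2 *+ 2))))%:E <=
   normal_prob 0 sigma `[a, b])%E.
Proof.
move=> s0 ab Ma bM.
pose e := expR (- (M ^+ 2 / (sigma ^+ 2 *+ 2))).
apply: (@le_trans _ _ (\int[lebesgue_measure]_(x in `[a, b]) ((3 * sigma)^-1 * e)%:E)%E).
  rewrite integral_cst//= lebesgue_measure_itv/= lte_fin.
  move: ab; rewrite le_eqVlt => /orP[/eqP ->|ab].
    by rewrite ltxx mule0 subrr !mul0r.
  rewrite ab -EFinB -EFinM lee_fin le_eqVlt; apply/orP; left; apply/eqP.
  by rewrite /e; field; rewrite gt_eqF.
apply: ge0_le_integral => //.
- by move=> x _; rewrite lee_fin mulr_ge0 ?expR_ge0// invr_ge0 mulr_ge0// ltW.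
- by apply/measurable_EFinP; apply: measurable_funTS; exact: measurable_normal_pdf.
- move=> x; rewrite /= in_itv/= => /andP[ax xb].
  rewrite lee_fin normal_pdfE ?gt_eqF//; apply: ler_pM.
  + by rewrite invr_ge0 mulr_ge0// ltW.
  + exact: expR_ge0.
  + exact: normal_peak_ge.
  rewrite /normal_fun subr0 ler_expR mulNr lerN2.
  rewrite ler_pM2r ?invr_gt0 ?mulrn_wgt0 ?exprn_gt0//.
  rewrite -[leLHS]real_normK ?num_real// ler_sqr ?nnegrE//; last lra.
  by rewrite ler_norml; apply/andP; split; lra.
Qed.

End normal_bounds.

Section brownian_increments.
Context {R : realType} {dO : measure_display} {O : measurableType dO}.
Variables (P : probability O R) (d : nat) (s : R) (B : R -> {mfun O >-> d.-tuple R}).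
Hypothesis s0 : 0 < s.
Hypothesis hB : is_brownian P s B.

Lemma brownian_box (i j : nat) (A : 'I_d -> set R) : (i < j)%N ->
  (forall l, measurable (A l)) ->
  P [set w | forall l, A l (tnth (B j%:R w) l - tnth (B i%:R w) l)] =
  (\prod_(l < d) normal_prob 0 (s * Num.sqrt (j - i)%:R)%R (A l))%E.
Proof.
move=> ij mA; have [h1 h2] := hB.
pose Ev l := [set w | A l (tnth (B j%:R w) l - tnth (B i%:R w) l)].
rewrite -[X in P X]/[set w | forall l, Ev l w] (indep_fin h2); last first.
  move=> l; rewrite /sigma_process.
  rewrite (_ : Ev l = (fun w => tnth (B j%:R w) l - tnth (B i%:R w) l) @^-1` A l)//.
  apply: sigma_pre => //; apply: measurable_funB.
    by apply: (@measurable_sigma_process _ _ R [set t : R | 0 <= t] _ _ _ (fun t w => tnth (B t w) l)) => /=.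
  by apply: (@measurable_sigma_process _ _ R [set t : R | 0 <= t] _ _ _ (fun t w => tnth (B t w) l)) => /=.
apply: eq_bigr => l _; have [_ _ nor _] := h1 l.
have ji : (0 : R) < (j - i)%:R by rewrite ltr0n subn_gt0.
have := nor i%:R (j - i)%:R (ler0n _ _) ji (A l) (mA l).
by rewrite -natrD subnKC// ltnW.
Qed.

End brownian_increments.

Section sums.
Context {R : realType}.

Lemma ln_le_subr1 (x : R) : 0 < x -> ln x <= x - 1.
Proof.
move=> x0; have -> : x = 1 + (x - 1) by ring.
by rewrite (le_trans (le_ln1Dx _))//; lra.
Qed.

Lemma ln_natS (k : nat) : (0 < k)%N -> ln k.+1%:R - ln k%:R <= k%:R^-1 :> R.
Proof.
move=> k0; have kp : (0 : R) < k%:R by rewrite ltr0n.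
rewrite -ln_div ?posrE//.
apply: (le_trans (ln_le_subr1 _)); first by rewrite divr_gt0.
rewrite -natr1 mulrDl divff ?gt_eqF// mul1r.
by rewrite addrC addKr.
Qed.

Lemma ln_natS_ge (k : nat) : (0 < k)%N -> k.+1%:R^-1 <= ln k.+1%:R - ln k%:R :> R.
Proof.
move=> k0; have kp : (0 : R) < k%:R by rewrite ltr0n.
have k1p : (0 : R) < k.+1%:R by rewrite ltr0n.
have := @ln_le_subr1 (k%:R / k.+1%:R) (divr_gt0 kp k1p).
rewrite ln_div ?posrE//.
have -> : k%:R / k.+1%:R = 1 - k.+1%:R^-1 :> R.
  by rewrite -natr1; field; rewrite natr1 gt_eqF.
by move: (ln _) (ln _) (_^-1) => x y z; lra.
Qed.

Lemma harmonic_ge (t : nat) : (0 < t)%N -> ln t%:R <= \sum_(1 <= k < t) k%:R^-1 :> R.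
Proof.
elim: t => // -[|t] ih _; first by rewrite big_geq// ln1.
rewrite big_nat_recr//=; have := ih isT; have := @ln_natS t.+1 isT.
by move: (ln _) (ln _) (bigop _ _ _) (_^-1) => a b c e; lra.
Qed.

Lemma harmonic_le (t : nat) : (0 < t)%N -> \sum_(1 <= k < t) k%:R^-1 <= 1 + ln t%:R :> R.
Proof.
move=> t0; apply: (@le_trans _ _ (\sum_(1 <= k < t.+1) k%:R^-1)).
  by rewrite big_nat_recr//= lerDl invr_ge0.
elim: t t0 => // -[|t] ih _; first by rewrite big_nat1 invr1 ln1 addr0.
rewrite big_nat_recr//=; have := ih isT; have := @ln_natS_ge t.+1 isT.
by move: (ln _) (ln _) (bigop _ _ _) (_^-1) => a b c e; lra.
Qed.

(** The inequality ln x <= x - 1 at 1/2 gives ln 2 >= 1/2. From 4 on, ln t absorbs additive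
    constants; this fixes the threshold of the theorem. *)
Lemma ln4_ge1 : 1 <= ln 4 :> R.
Proof.
have h : ln 2^-1 <= 2^-1 - 1 :> R by apply: ln_le_subr1; rewrite invr_gt0.
move: h; rewrite lnV ?posrE// (_ : 4 = 2 ^+ 2 :> R); last by rewrite expr2 -natrM.
by rewrite lnXn//; move: (ln _) => a; lra.
Qed.

(** The first term is 1 and the others are dominated by the differences of 2 / sqrt k, the discrete
    form of comparison with an integral; they telescope to at most 2. *)
Lemma sum_inv_pow32_le (t : nat) :
  \sum_(1 <= k < t) (Num.sqrt k%:R ^+ 3)^-1 <= 3 :> R.
Proof.
have [t2|t2] := leqP t 2.
  apply: (@le_trans _ _ (\sum_(1 <= k < 2) (Num.sqrt k%:R ^+ 3)^-1)).
    case: t t2 => [|[|[|]]] // _; rewrite big_geq//; apply: sumr_ge0 => k _;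
      by rewrite invr_ge0 exprn_ge0 ?sqrtr_ge0.
  by rewrite big_nat1 sqrtr1 expr1n invr1; lra.
suff H n : \sum_(1 <= k < n.+2) (Num.sqrt k%:R ^+ 3)^-1 <= 3 - 2 / Num.sqrt n.+1%:R :> R.
  case: t t2 => [|[|t]]// _; apply: le_trans (H t) _.
  by rewrite lerBlDr lerDl divr_ge0.
elim: n => [|n ih]; first by rewrite big_nat1 sqrtr1 expr1n invr1; lra.
rewrite big_nat_recr//= -lerBrDr; apply: le_trans ih _.
set a := Num.sqrt n.+1%:R; set b := Num.sqrt n.+2%:R.
have a0 : 0 < a by rewrite sqrtr_gt0.
have b0 : 0 < b by rewrite sqrtr_gt0.
have ab : a <= b by rewrite ler_sqrt// ler_nat.
have b2 : b ^+ 2 = a ^+ 2 + 1 by rewrite !sqr_sqrtr// natr1.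
(* Since b - a = 1 / (a + b), this amounts to a b (a + b) <= 2 b^3, which follows from a <= b. *)
have key : (b ^+ 3)^-1 <= 2 / a - 2 / b.
  have -> : 2 / a - 2 / b = 2 * (b - a) / (a * b) by field; rewrite !gt_eqF.
  have e1 : (b - a) * (b + a) = 1 by rewrite -subr_sqr b2; ring.
  have -> : b - a = (b + a)^-1.
    have ba : b + a != 0 by rewrite gt_eqF// addr_gt0.
    by apply: (mulIf ba); rewrite e1 mulVf.
  rewrite -[_ * _ / _]mulrA -invfM -[X in X * _]invrK -invfM lef_pV2 ?posrE; last 2 first.
  - by rewrite exprn_gt0.
  - by rewrite !mulr_gt0 ?invr_gt0 ?addr_gt0.
  rewrite ler_pdivrMl//.
  have ab2 : a * b <= b * b by rewrite ler_pM2r.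
  nra.
by rewrite -!/a -!/b in key *; move: (_^-1) (2 / a) (2 / b) key => x y z; lra.
Qed.

End sums.

(** The argument of f is |i - j| written with truncated subtraction. Each distance is attained at
    most twice, once on each side of i. *)
Lemma sum_dist_le (R : realType) (f : nat -> R) (i t : nat) :
  (forall k, 0 <= f k) -> (i < t)%N ->
  \sum_(j < t) f ((i - j) + (j - i))%N <= 2 * \sum_(k < t) f k.
Proof.
move=> f0 it; have mono n : (n <= t)%N -> \sum_(0 <= k < n) f k <= \sum_(k < t) f k.
  move=> nt; rewrite -(big_mkord xpredT) (big_cat_nat (leq0n n) nt)//=.
  by rewrite lerDl sumr_ge0.
rewrite -(big_mkord xpredT (fun j => f ((i - j) + (j - i))%N)).
rewrite (big_cat_nat (leq0n i.+1) it)//= mulr_natl mulr2n lerD//.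
  apply: le_trans (mono i.+1 it); rewrite big_nat_rev/= add0n.
  rewrite big_nat [leRHS]big_nat ler_sum// => k /andP[_ ki].
  by rewrite subSS (_ : i - (i - k) + (i - k - i) = k)%N//; lia.
apply: le_trans (mono (t - i)%N (leq_subr _ _)).
rewrite -[i.+1]add1n big_addn.
rewrite (@big_cat_nat _ _ _ 1 0 (t - i))//=; last by rewrite subn_gt0.
rewrite -[leLHS]add0r lerD//; first by rewrite sumr_ge0.
rewrite big_nat [leRHS]big_nat ler_sum// => k /andP[k1 _].
by rewrite (_ : i - (k + i) + (k + i - i) = k)%N//; lia.
Qed.

Lemma prode_le_exp (R : realType) (d : nat) (f : 'I_d -> \bar R) (q : R) :
  (forall l, (0 <= f l <= q%:E)%E) -> (\prod_(l < d) f l <= (q ^+ d)%:E)%E.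
Proof.
elim: d f => [|d ih] f hf; first by rewrite big_ord0 expr0.
rewrite big_ord_recr exprSr EFinM/=; apply: lee_pmul.
- by apply: prode_ge0 => l _; have /andP[] := hf (widen_ord (leqnSn d) l).
- by have /andP[] := hf ord_max.
- by apply: ih => l; exact: hf.
- by have /andP[] := hf ord_max.
Qed.

Section hitting_volume.
Context {R : realType} {dO : measure_display} {O : measurableType dO}.
Variables (P : probability O R) (d t : nat) (s r : R) (B : R -> {mfun O >-> d.-tuple R}).
Hypotheses (s0 : 0 < s) (r0 : 0 < r).
Hypothesis v1 : vol (eball (origin d) r) = 1%E.
Hypothesis hB : is_brownian P s B.
Local Notation path := (t.-tuple (d.-tuple R)).

(* Bounds the probability that an N(0, s^2 k) variable lies in a given interval of
   length 4 r, with kappa = 4 r / s. *)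
Definition return_bound (kappa : R) (k : nat) : R :=
  if k == 0%N then 1 else Num.min 1 (kappa / Num.sqrt k%:R).

Lemma return_bound_ge0 kappa k : 0 <= kappa -> 0 <= return_bound kappa k.
Proof.
move=> k0; rewrite /return_bound; case: ifP => // _.
by rewrite le_min ler01 divr_ge0.
Qed.

Lemma return_bound_le1 kappa k : return_bound kappa k <= 1.
Proof. by rewrite /return_bound; case: ifP => // _; rewrite ge_min lexx. Qed.

Let kappa := 4 * r / s.
Let kappa0 : 0 <= kappa.
Proof. by rewrite divr_ge0 ?mulr_ge0// ltW. Qed.

Let mu := powm (gauss d s) t.

(** [increments_law] is used backwards: read on the Brownian motion B, the increment from i to j is
    normal by hypothesis, so no convolution of normal laws has to be computed. *)
Lemma close_at_lt (i j : nat) (g : path) : (i < j <= t)%N ->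
  (mu [set b | close_at r i j g b] <= (return_bound kappa (j - i) ^+ d)%:E)%E.
Proof.
move=> /andP[ij jt]; have it : (i <= t)%N by rewrite (leq_trans _ jt)// ltnW.
rewrite -(increments_law hB (measurable_close_at r i j g)).
pose c l := tnth (partial_sum g j) l - tnth (partial_sum g i) l.
pose A l := [set x : R | `|x - c l| <= 2 * r].
have mA l : measurable (A l).
  rewrite (_ : A l = `[c l - 2 * r, c l + 2 * r]%classic); first exact: measurable_itv.
  by apply/seteqP; split => x; rewrite /A /= in_itv/= ler_distl.
rewrite (_ : [set w | _] = [set w | forall l, A l (tnth (B j%:R w) l - tnth (B i%:R w) l)]); last first.
  apply/seteqP; split => w /= h l; have := h l; rewrite !partial_sum_diff// /A/= -/(c l);
  by congr (`|_ - c l| <= _); ring.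
rewrite (brownian_box hB ij mA); apply: prode_le_exp => l; apply/andP; split; first exact: measure_ge0.
have ji : (0 < j - i)%N by rewrite subn_gt0.
rewrite /return_bound gtn_eqF// EFin_min le_min probability_le1/=; last exact: mA.
have sq0 : 0 < s * Num.sqrt (j - i)%:R by rewrite mulr_gt0// sqrtr_gt0 ltr0n.
apply: (le_trans (@normal_itv_le _ _ (c l) (2 * r) sq0 _)); first by rewrite mulr_ge0// ltW.
rewrite lee_fin le_eqVlt; apply/orP; left; apply/eqP.
rewrite /kappa; field.
by move: sq0; rewrite pmulr_rgt0// => sq0; rewrite !gt_eqF.
Qed.

Lemma close_at_le (i j : nat) (g : path) : (i <= t)%N -> (j <= t)%N ->
  (mu [set b | close_at r i j g b] <= (return_bound kappa ((i - j) + (j - i)) ^+ d)%:E)%E.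
Proof.
move=> it jt; have [ij|ji|<-] := ltngtP i j.
- rewrite (_ : i - j + (j - i) = j - i)%N; last by lia.
  by apply: close_at_lt; rewrite ij.
- rewrite (_ : i - j + (j - i) = i - j)%N; last by lia.
  rewrite (_ : [set b | _] = [set b | close_at r j i g b]).
    by apply: close_at_lt; rewrite ji.
  apply/seteqP; split => b h l; have := h l; congr (_ <= _);
  by rewrite -normrN; congr `|_|; ring.
- rewrite subnn /return_bound/= expr1n -(powm_gauss_setT d t s).
  by apply: le_measure; rewrite ?inE//; exact: measurable_close_at.
Qed.

Lemma hit_volume_ge (g : path) (K : R) : 0 < K ->
  2 * \sum_(k < t) return_bound kappa k ^+ d <= K -> ((t%:R / K)%:E <= hit_volume s r g)%E.
Proof.
move=> K0 hK; apply: second_moment => // i.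
apply: (@le_trans _ _ (\sum_(j < t) (return_bound kappa ((i - j) + (j - i)) ^+ d)%:E)%E).
  by apply: lee_sum => j _; apply: close_at_le; exact: ltnW.
rewrite sumEFin lee_fin; apply: le_trans hK.
by apply: (@sum_dist_le _ (fun k => return_bound kappa k ^+ d)) => // k; rewrite exprn_ge0// return_bound_ge0.
Qed.

(** Returns after k >= 1 steps have probability at most kappa^2 / k, and k = 0 contributes 1. The
    total 1 + kappa^2 (1 + ln t) is at most (1 + 2 kappa^2) ln t because ln t >= 1. *)
Lemma hit_volume_ge2 (g : path) : d = 2%N -> (4 <= t)%N ->
  ((t%:R / (2 * (1 + 2 * kappa ^+ 2) * ln t%:R))%:E <= hit_volume s r g)%E.
Proof.
move=> d2 t4; have t0 : (0 < t)%N by exact: leq_trans t4.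
have lt1 : 1 <= ln t%:R :> R.
  by apply: le_trans ln4_ge1 _; rewrite ler_ln ?posrE ?ltr0n// ler_nat.
have k2 : 0 <= kappa ^+ 2 by exact: sqr_ge0.
apply: hit_volume_ge.
  rewrite !mulr_gt0//; last by rewrite (lt_le_trans ltr01).
  by rewrite ltr_pwDl// mulr_ge0.
rewrite -[2 * _ * ln _]mulrA ler_pM2l// -(big_mkord xpredT (fun k => return_bound kappa k ^+ d)).
rewrite (@big_cat_nat _ _ _ 1)//= big_nat1 {1}/return_bound/= expr1n.
apply: (@le_trans _ _ (1 + kappa ^+ 2 * (1 + ln t%:R))); last by nra.
rewrite lerD2l; apply: (@le_trans _ _ (kappa ^+ 2 * \sum_(1 <= k < t) k%:R^-1)); last first.
  by rewrite ler_wpM2l// harmonic_le.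
rewrite mulr_sumr big_nat [leRHS]big_nat ler_sum// => k /andP[k1 _].
rewrite d2 -[k%:R in leRHS](sqr_sqrtr (ler0n _ _)) -exprVn -exprMn ler_sqr ?nnegrE ?return_bound_ge0//.
  by rewrite /return_bound gtn_eqF// ge_min lexx orbT.
by rewrite mulr_ge0// invr_ge0.
Qed.

(** [return_bound] is capped by 1, so its d-th power is at most its cube: the summable series of
    k^(-3/2) serves for every d >= 3. *)
Lemma hit_volume_ge3 (g : path) : (3 <= d)%N ->
  ((t%:R / (2 * (1 + 3 * kappa ^+ 3)))%:E <= hit_volume s r g)%E.
Proof.
move=> d3; have k3 : 0 <= kappa ^+ 3 by exact: exprn_ge0.
apply: hit_volume_ge.
  by rewrite mulr_gt0// ltr_pwDl// mulr_ge0.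
rewrite ler_pM2l// -(big_mkord xpredT (fun k => return_bound kappa k ^+ d)).
case: (t) => [|n]; first by rewrite big_geq// addr_ge0// mulr_ge0.
rewrite (@big_cat_nat _ _ _ 1)//= big_nat1 {1}/return_bound/= expr1n lerD2l.
apply: (@le_trans _ _ (kappa ^+ 3 * \sum_(1 <= k < n.+1) (Num.sqrt k%:R ^+ 3)^-1)); last first.
  by rewrite mulrC ler_wpM2r// sum_inv_pow32_le.
rewrite mulr_sumr big_nat [leRHS]big_nat ler_sum// => k /andP[k1 _].
apply: (@le_trans _ _ (return_bound kappa k ^+ 3)).
  by rewrite ler_wiXn2l// ?return_bound_ge0// return_bound_le1.
rewrite -exprVn -exprMn ler_pXn2r ?nnegrE ?return_bound_ge0//.
  by rewrite /return_bound gtn_eqF// ge_min lexx orbT.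
by rewrite mulr_ge0// invr_ge0.
Qed.

End hitting_volume.

(** * Mean hit volume in the plane *)

Section with_sigma_finite.
Context d (T : measurableType d) (R : realType).
Variable m : {measure set T -> \bar R}.
Hypothesis sm : sigma_finite setT m.

(** An alias that carries the proof, so that a measure constructed in the middle of an argument can
    receive the sigma-finite structure. *)
Definition with_sigma_finite of sigma_finite setT m : set T -> \bar R := m.

HB.instance Definition _ := isMeasure.Build _ _ _ (with_sigma_finite sm)
  (measure0 m) (measure_ge0 m) (@measure_semi_sigma_additive _ _ _ m).

HB.instance Definition _ := Measure_isSigmaFinite.Build _ _ _ (with_sigma_finite sm) sm.

End with_sigma_finite.

Section convolution.
Context {R : realType}.
Variable d : nat.
Local Notation vec := (d.-tuple R).

Definition vec_sub (a c : vec) : vec := vec_add a (vec_opp c).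

Definition pdiff (t : nat) (b g : t.-tuple vec) : t.-tuple vec :=
  [tuple vec_sub (tnth b m) (tnth g m) | m < t].

Lemma measurable_vec_sub d0 (T : measurableType d0) (f g : T -> vec) :
  measurable_fun setT f -> measurable_fun setT g ->
  measurable_fun setT (fun x => vec_sub (f x) (g x)).
Proof. by move=> mf mg; apply: measurable_vec_add => //; exact: measurable_vec_opp. Qed.

Lemma measurable_pdiff d0 (T : measurableType d0) t (f g : T -> t.-tuple vec) :
  measurable_fun setT f -> measurable_fun setT g ->
  measurable_fun setT (fun x => pdiff (f x) (g x)).
Proof.
move=> mf mg; apply/measurable_fun_tnthP => m.
rewrite (_ : _ \o _ = fun x => vec_sub (tnth (f x) m) (tnth (g x) m)); last first.
  by apply/funext => x /=; rewrite tnth_mktuple.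
by apply: measurable_vec_sub; exact: measurable_tnthT.
Qed.

Lemma pdiff_cons t a c (b g : t.-tuple vec) :
  pdiff [tuple of a :: b] [tuple of c :: g] = [tuple of vec_sub a c :: pdiff b g].
Proof.
apply: eq_from_tnth => i; rewrite tnth_mktuple.
case: (unliftP ord0 i) => [j ->|->//].
by rewrite !tnthS tnth_mktuple.
Qed.

(** zeta is the law of one step of the difference walk, node minus target. Keeping only the integral
    formula, rather than an explicit density, treats Gaussian and null target steps together. *)
Lemma step_law (gam nu : {sigma_finite_measure set vec -> \bar R}) :
  gam setT = 1%E -> nu setT = 1%E ->
  exists zeta : {sigma_finite_measure set vec -> \bar R}, zeta setT = 1%E /\
    forall f : vec -> \bar R, measurable_fun setT f -> (forall x, 0 <= f x)%E ->
    (\int[zeta]_x f x = \int[nu]_c \int[gam]_a f (vec_sub a c))%E.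
Proof.
move=> g1 n1.
have mD : measurable_fun setT (fun z : vec * vec => vec_sub z.2 z.1) by exact: measurable_vec_sub.
pose z0 := measure_function_pushforward__canonical__measure_function_Measure (nu \x gam)%E mD.
have z1 : z0 setT = 1%E.
  rewrite /z0/= /pushforward preimage_setT -setXTT product_measure1E//.
  by rewrite [X in (_ * X)%E]g1 [X in (X * _)%E]n1 mule1.
have zs : sigma_finite setT z0.
  exists (fun=> setT); first by rewrite bigcup_const.
  by move=> k; split => //; rewrite [X in (X < _)%E]z1 ltry.
exists (with_sigma_finite zs); split=> // f mf f0.
rewrite ge0_integral_pushforward// preimage_setT.
rewrite (@fubini_tonelli1 _ _ _ _ R nu gam (fun z => f (vec_sub z.2 z.1)))//.
by apply: measurableT_comp.
Qed.

Section conv.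
Variables (gam nu zeta : {sigma_finite_measure set vec -> \bar R}).
Hypothesis zetaE : forall f : vec -> \bar R, measurable_fun setT f -> (forall x, 0 <= f x)%E ->
    (\int[zeta]_x f x = \int[nu]_c \int[gam]_a f (vec_sub a c))%E.

Lemma conv_powm t (f : t.-tuple vec -> \bar R) :
  measurable_fun setT f -> (forall x, 0 <= f x)%E ->
  (\int[powm nu t]_g \int[powm gam t]_b f (pdiff b g) = \int[powm zeta t]_z f z)%E.
Proof.
elim: t f => [|t ih] f mf f0.
  have m2 : measurable_fun setT (fun b : 0.-tuple vec => f (pdiff b [tuple])).
    by apply: measurableT_comp => //; apply: measurable_pdiff.
  have m1 : measurable_fun setT (fun g : 0.-tuple vec => \int[powm gam 0]_b f (pdiff b g))%E.
    apply: (@measurable_fun_fubini_tonelli_F _ _ _ _ R (powm gam 0)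
      (fun z : 0.-tuple vec * 0.-tuple vec => f (pdiff z.2 z.1))) => //.
    by apply: measurableT_comp => //; exact: measurable_pdiff.
  rewrite (powm_integral0 _ m1) (powm_integral0 _ m2) (powm_integral0 _ mf).
  by congr f; exact: tuple0.
rewrite powm_integralS; last 2 first.
- apply: (@measurable_fun_fubini_tonelli_F _ _ _ _ R (powm gam t.+1)
    (fun z : t.+1.-tuple vec * t.+1.-tuple vec => f (pdiff z.2 z.1))) => //.
  by apply: measurableT_comp => //; exact: measurable_pdiff.
- by move=> g; apply: integral_ge0.
have mcons y : measurable_fun setT (fun z : t.-tuple vec => [tuple of y :: z]).
  exact: measurable_cons.
transitivity (\int[nu]_c \int[gam]_a \int[powm zeta t]_z f [tuple of vec_sub a c :: z])%E; last first.
  rewrite powm_integralS// (zetaE (f := fun y => \int[powm zeta t]_z f [tuple of y :: z])%E)//.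
    apply: (@measurable_fun_fubini_tonelli_F _ _ _ _ R (powm zeta t) (f \o @tcons _ vec t)).
      by apply: measurableT_comp => //; exact: measurable_tcons.
    by move=> z; exact: f0.
  by move=> y; apply: integral_ge0.
apply: eq_integral => c _.
pose phi (z : (t.-tuple vec * vec) * t.-tuple vec) := f [tuple of vec_sub z.1.2 c :: pdiff z.2 z.1.1].
have mphi : measurable_fun setT phi.
  apply: measurableT_comp => //; apply: measurable_cons.
    by apply: measurable_vec_sub => //; apply: measurableT_comp.
  by apply: measurable_pdiff => //; apply: measurableT_comp.
transitivity (\int[powm nu t]_g \int[gam]_a \int[powm gam t]_b phi ((g, a), b))%E.
  apply: eq_integral => g _; rewrite powm_integralS//; last first.
    by apply: measurableT_comp => //; apply: measurable_pdiff.
  by apply: eq_integral => a _; apply: eq_integral => b _; rewrite pdiff_cons.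
(* The first step of the node has to move in front of the remaining steps of the target, so that the
   two first steps face each other and the induction hypothesis applies to the tails. *)
rewrite (@fubini_tonelli _ _ _ _ R (powm nu t) gam
  (fun z => \int[powm gam t]_b phi (z, b))%E).
- apply: eq_integral => a _.
  rewrite -(ih (fun z => f [tuple of vec_sub a c :: z]))//.
  by apply: measurableT_comp => //.
- apply: (@measurable_fun_fubini_tonelli_F _ _ _ _ R (powm gam t) phi).
    exact: mphi.
  by move=> z; exact: f0.
- by move=> z; apply: integral_ge0 => b _; exact: f0.
Qed.

End conv.
End convolution.

Lemma measurable_slice1 d1 d2 d3 (T1 : measurableType d1) (T2 : measurableType d2)
    (T3 : measurableType d3) (f : T1 * T2 -> T3) (x : T1) :
  measurable_fun setT f -> measurable_fun setT (fun z => f (x, z)).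
Proof. by move=> mf; exact: measurableT_comp mf (pair1_measurable x). Qed.

Lemma measurable_slice2 d1 d2 d3 (T1 : measurableType d1) (T2 : measurableType d2)
    (T3 : measurableType d3) (f : T1 * T2 -> T3) (z : T2) :
  measurable_fun setT f -> measurable_fun setT (fun x => f (x, z)).
Proof. by move=> mf; exact: measurableT_comp mf (pair2_measurable z). Qed.

(** * Green function of a walk and first passage to the ball *)

Section walk.
Context {R : realType}.
Variables (d : nat) (r : R).
Hypothesis r0 : 0 < r.
Hypothesis v1 : vol (eball (origin d) r) = 1%E.
Local Notation vec := (d.-tuple R).
Variable zeta : {sigma_finite_measure set vec -> \bar R}.
Hypothesis zeta1 : zeta setT = 1%E.

Definition inball (x : vec) : Prop := Defs.edist x (origin d) <= r.

Definition visits (x : vec) (t i : nat) (z : t.-tuple vec) : R :=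
  \1_[set x : vec | inball x] (vec_add x (partial_sum z i)).

Definition meets (x : vec) (t : nat) (z : t.-tuple vec) : R :=
  \1_[set z : t.-tuple vec | exists i : 'I_t, inball (vec_add x (partial_sum z i))] z.

Definition meet_prob (t : nat) (x : vec) : \bar R := (\int[powm zeta t]_z (meets x z)%:E)%E.

(** The truncated Green function of the ball: the mean number of visits at times 0, ..., t - 1. *)
Definition green (t : nat) (x : vec) : \bar R :=
  (\int[powm zeta t]_z (\sum_(i < t) visits x i z)%:E)%E.

Lemma partial_sum_cons t (y : vec) (z : t.-tuple vec) i :
  partial_sum [tuple of y :: z] i.+1 = vec_add y (partial_sum z i).
Proof.
apply: eq_from_tnth => l; rewrite !tnth_mktuple big_mkcond big_ord_recl/=.
congr (_ + _); rewrite [RHS]big_mkcond/=; apply: eq_bigr => m _.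
by rewrite /bump/= add1n ltnS tnthS.
Qed.

Lemma partial_sum0 t (z : t.-tuple vec) : partial_sum z 0 = origin d.
Proof. by apply: eq_from_tnth => l; rewrite !tnth_mktuple big_pred0. Qed.

Lemma vec_add_origin (x : vec) : vec_add x (origin d) = x.
Proof. by apply: eq_from_tnth => l; rewrite !tnth_mktuple addr0. Qed.

Lemma vec_addA (x y z : vec) : vec_add x (vec_add y z) = vec_add (vec_add x y) z.
Proof. by apply: eq_from_tnth => l; rewrite !tnth_mktuple addrA. Qed.

Lemma visitsS x t i y (z : t.-tuple vec) :
  visits x i.+1 [tuple of y :: z] = visits (vec_add x y) i z.
Proof. by rewrite /visits partial_sum_cons vec_addA. Qed.

Lemma visits0 x t (z : t.-tuple vec) : visits x 0 z = \1_[set x : vec | inball x] x.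
Proof. by rewrite /visits partial_sum0 vec_add_origin. Qed.

Lemma measurable_inball : measurable [set x : vec | inball x].
Proof. by apply: measurable_edist_le => //; exact: measurable_cst. Qed.

Lemma measurable_visits2 t i :
  measurable_fun setT (fun u : vec * t.-tuple vec => visits u.1 i u.2).
Proof.
apply: measurableT_comp.
  by apply: measurable_indic; exact: measurable_inball.
by apply: measurable_vec_add => //; exact: measurable_partial_sum.
Qed.

Lemma measurable_visits x t i : measurable_fun setT (fun z : t.-tuple vec => visits x i z).
Proof.
exact (measurable_slice1 x (@measurable_visits2 t i)).
Qed.

Lemma measurable_meets2 t :
  measurable_fun setT (fun u : vec * t.-tuple vec => meets u.1 u.2).
Proof.
rewrite (_ : (fun u => _) = \1_[set u : vec * t.-tuple vec |
    exists i : 'I_t, inball (vec_add u.1 (partial_sum u.2 i))]); last first.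
  by apply/funext => u; rewrite /meets !indicE.
apply: measurable_indic; rewrite (_ : [set u | _] = \bigcup_(i in [set: 'I_t])
  [set u : vec * t.-tuple vec | Defs.edist (vec_add u.1 (partial_sum u.2 i)) (origin d) <= r]).
  apply: fin_bigcup_measurable => // i _; apply: measurable_edist_le => //.
  by apply: measurable_vec_add => //; exact: measurable_partial_sum.
by apply/seteqP; split => u; [move=> [i h]; exists i|move=> [i _ h]; exists i].
Qed.

Lemma measurable_meets x t : measurable_fun setT (fun z : t.-tuple vec => meets x z).
Proof.
exact: (measurable_slice1 x (@measurable_meets2 t)).
Qed.

Let mgreen_integrand t :
  measurable_fun setT (fun u : vec * t.-tuple vec => (\sum_(i < t) visits u.1 i u.2)%:E).
Proof. by apply/measurable_EFinP; apply: measurable_sum => i; exact: measurable_visits2. Qed.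

Let mgreen_integrand1 t x :
  measurable_fun setT (fun z : t.-tuple vec => (\sum_(i < t) visits x i z)%:E).
Proof. by apply/measurable_EFinP; apply: measurable_sum => i; exact: measurable_visits. Qed.

Let green_integrand_ge0 t x (z : t.-tuple vec) :
  (0 <= (\sum_(i < t) visits x i z)%:E)%E.
Proof. by rewrite lee_fin sumr_ge0. Qed.

Lemma green_ge0 t x : (0 <= green t x)%E.
Proof. by apply: integral_ge0 => z _. Qed.

Lemma meet_prob_ge0 t x : (0 <= meet_prob t x)%E.
Proof. by apply: integral_ge0 => z _; rewrite lee_fin. Qed.

Lemma measurable_green t : measurable_fun setT (green t).
Proof.
apply: (@measurable_fun_fubini_tonelli_F _ _ _ _ R (powm zeta t)
  (fun u : vec * t.-tuple vec => (\sum_(i < t) visits u.1 i u.2)%:E)).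
  exact: mgreen_integrand.
by move=> u; exact: green_integrand_ge0.
Qed.

Lemma measurable_meet_prob t : measurable_fun setT (meet_prob t).
Proof.
apply: (@measurable_fun_fubini_tonelli_F _ _ _ _ R (powm zeta t)
  (fun u : vec * t.-tuple vec => (meets u.1 u.2)%:E)).
  by apply/measurable_EFinP; exact: measurable_meets2.
by move=> u; rewrite lee_fin.
Qed.

Let mshift x : measurable_fun setT (vec_add x : vec -> vec).
Proof. by apply: measurable_vec_add => //; exact: measurable_cst. Qed.

Lemma green_rec t x :
  green t.+1 x = ((\1_[set x : vec | inball x] x)%:E + \int[zeta]_y green t (vec_add x y))%E.
Proof.
rewrite /green powm_integralS//.
set c := (\1__ x)%:E.
have c0 : (0 <= c)%E by rewrite lee_fin.
have p1 : powm zeta t setT = 1%E by exact: powm_setT.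
transitivity (\int[zeta]_y (c + green t (vec_add x y)))%E.
  apply: eq_integral => y _.
  transitivity (\int[powm zeta t]_z (c + (\sum_(i < t) visits (vec_add x y) i z)%:E))%E.
    apply: eq_integral => z _; rewrite big_ord_recl/= visits0 EFinD; congr (_ + _%:E)%E.
    by apply: eq_bigr => i _; rewrite visitsS.
  rewrite ge0_integralD//; last exact: mgreen_integrand1.
  by rewrite integral_cst// [X in (_ * X)%E]p1 mule1.
rewrite ge0_integralD//; last 2 first.
- by move=> y _; exact: green_ge0.
- by apply: measurableT_comp => //; exact: measurable_green.
by rewrite integral_cst// [X in (_ * X)%E]zeta1 mule1.
Qed.

Lemma green_leS t x : (green t x <= green t.+1 x)%E.
Proof.
elim: t x => [|t ih] x.
  rewrite {1}/green powm_integral0// big_ord0; exact: green_ge0.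
rewrite [leRHS]green_rec green_rec leeD2l//; apply: ge0_le_integral => //.
- by move=> y _; exact: green_ge0.
- by apply: measurableT_comp => //; exact: measurable_green.
- by apply: measurableT_comp => //; exact: measurable_green.
Qed.

Lemma green_le n m x : (green m x <= green (n + m) x)%E.
Proof. by elim: n => // n ih; exact: le_trans ih (green_leS _ _). Qed.

Lemma meet_prob_le1 t x : (meet_prob t x <= 1)%E.
Proof.
have p1 : powm zeta t setT = 1%E by exact: powm_setT.
apply: (@le_trans _ _ (\int[powm zeta t]_z (1 : \bar R))%E); last first.
  by rewrite integral_cst// mul1e [X in (X <= _)%E]p1.
apply: ge0_le_integral => //.
- by move=> z _; rewrite lee_fin.
- by apply/measurable_EFinP; exact: measurable_meets.
- by move=> z _; rewrite lee_fin /meets indicE; case: (_ \in _).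
Qed.

Lemma meet_prob_rec t x : ~ inball x ->
  meet_prob t.+1 x = (\int[zeta]_y meet_prob t (vec_add x y))%E.
Proof.
move=> nx; rewrite /meet_prob powm_integralS; last 2 first.
- by apply/measurable_EFinP; exact: measurable_meets.
- by move=> z; rewrite lee_fin.
apply: eq_integral => y _; apply: eq_integral => z _; congr EFin.
rewrite /meets !indicE; congr (nat_of_bool _)%:R; apply/idP/idP; rewrite !inE/=.
  move=> [i]; case: (unliftP ord0 i) => [j ->|->]; last by rewrite partial_sum0 vec_add_origin.
  by rewrite /= /bump/= add1n partial_sum_cons vec_addA => h; exists j.
move=> [i h]; exists (lift ord0 i); rewrite /= /bump/= add1n.
by rewrite partial_sum_cons vec_addA.
Qed.

(* First-passage argument: once the walk is in the ball, the expected number of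
   further visits during m steps is at least L. *)
Lemma meet_prob_green n m (L : R) x : 0 <= L ->
  (forall y, inball y -> (L%:E <= green m y)%E) ->
  (L%:E * meet_prob n x <= green (n + m) x)%E.
Proof.
move=> L0 hL; elim: n x => [|n ih] x.
  rewrite /meet_prob powm_integral0; last by apply/measurable_EFinP; exact: measurable_meets.
  rewrite /meets indicE memNset ?mule0 ?green_ge0//= => -[[]]//.
have [bx|nx] := pselect (inball x).
  apply: (@le_trans _ _ (L%:E * 1)%E); first by rewrite lee_wpmul2l ?lee_fin ?meet_prob_le1.
  by rewrite mule1; apply: le_trans (hL x bx) (green_le _ _ _).
rewrite meet_prob_rec// addSn green_rec indicE memNset// add0e.
rewrite -ge0_integralZl ?lee_fin//; last 2 first.
- by apply: measurableT_comp => //; exact: measurable_meet_prob.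
- by move=> y _; exact: meet_prob_ge0.
apply: ge0_le_integral => //.
- by move=> y _; rewrite mule_ge0 ?lee_fin ?meet_prob_ge0.
- apply: measurable_funeM; apply: measurableT_comp => //; exact: measurable_meet_prob.
- by apply: measurableT_comp => //; exact: measurable_green.
Qed.

Lemma integral_green t : (\int[vol_measure d]_x green t x = t%:R%:E)%E.
Proof.
have p1 : powm zeta t setT = 1%E by exact: powm_setT.
rewrite /green (@fubini_tonelli _ _ _ _ R (vol_measure d) (powm zeta t)
  (fun u : vec * t.-tuple vec => (\sum_(i < t) visits u.1 i u.2)%:E)); last 2 first.
- exact: mgreen_integrand.
- by move=> u; exact: green_integrand_ge0.
transitivity (\int[powm zeta t]_z t%:R%:E)%E; last first.
  by rewrite integral_cst// [X in (_ * X)%E]p1 mule1.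
apply: eq_integral => z _; rewrite /fubini_G/=.
under eq_integral do rewrite -sumEFin.
rewrite ge0_integral_sum//; last 2 first.
- move=> i; apply/measurable_EFinP.
  exact: (measurable_slice2 z (@measurable_visits2 t i)).
- by move=> i x _; rewrite lee_fin.
rewrite (eq_bigr (fun=> 1%E)); first by rewrite sumEFin sumr_const card_ord.
move=> i _; rewrite -[RHS](eball_shift r0 (partial_sum z i) (origin d) v1).
by apply: eq_integral => x _; rewrite /visits !indicE.
Qed.

Lemma integral_meet_prob t (L : R) : 0 <= L ->
  (forall y, inball y -> (L%:E <= green t y)%E) ->
  (L%:E * \int[vol_measure d]_x meet_prob t x <= (2 * t%:R)%:E)%E.
Proof.
move=> L0 hL; rewrite -ge0_integralZl ?lee_fin//; last 2 first.
- exact: measurable_meet_prob.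
- by move=> y _; exact: meet_prob_ge0.
apply: (@le_trans _ _ (\int[vol_measure d]_x green (t + t) x)%E); last first.
  by rewrite integral_green lee_fin natrD mulr_natl mulr2n.
apply: ge0_le_integral => //.
- by move=> y _; rewrite mule_ge0 ?lee_fin ?meet_prob_ge0.
- by apply: measurable_funeM; exact: measurable_meet_prob.
- exact: measurable_green.
- by move=> x _; exact: meet_prob_green.
Qed.

End walk.

Lemma prode_ge_exp (R : realType) (d : nat) (f : 'I_d -> \bar R) (q : R) : 0 <= q ->
  (forall l, (q%:E <= f l)%E) -> ((q ^+ d)%:E <= \prod_(l < d) f l)%E.
Proof.
move=> q0; elim: d f => [|d ih] f hf; first by rewrite big_ord0 expr0.
by rewrite big_ord_recr exprSr EFinM/=; apply: lee_pmul; rewrite ?lee_fin ?exprn_ge0// ih.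
Qed.

Lemma tnth_vec_add (R : realType) (d : nat) (x y : d.-tuple R) l :
  tnth (vec_add x y) l = tnth x l + tnth y l.
Proof. by rewrite tnth_mktuple. Qed.

Lemma tnth_origin (R : realType) (d : nat) (l : 'I_d) : tnth (@origin R d) l = 0.
Proof. by rewrite tnth_mktuple. Qed.

Section brownian_boxes.
Context {R : realType} {dO : measure_display} {O : measurableType dO}.
Variables (P : probability O R) (d t : nat) (s : R) (B : R -> {mfun O >-> d.-tuple R}).
Hypothesis s0 : 0 < s.
Hypothesis hB : is_brownian P s B.
Local Notation path := (t.-tuple (d.-tuple R)).

Lemma measurable_path_box (i : nat) (a b : 'I_d -> R) :
  measurable [set z : path | forall l, a l <= tnth (partial_sum z i) l <= b l].
Proof.
rewrite (_ : [set z | _] = \bigcap_(l in [set: 'I_d])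
  (fun z : path => tnth (partial_sum z i) l) @^-1` `[a l, b l]).
  apply: fin_bigcap_measurable => // l _; rewrite -[X in measurable X]setTI.
  have : measurable_fun setT (fun z : path => tnth (partial_sum z i) l).
    by apply: measurable_tnthT; exact: measurable_partial_sum.
  by apply => //; exact: measurable_itv.
apply/seteqP; split => z /=.
  by move=> h l _; rewrite /= in_itv/=; exact: h.
by move=> h l; have := h l I; rewrite /= in_itv.
Qed.

(** The box stays within the diffusive scale sqrt i, so the exponential factor does not depend on i
    and each coordinate costs only a factor of order 1 / sqrt i. *)
Lemma path_box_ge (i : nat) (a b : 'I_d -> R) (rho M : R) : (0 < i <= t)%N -> 0 <= rho ->
  (forall l, b l - a l = rho) ->
  (forall l, - (M * Num.sqrt i%:R) <= a l) -> (forall l, b l <= M * Num.sqrt i%:R) ->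
  (((rho / (3 * s) * expR (- (M ^+ 2 / (s ^+ 2 *+ 2))) / Num.sqrt i%:R) ^+ d)%:E <=
   powm (gauss d s) t [set z : path | forall l, a l <= tnth (partial_sum z i) l <= b l]%R)%E.
Proof.
move=> /andP[i0 it] rho0 ab Ma bM.
have sq0 : 0 < Num.sqrt i%:R :> R by rewrite sqrtr_gt0 ltr0n.
rewrite -(increments_law hB (measurable_path_box i a b)).
rewrite (_ : [set w | _] =
    [set w | forall l, `[a l, b l]%classic (tnth (B i%:R w) l - tnth (B 0%:R w) l)]); last first.
  by apply/seteqP; split => w /= h l; have := h l; rewrite partial_sum_diff// in_itv.
rewrite (brownian_box hB i0 (A := fun l => `[a l, b l]%classic)); last first.
  by move=> l; exact: measurable_itv.
rewrite subn0; apply: prode_ge_exp.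
  by rewrite !mulr_ge0 ?expR_ge0 ?invr_ge0// ?mulr_ge0// ltW.
move=> l; have ss : 0 < s * Num.sqrt i%:R by rewrite mulr_gt0.
have lab : a l <= b l by rewrite -subr_ge0 ab.
apply: le_trans (normal_itv_ge ss lab (Ma l) (bM l)).
rewrite lee_fin ab le_eqVlt; apply/orP; left; apply/eqP.
have -> : (M * Num.sqrt i%:R) ^+ 2 / ((s * Num.sqrt i%:R) ^+ 2 *+ 2) = M ^+ 2 / (s ^+ 2 *+ 2).
  by field; rewrite !gt_eqF.
by field; rewrite !gt_eqF.
Qed.

End brownian_boxes.

Section mean_hitting_volume.
Context {R : realType} {dO : measure_display} {O : measurableType dO}.
Variables (P : probability O R) (d t : nat) (s r : R) (B : R -> {mfun O >-> d.-tuple R}).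
Hypotheses (s0 : 0 < s) (r0 : 0 < r).
Hypothesis v1 : vol (eball (origin d) r) = 1%E.
Hypothesis hB : is_brownian P s B.
Local Notation vec := (d.-tuple R).
Local Notation path := (t.-tuple (d.-tuple R)).

Lemma partial_sum_pdiff (b g : path) i l :
  tnth (partial_sum (pdiff b g) i) l = tnth (partial_sum b i) l - tnth (partial_sum g i) l.
Proof.
rewrite !tnth_mktuple -sumrB; apply: eq_bigr => m _.
by rewrite !tnth_mktuple.
Qed.

Lemma edist_pdiff (x : vec) (b g : path) i :
  Defs.edist (vec_add x (partial_sum b i)) (partial_sum g i) =
  Defs.edist (vec_add x (partial_sum (pdiff b g) i)) (origin d).
Proof.
congr Num.sqrt; apply: eq_bigr => l _.
by rewrite !tnth_vec_add partial_sum_pdiff tnth_origin; ring.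
Qed.

Variables nu zeta : {sigma_finite_measure set vec -> \bar R}.
Hypothesis zeta1 : zeta setT = 1%E.
Hypothesis zetaE : forall f : vec -> \bar R, measurable_fun setT f -> (forall x, 0 <= f x)%E ->
  (\int[zeta]_x f x = \int[nu]_c \int[gauss d s]_a f (vec_sub a c))%E.

(** Once the target is averaged as well, only differences of positions matter: the moving target
    becomes a ball at rest, met by the difference walk. *)
Lemma integral_hit_volume :
  (\int[powm nu t]_g hit_volume s r g = \int[vol_measure d]_x meet_prob r zeta t x)%E.
Proof.
rewrite /hit_volume (@fubini_tonelli _ _ _ _ R (powm nu t) (vol_measure d)
  (fun u : path * vec => hit_prob s r u.1 u.2)); last 2 first.
- exact: measurable_hit_prob2.
- by move=> u; exact: hit_prob_ge0.
apply: eq_integral => x _; rewrite /meet_prob -(conv_powm zetaE); last 2 first.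
- by apply/measurable_EFinP; exact: measurable_meets.
- by move=> z; rewrite lee_fin.
apply: eq_integral => g _; rewrite (hit_prob_integral s r0).
apply: eq_integral => b _; rewrite /meets !indicE; congr (nat_of_bool _)%:R%:E.
apply/idP/idP; rewrite !inE => -[i h]; exists i; first by rewrite /inball -edist_pdiff.
by rewrite edist_pdiff.
Qed.

Hypothesis d2 : d = 2%N.
Variable c0 : R.
Hypothesis c00 : 0 <= c0.
Hypothesis hnu : forall i, (0 < i < t)%N -> (c0%:E <= powm nu t
  [set g : path | forall l, - (s * Num.sqrt i%:R) <= tnth (partial_sum g i) l <= s * Num.sqrt i%:R]%R)%E.

(** The constant of [path_box_ge] for side rho = r and M = s + 2 r: the centre of the box is within
    s sqrt i + r of 0 in each coordinate, its half side is r / 2, and sqrt i >= 1. *)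
Let c1 : R := r / (3 * s) * expR (- ((s + 2 * r) ^+ 2 / (s ^+ 2 *+ 2))).

(* The walk is asked to be in the cube of half side r / 2, which lies in the ball
   because d = 2. *)
Lemma visits_ge (y : vec) i (g : path) : inball r y -> (0 < i < t)%N ->
  (forall l, - (s * Num.sqrt i%:R) <= tnth (partial_sum g i) l <= s * Num.sqrt i%:R) ->
  ((c1 ^+ 2 / i%:R)%:E <= \int[powm (gauss d s) t]_b (visits r y i (pdiff b g))%:E)%E.
Proof.
move=> yb /andP[i0 it] hg.
have sq1 : 1 <= Num.sqrt i%:R :> R by rewrite -[leLHS]sqrtr1 ler_sqrt// ler1n.
pose a l := tnth (partial_sum g i) l - tnth y l - r / 2.
pose b l := tnth (partial_sum g i) l - tnth y l + r / 2.
have yl l : `|tnth y l| <= r by have := edist_coord r0 l yb; rewrite tnth_origin subr0.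
have r2 : r <= r * Num.sqrt i%:R by rewrite ler_peMr// ltW.
apply: (@le_trans _ _ (powm (gauss d s) t
    [set z : path | forall l, a l <= tnth (partial_sum z i) l <= b l])).
  have -> : c1 ^+ 2 / i%:R = (c1 / Num.sqrt i%:R) ^+ d.
    by rewrite d2 [RHS]exprMn exprVn sqr_sqrtr.
  apply: (path_box_ge s0 hB (i := i) (M := s + 2 * r)) => //.
  - by rewrite i0 ltnW.
  - exact: ltW.
  - by move=> l; rewrite /a /b; lra.
  - move=> l; have := yl l; have /andP[g1 g2] := hg l.
    by move=> /ler_normlP[y1 y2]; rewrite /a mulrDl; lra.
  - move=> l; have := yl l; have /andP[g1 g2] := hg l.
    by move=> /ler_normlP[y1 y2]; rewrite /b mulrDl; lra.
pose S := [set z : path | forall l, a l <= tnth (partial_sum z i) l <= b l].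
rewrite -/S (_ : powm _ _ S = \int[powm (gauss d s) t]_z (\1_S z)%:E)%E; last first.
  by rewrite integral_indic ?setIT//; exact: measurable_path_box.
apply: ge0_le_integral => //.
- by apply/measurable_EFinP; apply: measurable_indic; exact: measurable_path_box.
- apply/measurable_EFinP; apply: (measurableT_comp (measurable_visits r0 y i)).
  by apply: measurable_pdiff.
move=> z _; rewrite lee_fin indicE; case: (boolP (z \in _)) => // zb.
rewrite /visits indicE mem_set//= /inball (edist_le r0).
move: zb; rewrite inE /= => zb.
apply: (@le_trans _ _ (\sum_(l < d) (r / 2) ^+ 2)).
  apply: ler_sum => l _; rewrite tnth_vec_add partial_sum_pdiff tnth_origin.
  have := zb l; rewrite /a /b => /andP[z1 z2].
  rewrite -[leLHS]real_normK ?num_real// ler_sqr ?nnegrE ?divr_ge0 ?(ltW r0)//.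
  by rewrite ler_norml ?subr0; apply/andP; split; lra.
rewrite sumr_const card_ord d2; nra.
Qed.

(** At time i the target is at the diffusive scale with probability at least c0, and for such a
    target path the node is near it with probability at least c1^2 / i. The harmonic sum gives ln t;
    time 0 is dropped. *)
Lemma green_ge (y : vec) : (0 < t)%N -> inball r y ->
  ((c0 * c1 ^+ 2 * ln t%:R)%:E <= green r zeta t y)%E.
Proof.
move=> t0 yb.
have cc : 0 <= c0 * c1 ^+ 2 by rewrite mulr_ge0// sqr_ge0.
apply: (@le_trans _ _ (\sum_(1 <= i < t) (c0 * (c1 ^+ 2 / i%:R))%:E)%E).
  rewrite sumEFin lee_fin; under eq_bigr do rewrite mulrA.
  by rewrite -mulr_sumr ler_wpM2l// harmonic_ge.
have mv i : measurable_fun setT (fun z : path => (visits r y i z)%:E).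
  by apply/measurable_EFinP; exact: measurable_visits.
rewrite /green; under eq_integral do rewrite -sumEFin.
rewrite ge0_integral_sum//; last by move=> i z _; rewrite lee_fin.
rewrite -(big_mkord xpredT (fun i => \int[powm zeta t]_z (visits r y i z)%:E)%E).
rewrite [leRHS](@big_cat_nat _ _ _ 1)//=.
rewrite -[leLHS]add0e; apply: leeD.
  by apply: sume_ge0 => i _; apply: integral_ge0 => z _; rewrite lee_fin.
rewrite big_nat [leRHS]big_nat; apply: lee_sum => i /andP[i0 it].
rewrite -(conv_powm zetaE)//; last by move=> z; rewrite lee_fin.
pose G := [set g : path | forall l, - (s * Num.sqrt i%:R) <= tnth (partial_sum g i) l <= s * Num.sqrt i%:R].
have mG : measurable G by exact: measurable_path_box.
have c12 : 0 <= c1 ^+ 2 / i%:R by rewrite divr_ge0 ?sqr_ge0.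
apply: (@le_trans _ _ (\int[powm nu t]_g ((c1 ^+ 2 / i%:R)%:E * (\1_G g)%:E))%E).
  rewrite ge0_integralZl ?lee_fin//; last first.
    by apply/measurable_EFinP; exact: measurable_indic.
  rewrite integral_indic ?setIT// mulrC EFinM; apply: lee_wpmul2l; rewrite ?lee_fin//.
  by apply: hnu; rewrite i0.
apply: ge0_le_integral => //.
- by move=> g _; rewrite mule_ge0 ?lee_fin.
- by apply: measurable_funeM; apply/measurable_EFinP; exact: measurable_indic.
- apply: (@measurable_fun_fubini_tonelli_F _ _ _ _ R (powm (gauss d s) t)
    (fun z : path * path => (visits r y i (pdiff z.2 z.1))%:E)).
    apply: (@measurableT_comp _ _ _ _ _ _ (fun z : path => (visits r y i z)%:E)) => //.
    exact: measurable_pdiff.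
  by move=> z; rewrite lee_fin.
move=> g _; rewrite indicE; case: (boolP (g \in _)) => gG.
  by rewrite mule1; apply: visits_ge; rewrite ?i0//; move: gG; rewrite inE.
by rewrite mule0; apply: integral_ge0 => z _; rewrite lee_fin.
Qed.

Lemma mean_hit_volume_le : (0 < t)%N ->
  ((c0 * c1 ^+ 2 * ln t%:R)%:E * \int[powm nu t]_g hit_volume s r g <= (2 * t%:R)%:E)%E.
Proof.
move=> t0; rewrite integral_hit_volume; apply: integral_meet_prob => //.
  by apply: mulr_ge0; [rewrite mulr_ge0// sqr_ge0|rewrite ln_ge0// ler1n].
by move=> y; exact: green_ge.
Qed.

End mean_hitting_volume.

(** * Survival probability *)

Section probability_lemmas.
Context {R : realType} {dO : measure_display} {O : measurableType dO}.
Variable P : probability O R.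

Lemma jensen_expRN (Y : O -> R) (M : R) : measurable_fun setT Y -> (forall w, 0 <= Y w) ->
  (\int[P]_w (Y w)%:E <= M%:E)%E -> ((expR (- M))%:E <= \int[P]_w (expR (- Y w))%:E)%E.
Proof.
move=> mY Y0 YM.
have M0 : 0 <= M.
  by rewrite -lee_fin; apply: le_trans YM; apply: integral_ge0 => w _; rewrite lee_fin.
have e0 : 0 < expR (- M) by exact: expR_gt0.
have mE : measurable_fun setT (fun w => (expR (- Y w))%:E).
  apply/measurable_EFinP; apply: measurableT_comp => //; exact: measurableT_comp.
have mZ : measurable_fun setT (fun w => ((expR (- M))%:E * (Y w)%:E)%E).
  by apply: measurable_funeM; exact/measurable_EFinP.
have E0 w : (0 <= (expR (- Y w))%:E)%E by rewrite lee_fin expR_ge0.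
have Z0 w : (0 <= (expR (- M))%:E * (Y w)%:E)%E by rewrite mule_ge0 ?lee_fin// ltW.
(* exp lies above its tangent at - M *)
have tangent w : expR (- M) * (1 + M) <= expR (- Y w) + expR (- M) * Y w.
  have -> : expR (- Y w) = expR (- M) * expR (M - Y w) by rewrite -expRD; congr expR; ring.
  by rewrite -mulrDr ler_pM2l//; have := expR_ge1Dx (M - Y w); lra.
have : ((expR (- M) * (1 + M))%:E <=
    \int[P]_w ((expR (- Y w))%:E + (expR (- M))%:E * (Y w)%:E))%E.
  have -> : (expR (- M) * (1 + M))%:E = (\int[P]_w (expR (- M) * (1 + M))%:E)%E.
    by rewrite integral_cst// [X in (_ * X)%E]probability_setT mule1.
  apply: ge0_le_integral => //.
  - by move=> w _; rewrite lee_fin mulr_ge0// ?addr_ge0// ltW.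
  - exact: emeasurable_funD.
  - by move=> w _; rewrite lee_fin.
rewrite ge0_integralD// ge0_integralZl ?lee_fin//; last 2 first.
- exact/measurable_EFinP.
- by move=> w _; rewrite lee_fin.
have IE : (\int[P]_w (expR (- Y w))%:E)%E \is a fin_num.
  rewrite ge0_fin_numE ?integral_ge0//; apply: (@le_lt_trans _ _ (\int[P]_w (cst 1%E w))%E).
    apply: ge0_le_integral => //.
    by move=> w _; rewrite lee_fin -expR0 ler_expR oppr_le0.
  by rewrite integral_cst// mul1e; exact: le_lt_trans (probability_le1 P measurableT) (ltry 1).
have IY : (\int[P]_w (Y w)%:E)%E \is a fin_num.
  rewrite ge0_fin_numE ?integral_ge0//; first exact: le_lt_trans YM (ltry _).
  by move=> w _; rewrite lee_fin.
move: YM; rewrite -(fineK IE) -(fineK IY) -EFinM -EFinD !lee_fin => YM h.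
nra.
Qed.

Lemma ae_le_probability (A B : set O) : measurable A -> measurable B ->
  {ae P, forall w, A w -> B w} -> (P A <= P B)%E.
Proof.
move=> mA mB [N [mN N0 sub]].
apply: (@le_trans _ _ (P (B `|` N))).
  apply: le_measure; rewrite ?inE//; first exact: measurableU.
  move=> w Aw; have [Bw|nB] := pselect (B w); first by left.
  by right; apply: sub => /(_ Aw).
by apply: (le_trans (measureU2 _ mB mN)); rewrite [X in (_ + X)%E]N0 adde0.
Qed.

Lemma ae_eq_probability (A B : set O) : measurable A -> measurable B ->
  {ae P, forall w, A w <-> B w} -> P A = P B.
Proof.
move=> mA mB AB; apply/eqP; rewrite eq_le; apply/andP; split;
by apply: ae_le_probability => //; apply: filterS AB => w [].
Qed.

Lemma brownian_start (d : nat) (s : R) (B : R -> {mfun O >-> d.-tuple R}) :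
  is_brownian P s B -> {ae P, forall w, B 0 w = origin d}.
Proof.
move=> [hB _].
have : {ae P, forall w, forall l : 'I_d, tnth (B 0 w) l = 0}.
  by apply: filter_forall => l; have [] := hB l.
by apply: filterS => w h; apply: eq_from_tnth => l; rewrite h tnth_origin.
Qed.

End probability_lemmas.

(** Serves the fixed target, whose steps are all null. *)
Lemma powm_dirac (R : realType) d (T : measurableType d) (x : T) n
    (f : n.-tuple T -> \bar R) : measurable_fun setT f -> (forall z, 0 <= f z)%E ->
  (\int[powm (\d_x : {sigma_finite_measure set T -> \bar R}) n]_z f z = f [tuple x | _ < n])%E.
Proof.
elim: n f => [|n ih] f mf f0.
  by rewrite powm_integral0//; congr f; exact: esym (tuple0 _).
rewrite powm_integralS// integral_dirac//; last first.
  apply: (@measurable_fun_fubini_tonelli_F _ _ _ _ R (powm _ n) (f \o @tcons _ T n)).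
    by apply: measurableT_comp => //; exact: measurable_tcons.
  by move=> z; exact: f0.
rewrite diracT mul1e ih//; last by apply: measurableT_comp => //; exact: measurable_cons.
congr f; apply: eq_from_tnth => i; rewrite tnth_mktuple.
case: (unliftP ord0 i) => [j ->|->//].
by rewrite tnthS tnth_mktuple.
Qed.

Section detection.
Context {R : realType} {dO : measure_display} {O : measurableType dO}.
Variables (P : probability O R) (d : nat) (lambda s r : R).
Hypotheses (lambda0 : 0 < lambda) (s0 : 0 < s) (r0 : 0 < r).
Hypothesis v1 : vol (eball (origin d) r) = 1%E.
Variables (X : nat -> {mfun O >-> d.-tuple R})
          (B : nat -> R -> {mfun O >-> d.-tuple R})
          (u : R -> {mfun O >-> d.-tuple R}).
Hypothesis hmgg : is_mgg P X B lambda s.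
Hypothesis htar : is_target P X B u s.
Variable t : nat.
Local Notation path := (t.-tuple (d.-tuple R)).

Definition target_path (w : O) : path := path_increments t (fun i => u i%:R w).

Lemma measurable_target_path : measurable_fun setT target_path.
Proof. exact: (@measurable_path_increments _ _ O d t (fun i => u i%:R)). Qed.

Lemma target_start : {ae P, forall w, u 0 w = origin d}.
Proof.
have [[fix_u|bu] _] := htar; last exact: brownian_start bu.
by apply: aeW => w; exact: fix_u.
Qed.

(* A lower bound for the probability that the target is in the box of half side
   s sqrt i at time i, valid for both kinds of target. *)
Definition box_prob : R := (2 / 3 * expR (- (s ^+ 2 / (s ^+ 2 *+ 2)))) ^+ d.

(** The common form of the two kinds of target that the bound on the mean hit volume requires:
    identically distributed independent steps, null or Gaussian, whose sum at time i stays at the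
    scale sqrt i with probability bounded below. *)
Lemma target_law : exists nu : {sigma_finite_measure set (d.-tuple R) -> \bar R},
  [/\ nu setT = 1%E,
      (forall f : path -> \bar R, measurable_fun setT f -> (forall z, 0 <= f z)%E ->
        \int[P]_w f (target_path w) = \int[powm nu t]_g f g)%E &
      forall i, (0 < i < t)%N -> (box_prob%:E <= powm nu t
        [set g : path | forall l, - (s * Num.sqrt i%:R) <= tnth (partial_sum g i) l
                                  <= s * Num.sqrt i%:R]%R)%E].
Proof.
have [[fix_u|bu] _] := htar.
- exists \d_(origin d : d.-tuple R); split; first exact: diracT.
    move=> f mf f0; rewrite powm_dirac//.
    rewrite (_ : (fun w => _) = cst (f [tuple origin d | _ < t])).
      by rewrite integral_cst// [X in (_ * X)%E]probability_setT mule1.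
    apply/funext => w; congr f; apply: eq_from_tnth => m; rewrite !tnth_mktuple !fix_u//.
    by apply: eq_from_tnth => l; rewrite !tnth_mktuple subrr.
  move=> i _.
  pose G := [set g : path | forall l, - (s * Num.sqrt i%:R) <= tnth (partial_sum g i) l <= s * Num.sqrt i%:R].
  have mG : measurable G by exact: measurable_path_box.
  rewrite -/G (_ : powm _ _ G = \int[powm \d_(origin d : d.-tuple R) t]_z (\1_G z)%:E)%E; last first.
    by rewrite integral_indic ?setIT.
  rewrite powm_dirac; last 2 first.
  - by apply/measurable_EFinP; exact: measurable_indic.
  - by move=> z; rewrite lee_fin.
  rewrite indicE mem_set; last first.
    move=> l; rewrite tnth_mktuple big1 ?oppr_le0 ?mulr_ge0// ?ltW//.
    by move=> m _; rewrite !tnth_mktuple.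
  rewrite lee_fin /box_prob; apply: exprn_ile1; first by rewrite mulr_ge0 ?expR_ge0.
  rewrite -[leRHS]mulr1 ler_pM ?expR_ge0//; first lra.
  by rewrite -expR0 ler_expR oppr_le0 divr_ge0 ?mulrn_wge0 ?sqr_ge0.
- exists (gauss d s); split.
  + by apply: powm_setT; exact: probability_setT.
  + move=> f mf f0.
    have := @ge0_integral_pushforward _ _ _ _ R _ measurable_target_path P setT f measurableT mf.
    rewrite preimage_setT => <- //.
    pose m1 := measure_function_pushforward__canonical__measure_function_Measure
      P measurable_target_path.
    apply: (@eq_measure_integral _ _ _ _ _ m1) => A mA _.
    exact (increments_law bu mA).
  move=> i /andP[i0 it]; have sq0 : 0 < Num.sqrt i%:R :> R by rewrite sqrtr_gt0 ltr0n.
  (* The side of the box is 2 s sqrt i; divided by 3 s and by sqrt i it gives the factor 2 / 3 of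
     [box_prob], independent of i. *)
  have -> : box_prob = (2 * s * Num.sqrt i%:R / (3 * s) * expR (- (s ^+ 2 / (s ^+ 2 *+ 2))) / Num.sqrt i%:R) ^+ d.
    by rewrite /box_prob; congr (_ ^+ _); field; rewrite !gt_eqF.
  apply: (path_box_ge s0 bu (M := s)) => //.
  + by rewrite i0 ltnW.
  + by rewrite !mulr_ge0// ltW.
  + by move=> l; ring.
Qed.

Lemma detection_event w : (t%:R%:E <= Tdet X B u r w)%E <->
  (forall n (i : 'I_t), ~ detects X B u r n i w).
Proof.
split.
  move=> h n i hd; move: h; apply/negP; rewrite -ltNge.
  apply: (@le_lt_trans _ _ (i%:R%:E)); last by rewrite lte_fin ltr_nat.
  by apply: ereal_inf_lbound; exists i => //; exists n.
move=> h; apply/ereal_infP => _ [i [n hd] <-].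
rewrite lee_fin ler_nat leqNgt; apply/negP => it.
exact: (h n (Ordinal it)).
Qed.

(** Detection concerns actual positions, whereas [hit] sees displacements from the value at time 0.
    They agree when all motions start at the origin, which for Brownian motions holds only almost
    surely; countably many null sets are discarded. *)
Lemma survival_probability :
  P [set w | (t%:R%:E <= Tdet X B u r w)%E] =
  (\int[P]_w (expR (- (lambda * fine (hit_volume s r (target_path w)))))%:E)%E.
Proof.
have [_ iU] := htar; have [_ hB _] := hmgg.
rewrite -(void_probability (t := t) lambda0 r0 v1 hmgg measurable_target_path); last first.
  move=> A C mC sA; apply: iU => //; apply: sigma_pre => //.
  apply: (@measurable_path_increments _ _ (g_sigma_algebraType _) d t (fun i => u i%:R)) => i.
  by apply: (@measurable_sigma_process _ _ R [set t : R | 0 <= t] _ _ _ (fun t w => u t w)) => /=.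
rewrite (_ : [set w | (_ <= _)%E] = [set w | forall n (i : 'I_t), ~ detects X B u r n i w]); last first.
  by apply/seteqP; split => w /detection_event.
have mnode n (i : nat) : measurable_fun setT (node_pos X B n i) by exact: measurable_vec_add.
apply: ae_eq_probability.
- rewrite (_ : [set w | _] = \bigcap_n \bigcap_(i in [set: 'I_t]) ~` [set w | detects X B u r n i w]).
    apply: bigcap_measurable => // n _; apply: fin_bigcap_measurable => // i _.
    by apply: measurableC; apply: measurable_edist_le.
  by apply/seteqP; split => w; [move=> h n _ i _; exact: h|move=> h n i; exact: h].
- rewrite (_ : [set w | _] = \bigcap_n ~` [set w | hit r (X n w)
      (path_increments t (fun i => B n i%:R w)) (target_path w)]).
    apply: bigcap_measurable => // n _; apply: measurableC; apply: measurable_hit => //.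
      exact: (@measurable_path_increments _ _ O d t (fun i => B n i%:R)).
    exact: measurable_target_path.
  by apply/seteqP; split => w; [move=> h n _; exact: h|move=> h n; exact: h].
have Bst : {ae P, forall w, forall n, B n 0 w = origin d}.
  by apply: ae_foralln => n; exact: brownian_start.
have := target_start; apply: filterS2 Bst => w Bw uw.
have E n (i : 'I_t) : detects X B u r n i w <-> Defs.edist (vec_add (X n w)
    (partial_sum (path_increments t (fun i => B n i%:R w)) i)) (partial_sum (target_path w) i) <= r.
  by rewrite /target_path !partial_sum_increments ?(ltnW (ltn_ord i)).
split => h n; first by move=> [i /E hi]; exact: (h n i).
by move=> i /E hi; apply: (h n); exists i.
Qed.

Let hVfin g : hit_volume s r (g : path) \is a fin_num.
Proof. by rewrite ge0_fin_numE ?hit_volume_ge0//; exact: le_lt_trans (hit_volume_le s r0 g v1) (ltry _). Qed.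

Let mhV : measurable_fun setT (fun w => fine (hit_volume s r (target_path w))).
Proof.
apply: (@measurableT_comp _ _ _ _ _ _ (@fine R)) => //.
by apply: measurableT_comp measurable_target_path; exact: measurable_hit_volume.
Qed.

Lemma survival_le (v : R) : (forall g : path, (v%:E <= hit_volume s r g)%E) ->
  (P [set w | (t%:R%:E <= Tdet X B u r w)%E] <= (expR (- (lambda * v)))%:E)%E.
Proof.
move=> hv; rewrite survival_probability.
rewrite (_ : (expR (- (lambda * v)))%:E = \int[P]_w (expR (- (lambda * v)))%:E)%E; last first.
  by rewrite integral_cst// [X in (_ * X)%E]probability_setT mule1.
apply: ge0_le_integral => //.
- apply/measurable_EFinP; apply: measurableT_comp => //; apply: measurableT_comp => //.
  exact: measurable_funM.
- by move=> w _; rewrite lee_fin ler_expR lerN2 ler_pM2l// -lee_fin fineK.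
Qed.

Lemma survival_ge (v : R) : (\int[P]_w hit_volume s r (target_path w) <= v%:E)%E ->
  ((expR (- (lambda * v)))%:E <= P [set w | (t%:R%:E <= Tdet X B u r w)%E])%E.
Proof.
move=> hv; rewrite survival_probability; apply: jensen_expRN.
- exact: measurable_funM.
- by move=> w; rewrite mulr_ge0 ?fine_ge0 ?hit_volume_ge0// ltW.
under eq_integral do rewrite EFinM.
rewrite ge0_integralZl ?lee_fin ?(ltW lambda0)//; last 2 first.
- exact/measurable_EFinP.
- by move=> w _; rewrite lee_fin fine_ge0// hit_volume_ge0.
rewrite EFinM lee_pmul2l//; apply: le_trans hv.
by rewrite le_eqVlt; apply/orP; left; apply/eqP; apply: eq_integral => w _; rewrite fineK.
Qed.

End detection.

Section survival_constants.
Context {R : realType}.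
Variables (d : nat) (lambda s r : R).
Hypotheses (lambda0 : 0 < lambda) (s0 : 0 < s) (r0 : 0 < r).
Hypothesis v1 : vol (eball (origin d) r) = 1%E.

(** The numerator 2 is that of the horizon 2 t in the first-passage bound; the denominator is the
    constant in front of ln t in the lower bound on the Green function. *)
Definition mean_rate : R :=
  2 / (box_prob d s * (r / (3 * s) * expR (- ((s + 2 * r) ^+ 2 / (s ^+ 2 *+ 2)))) ^+ 2).

Lemma mean_rate_gt0 : 0 < mean_rate.
Proof.
rewrite divr_gt0// mulr_gt0//.
  by rewrite exprn_gt0// mulr_gt0 ?expR_gt0.
by rewrite exprn_gt0// mulr_gt0 ?expR_gt0// divr_gt0// mulr_gt0.
Qed.

Context {dO : measure_display} {O : measurableType dO}.
Variables (P : probability O R) (X : nat -> {mfun O >-> d.-tuple R})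
          (B : nat -> R -> {mfun O >-> d.-tuple R})
          (u : R -> {mfun O >-> d.-tuple R}).
Hypothesis hmgg : is_mgg P X B lambda s.
Hypothesis htar : is_target P X B u s.
Variable t : nat.

Local Notation survival := (P [set w | (t%:R%:E <= Tdet X B u r w)%E]).
Local Notation kappa := (4 * r / s).

(** The motion of one node serves as a concrete realisation of the Gaussian walk, on which its
    increments over several steps are read as normal variables. *)
Let hB : is_brownian P s (B 0). Proof. by have [_ + _] := hmgg; exact. Qed.

Lemma survival2_le : d = 2%N -> (4 <= t)%N ->
  (survival <= (expR (- (lambda / (2 * (1 + 2 * kappa ^+ 2)) * (t%:R / ln t%:R))))%:E)%E.
Proof.
move=> d2 t4.
have -> k l : lambda / k * (t%:R / l) = lambda * (t%:R / (k * l)).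
  by rewrite invfM -!mulrA; congr (_ * _); rewrite mulrCA.
by apply: (survival_le lambda0 r0 v1 hmgg htar) => g; exact: (hit_volume_ge2 s0 r0 v1 hB g d2 t4).
Qed.

Lemma survival3_le : (3 <= d)%N ->
  (survival <= (expR (- (lambda / (2 * (1 + 3 * kappa ^+ 3)) * t%:R)))%:E)%E.
Proof.
move=> d3.
rewrite -mulrA (mulrC _^-1).
by apply: (survival_le lambda0 r0 v1 hmgg htar) => g; exact: (hit_volume_ge3 s0 r0 v1 hB g d3).
Qed.

Lemma survival_ge_linear : ((expR (- (lambda * t%:R)))%:E <= survival)%E.
Proof.
apply: (survival_ge lambda0 r0 v1 hmgg htar).
apply: (@le_trans _ _ (\int[P]_w (cst t%:R%:E w))%E); last first.
  by rewrite integral_cst// [X in (_ * X)%E]probability_setT mule1.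
apply: ge0_le_integral => //.
- by move=> w _; exact: hit_volume_ge0.
- exact: measurableT_comp (measurable_hit_volume s r0) (@measurable_target_path _ _ _ d u t).
- by move=> w _; exact: hit_volume_le.
Qed.

Lemma survival2_ge : d = 2%N -> (2 <= t)%N ->
  ((expR (- (lambda * mean_rate * (t%:R / ln t%:R))))%:E <= survival)%E.
Proof.
move=> d2 t2; rewrite -[lambda * _ * _]mulrA.
apply: (survival_ge lambda0 r0 v1 hmgg htar).
have lt0 : 0 < ln t%:R :> R by rewrite ln_gt0// ltr1n.
have [nu [nu1 nuE hnu]] := target_law s0 htar t.
have g1 : gauss d s setT = 1%E by apply: powm_setT; exact: probability_setT.
have [zeta [zeta1 zetaE]] := step_law g1 nu1.
rewrite nuE; last 2 first.
- exact: measurable_hit_volume.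
- by move=> g; exact: hit_volume_ge0.
have bp : 0 < box_prob d s by rewrite exprn_gt0// mulr_gt0 ?expR_gt0.
have := mean_hit_volume_le s0 r0 v1 hB zeta1 zetaE d2 (ltW bp) hnu (ltnW t2).
set c := box_prob d s * _ ^+ 2.
have c0 : 0 < c.
  by rewrite /c mulr_gt0// exprn_gt0// mulr_gt0 ?expR_gt0// divr_gt0// mulr_gt0.
rewrite /mean_rate -/c; clearbody c.
have cl : 0 < c * ln t%:R by rewrite mulr_gt0.
rewrite -lee_pdivlMl// => h; apply: le_trans h _.
rewrite -EFinM lee_fin le_eqVlt; apply/orP; left; apply/eqP.
by field; rewrite !gt_eqF.
Qed.

End survival_constants.

Theorem theorem1p1 (R : realType) (d : nat) (lambda s r : R)
    (hd : (2 <= d)%N) (hlambda : 0 < lambda) (hs : 0 < s)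
    (hr : 0 < r) (hvol : vol (eball (origin d) r) = 1%E) :
  exists (c C : R) (t0 : nat), 0 < c /\ c <= C /\
    forall (dO : measure_display) (O : measurableType dO)
      (P : probability O R)
      (X : nat -> {mfun O >-> d.-tuple R})
      (B : nat -> R -> {mfun O >-> d.-tuple R})
      (u : R -> {mfun O >-> d.-tuple R}),
    is_mgg P X B lambda s -> is_target P X B u s ->
    forall t : nat, (t0 <= t)%N ->
      (d = 2%N ->
        ((expR (- (C * (t%:R / ln t%:R))))%:E
           <= P [set w | (t%:R%:E <= Tdet X B u r w)%E]
           <= (expR (- (c * (t%:R / ln t%:R))))%:E)%E) /\
      ((3 <= d)%N ->
        ((expR (- (C * t%:R)))%:E
           <= P [set w | (t%:R%:E <= Tdet X B u r w)%E]
           <= (expR (- (c * t%:R)))%:E)%E).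
Proof.
pose a2 := lambda / (2 * (1 + 2 * (4 * r / s) ^+ 2)).
pose a3 := lambda / (2 * (1 + 3 * (4 * r / s) ^+ 3)).
pose b2 := lambda * mean_rate d s r.
have k0 : 0 <= 4 * r / s by rewrite divr_ge0 ?mulr_ge0// ltW.
have a20 : 0 < a2 by rewrite divr_gt0// mulr_gt0// ltr_pwDl// mulr_ge0// exprn_ge0.
have a30 : 0 < a3 by rewrite divr_gt0// mulr_gt0// ltr_pwDl// mulr_ge0// exprn_ge0.
have b20 : 0 < b2 by rewrite mulr_gt0// mean_rate_gt0.
(* One pair of constants serves all dimensions: c is below both upper-bound rates, C is above both
   lower-bound rates, and the summand a2 in C secures c <= C. *)
pose c := Num.min a2 a3; pose C := a2 + b2 + lambda.
have c0 : 0 < c by rewrite lt_min a20.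
have ca2 : c <= a2 by rewrite ge_min lexx.
have ca3 : c <= a3 by rewrite ge_min lexx orbT.
exists c, C, 4%N; split=> //; split; first by rewrite /C; lra.
move=> dO O P X B u hmgg htar t t4.
have dec (x y z : R) : 0 <= z -> x <= y -> ((expR (- (y * z)))%:E <= (expR (- (x * z)))%:E)%E.
  by move=> z0 xy; rewrite lee_fin ler_expR lerN2 ler_wpM2r.
split=> hd'; apply/andP; split.
- have tl : 0 <= t%:R / ln t%:R :> R.
    by rewrite divr_ge0// ln_ge0// ler1n (leq_trans _ t4).
  apply: le_trans (survival2_ge hlambda hs hr hvol hmgg htar hd' (leq_trans _ t4)) => //.
  by apply: dec => //; rewrite /C -/b2; lra.
- have tl : 0 <= t%:R / ln t%:R :> R.
    by rewrite divr_ge0// ln_ge0// ler1n (leq_trans _ t4).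
  apply: le_trans (survival2_le hlambda hs hr hvol hmgg htar hd' t4) _.
  exact: dec.
- apply: le_trans (survival_ge_linear hlambda hr hvol hmgg htar t).
  by apply: dec => //; rewrite /C; lra.
- apply: le_trans (survival3_le hlambda hs hr hvol hmgg htar t hd') _.
  exact: dec.
Qed.
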